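(* Let $\mathcal L$ be the class of second-order linear ODEs $x''+a_1(t)x'+a_0(t)x=b(t)$ with arbitrary smooth coefficients $a_1,a_0,b$. The equivalence groupoid of $\mathcal L$ is generated by compositions of transformations from the equivalence group $G^\sim$ of $\mathcal L$ with transformations from the point symmetry group of the equation $x''=0$. Therefore, the class $\mathcal L$ is semi-normalized but not normalized.
   Context: The underlying field $\mathbb F$ is $\mathbb R$ or $\mathbb C$; all variables, functions and constants are real or complex, respectively. $x=x(t)$ is the unknown function. Everything is local: functions and transformations are smooth and considered on suitable open domains. A point transformation is a transformation $\tilde t=T(t,x)$, $\tilde x=X(t,x)$ with nonvanishing Jacobian $\partial(T,X)/\partial(t,x)$; it acts on ODEs via prolongation to derivatives. The arbitrary elements of a class of ODEs are the functions (coefficients, right-hand side) parameterizing it. An admissible transformation of a class is a triple $(\mathcal E,\tilde{\mathcal E},\mathcal T)$, where $\mathcal E$ and $\tilde{\mathcal E}$ are equations of the class and $\mathcal T$ (the transformational part) is a point transformation mapping $\mathcal E$ to $\tilde{\mathcal E}$. The equivalence groupoid of the class is the set of all its admissible transformations with composition. The (usual) equivalence (pseudo)group of the class consists of the point transformations in the joint space of $t$, $x$, the derivatives of $x$ and the arbitrary elements that are consistent with the contact structure (the components for derivatives are obtained by prolongation), are projectable to the $(t,x)$-space (the components for $t$ and $x$ depend only on $(t,x)$), and map every equation of the class to an equation of the class. An equivalence transformation generates the admissible transformations $(\mathcal E,\tilde{\mathcal E},\mathcal T)$ in which $\mathcal T$ is its projection to the $(t,x)$-space, $\mathcal E$ is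 any equation of the class and $\tilde{\mathcal E}$ is the image of $\mathcal E$. A class is normalized if its equivalence group generates its entire equivalence groupoid. A class is semi-normalized if for every admissible transformation $(\mathcal E,\tilde{\mathcal E},\mathcal T)$, $\mathcal T$ is the composition of a point symmetry transformation of $\mathcal E$ followed by the projection of an equivalence transformation. In the claim, ''generated by compositions'' means that the transformational part of each admissible transformation $(\mathcal E_1,\mathcal E_2,\mathcal T)$ is of the form $\mathcal T=\mathcal T_2^{-1}\mathcal T_0\mathcal T_1$, where $\mathcal T_1$, $\mathcal T_2$ are projections of equivalence transformations mapping $\mathcal E_1$, $\mathcal E_2$, respectively, to $x''=0$, and $\mathcal T_0$ is a point symmetry transformation of $x''=0$. *)

(* Defs.v *)
From HB Require Import structures.
From mathcomp Require Import all_boot all_order all_algebra.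
From mathcomp Require Import all_classical all_reals all_analysis.
From mathcomp Require Import complex.

Set Implicit Arguments.
Unset Strict Implicit.
Unset Printing Implicit Defensive.

Import Order.TTheory GRing.Theory Num.Theory.
Import numFieldNormedType.Exports.

Local Open Scope classical_set_scope.
Local Open Scope ring_scope.

(* C^oo on an open set: every iterated directional derivative is Frechet
   differentiable.  Over K = R[i], 'D_v is the complex derivative, so smooth
   means holomorphic. *)
Definition smooth_on (K : numFieldType) (V W : normedModType K)
    (D : set V) (f : V -> W) : Prop :=
  forall (s : seq V) (x : V), D x ->
    differentiable (foldr (fun v g => 'D_v g) f s) x.

(* As usual for pseudogroups, nothing is required beyond the nonvanishing
   Jacobian; in particular [tfun] need not be injective on [tdom], and its
   values outside [tdom] are irrelevant. *)
Record transf (K : numFieldType) (n : nat) := Transf {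
  tdom : set 'rV[K]_n;
  tfun :> 'rV[K]_n -> 'rV[K]_n;
  tdom_open : open tdom;
  tfun_smooth : smooth_on tdom tfun;
  tfun_jacobian : forall z, tdom z -> \det ('J tfun z) != 0 }.

Definition inverse_transf (K : numFieldType) (n : nat) (S T : transf K n) :
    Prop :=
  tdom S = T @` tdom T /\ forall z, tdom T z -> S (T z) = z.

(* The (t, x)-space is 'rV_2, the space of (x', x'') is 'rV_2, and the space of
   values of the arbitrary elements (a1, a0, b) is 'rV_3. *)
Definition row2 (K : numFieldType) (u v : K) : 'rV[K]_2 :=
  \row_i [:: u; v]`_i.

Definition row3 (K : numFieldType) (u v w : K) : 'rV[K]_3 :=
  \row_i [:: u; v; w]`_i.

Definition comp0 (K : numFieldType) (z : 'rV[K]_2) : K := z 0 0.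
Definition comp1 (K : numFieldType) (z : 'rV[K]_2) : K := z 0 1.

Definition joint (K : numFieldType) (z d : 'rV[K]_2) (a : 'rV[K]_3) :
    'rV[K]_(2 + (2 + 3)) := row_mx z (row_mx d a).

Definition base_part (K : numFieldType) (j : 'rV[K]_(2 + (2 + 3))) :
  'rV[K]_2 := lsubmx j.
Definition deriv_part (K : numFieldType) (j : 'rV[K]_(2 + (2 + 3))) :
  'rV[K]_2 := lsubmx (rsubmx j).
Definition arb_part (K : numFieldType) (j : 'rV[K]_(2 + (2 + 3))) :
  'rV[K]_3 := rsubmx (rsubmx j).

(* The total derivatives D_t f = f_t + x' f_x and
   D_t^2 f = f_tt + 2 x' f_tx + x'^2 f_xx + x'' f_x of a function f of (t, x),
   where p = x' and q = x''. *)
Definition total1 (K : numFieldType) (f : 'rV[K]_2 -> K^o) (z : 'rV[K]_2)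
    (p : K) : K := 'D_(row2 1 p) f z.

Definition total2 (K : numFieldType) (f : 'rV[K]_2 -> K^o) (z : 'rV[K]_2)
    (p q : K) : K :=
  'D_(row2 1 p) ('D_(row2 1 p) f) z + q * 'D_(row2 0 1) f z.

Section prolongation.
Context (K : numFieldType) (F : 'rV[K]_2 -> 'rV[K]_2).

Let T (z : 'rV[K]_2) : K^o := comp0 (F z).
Let X (z : 'rV[K]_2) : K^o := comp1 (F z).

(* The prolongation is defined only where D_t T != 0. *)
Definition prol_def (z : 'rV[K]_2) (p : K) : Prop := total1 T z p != 0.

(* x'  |-> D_t X / D_t T *)
Definition prol1 (z : 'rV[K]_2) (p : K) : K := total1 X z p / total1 T z p.

(* x'' |-> D_t (D_t X / D_t T) / D_t T, with the quotient rule expanded *)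
Definition prol2 (z : 'rV[K]_2) (p q : K) : K :=
  (total2 X z p q * total1 T z p - total1 X z p * total2 T z p q)
    / total1 T z p ^+ 3.

End prolongation.

Record linear_ode (K : numFieldType) := LinearOde {
  odom : set K^o;
  oa1 : K^o -> K^o;
  oa0 : K^o -> K^o;
  ob : K^o -> K^o;
  odom_open : open odom;
  oa1_smooth : smooth_on odom oa1;
  oa0_smooth : smooth_on odom oa0;
  ob_smooth : smooth_on odom ob }.

Definition arb_elts (K : numFieldType) (E : linear_ode K) (t : K) :
  'rV[K]_3 := row3 (oa1 E t) (oa0 E t) (ob E t).

(* (t, x, p, q) lies on the submanifold of the second-order jet space given by
   the equation E *)
Definition on_ode (K : numFieldType) (E : linear_ode K) (z : 'rV[K]_2)
    (p q : K) : Prop :=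
  q + oa1 E (comp0 z) * p + oa0 E (comp0 z) * comp1 z = ob E (comp0 z).

Definition maps_at (K : numFieldType) (T : transf K 2) (E E' : linear_ode K)
    (z : 'rV[K]_2) : Prop :=
  [/\ tdom T z, odom E (comp0 z), odom E' (comp0 (T z))
    & forall p q : K, prol_def T z p ->
        (on_ode E z p q <-> on_ode E' (T z) (prol1 T z p) (prol2 T z p q))].

Definition admissible (K : numFieldType) (E E' : linear_ode K)
    (T : transf K 2) : Prop :=
  forall z, tdom T z -> maps_at T E E' z.

Definition point_symmetry (K : numFieldType) (E : linear_ode K)
    (T : transf K 2) : Prop := admissible E E T.

(* The transformation Phi of the joint space, with the projection T to the
   (t, x)-space, acts on the equation E at the point z: some point of the
   joint space over z with the values of arbitrary elements given by E belongs
   to the domain of Phi. *)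
Definition acts_at (K : numFieldType) (Phi : transf K (2 + (2 + 3)))
    (E : linear_ode K) (z : 'rV[K]_2) : Prop :=
  odom E (comp0 z) /\
  exists d, tdom Phi (joint z d (arb_elts E (comp0 z))).

(* E' is the image of E at z: T maps E to E', and the values of the arbitrary
   elements of E' are those given by Phi.  [maps_at] considers all the values of
   (x', x'') over z, and not only those in the domain of Phi; otherwise the
   condition would be void when this domain misses the submanifold E. *)
Definition image_at (K : numFieldType) (Phi : transf K (2 + (2 + 3)))
    (T : transf K 2) (E E' : linear_ode K) (z : 'rV[K]_2) : Prop :=
  [/\ acts_at Phi E z, maps_at T E E' z
    & forall d, tdom Phi (joint z d (arb_elts E (comp0 z))) ->
        arb_part (Phi (joint z d (arb_elts E (comp0 z)))) =
        arb_elts E' (comp0 (T z))].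

Record equiv_transf (K : numFieldType) := EquivTransf {
  ejoint : transf K (2 + (2 + 3));
  eproj : transf K 2;
  eproj_dom : tdom eproj = [set base_part j | j in tdom ejoint];
  eproj_fun : forall j, tdom ejoint j ->
    base_part (ejoint j) = eproj (base_part j);
  econtact : forall z p q a, tdom ejoint (joint z (row2 p q) a) ->
    prol_def eproj z p /\
    deriv_part (ejoint (joint z (row2 p q) a)) =
      row2 (prol1 eproj z p) (prol2 eproj z p q);
  emaps : forall E : linear_ode K, exists E' : linear_ode K,
    forall z, acts_at ejoint E z -> image_at ejoint eproj E E' z }.

Definition sends_at (K : numFieldType) (Phi : equiv_transf K)
    (E E' : linear_ode K) (z : 'rV[K]_2) : Prop :=
  image_at (ejoint Phi) (eproj Phi) E E' z.

Lemma smooth_on_cst (K : numFieldType) (V W : normedModType K) (D : set V)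
  (c : W) : smooth_on D (fun _ : V => c).
Proof.
move=> s x _; suff [c' ->] : exists c' : W,
    foldr (fun v g => 'D_v g) (fun _ : V => c) s = cst c'.
  exact: differentiable_cst.
elim: s => [|v s [c' /= ->]]; first by exists c.
by exists 0; apply/funext => y; rewrite derive_cst.
Qed.

Definition free_ode (K : numFieldType) : linear_ode K :=
  @LinearOde K setT (fun=> 0) (fun=> 0) (fun=> 0) openT
    (@smooth_on_cst K K^o K^o setT 0) (@smooth_on_cst K K^o K^o setT 0)
    (@smooth_on_cst K K^o K^o setT 0).

(* Everything is local, so that equalities of transformations are required
   near each point of the domain of the given admissible transformation. *)

(* T = T2^-1 o T0 o T1, where T1 and T2 are the projections of Phi1 and Phi2
   and S2 is the inverse of T2 *)
Definition groupoid_generated_via_free (K : numFieldType) : Prop :=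
  forall (E1 E2 : linear_ode K) (T : transf K 2), admissible E1 E2 T ->
  forall z0, tdom T z0 ->
  exists (Phi1 Phi2 : equiv_transf K) (T0 S2 : transf K 2),
    [/\ point_symmetry (free_ode K) T0,
        inverse_transf S2 (eproj Phi2)
      & \forall z \near z0,
        [/\ sends_at Phi1 E1 (free_ode K) z,
            sends_at Phi2 E2 (free_ode K) (T z),
            tdom T0 (eproj Phi1 z),
            tdom S2 (T0 (eproj Phi1 z))
          & T z = S2 (T0 (eproj Phi1 z))]].

Definition normalized (K : numFieldType) : Prop :=
  forall (E E' : linear_ode K) (T : transf K 2), admissible E E' T ->
  forall z0, tdom T z0 ->
  exists Phi : equiv_transf K,
    \forall z \near z0, sends_at Phi E E' z /\ T z = eproj Phi z.

Definition semi_normalized (K : numFieldType) : Prop :=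
  forall (E E' : linear_ode K) (T : transf K 2), admissible E E' T ->
  forall z0, tdom T z0 ->
  exists (S : transf K 2) (Phi : equiv_transf K),
    point_symmetry E S /\
    \forall z \near z0,
      [/\ tdom S z, sends_at Phi E E' (S z) & T z = eproj Phi (S z)].

(* Main.v *)
(* Over K = R or C, fundamental solutions u, s of the homogeneous equation with
   u(t0) = s'(t0) = 1, u'(t0) = s(t0) = 0 and a particular solution w with
   w(t0) = x0 give the fibre-affine transformation t~ = s/u, x~ = (x - w)/u,
   which maps the linear equation to x'' = 0 near t0, sends (t0, x0) to (0, 0),
   and is the projection of an equivalence transformation.  Conjugating an
   admissible transformation by two such maps gives a symmetry of x'' = 0, hence
   generation.  If P is the composition of the map for the source at z0 with the
   inverse of the map for the target at T z0, then P z0 = T z0 and P^-1 o T is a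
   symmetry of the source, hence semi-normalization.  The swap (t, x) -> (x, t)
   preserves x'' = 0, but no equivalence transformation projects to it, since it
   maps x'' = e to x'' = - e x'^3, which is not linear for e != 0.

   To treat R and C at once, the analysis only uses completeness: the mean value
   inequality follows by bisection, primitives are limits of Riemann sums,
   solutions are limits of Picard iterates, and local inverses of functions with
   derivative close to 1 are found by successive approximation. *)
From HB Require Import structures.
Require Import Defs.
From mathcomp Require Import all_boot all_order all_algebra.
From mathcomp Require Import all_classical all_reals all_analysis.
From mathcomp Require Import complex ring lra.

Set Implicit Arguments.
Unset Strict Implicit.
Unset Printing Implicit Defensive.

Import Order.TTheory GRing.Theory Num.Theory.
Import numFieldNormedType.Exports.

Local Open Scope classical_set_scope.
Local Open Scope ring_scope.

(** Three requirements of the definitions shape the work. An equivalence transformation must send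
    every linear equation to one with smooth coefficients in the new variable on an open set,
    whereas a map with nonvanishing Jacobian may fail to be injective; hence a [chart] carries a
    smooth inverse of its t-component, and straightening one equation ends with a quantitative local
    inversion. It must also act on all seven joint coordinates with nonvanishing Jacobian and
    prescribed coefficient values, so the push-forward is written out; in the order t, x, x', x'',
    a1, a0, b it is triangular. Finally, the prolongation of a composition may be defined where that
    of its first factor is not, as for two swaps in a row; compositions are therefore formed only
    with fibre-preserving factors. On the analytic side, all convergence is geometric with ratio
    1/2, which reduces limit arguments to linear arithmetic, and Picard iteration stays among
    functions with two bounded derivatives, a class closed under products and primitives and regular
    enough for Riemann sums. *)

Local Notation d1 f := (derive (f : _^o -> _^o) ^~ 1).
Local Notation ord7 k := (@Ordinal (2 + (2 + 3)) k isT).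

(** * Calculus of smooth functions *)

Section NearEq.
Context (K : numFieldType) (V W : normedModType K).

Lemma near_eq_differentiable (f g : V -> W) (x : V) :
  {near x, f =1 g} -> differentiable f x -> differentiable g x.
Proof.
move=> fg df.
have /diff_locallyP [dc /eqaddoP dE] := df.
have gE : g \o shift x = cst (g x) + 'd f x +o_ 0 id.
  apply/eqaddoP => e e0; have := dE e e0.
  have fg0 : \forall h \near (0 : V), f (h + x) = g (h + x).
    by move: fg; rewrite (near_shift 0 x); apply: filterS => h /=; rewrite subr0.
  apply: filter_app; near=> h => /=.
  rewrite /= !fctE /= (nbhs_singleton fg).
  by rewrite (_ : f (h + x) = g (h + x)) //; near: h.
apply/diff_locallyP; rewrite (_ : 'd g x = 'd f x :> (V -> W)).
  by split.
exact: diff_unique.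
Unshelve. all: by end_near. Qed.

End NearEq.

Section IterSmooth.
Context (K : numFieldType) (V : normedModType K) (D : set V).

(* [n]-fold version of [smooth_on], on which one can argue by induction *)
Fixpoint nsmooth (W : normedModType K) (n : nat) (f : V -> W) : Prop :=
  (forall x, D x -> differentiable f x) /\
  (if n is m.+1 then forall v, nsmooth m ('D_v f) else True).

Lemma nsmooth_diff (W : normedModType K) n (f : V -> W) x :
  nsmooth n f -> D x -> differentiable f x.
Proof. by case: n => [|n] [] /(_ x). Qed.

Lemma nsmoothW (W : normedModType K) n (f : V -> W) :
  nsmooth n.+1 f -> nsmooth n f.
Proof.
elim: n f => [|n IHn] f [df Df]; split=> // v.
by apply: IHn; exact: Df.
Qed.

Lemma smooth_onP (W : normedModType K) (f : V -> W) :
  smooth_on D f <-> forall n, nsmooth n f.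
Proof.
split=> [sf n|sf].
  elim: n f sf => [|n IHn] f sf; split=> //; first by move=> x /(sf [::]).
    by move=> x /(sf [::]).
  move=> v; apply: IHn => s x Dx.
  (* [foldr] applies the last direction of the list first, so differentiating along [v] before [s]
     corresponds to [rcons s v]. *)
  by have := sf (rcons s v) x Dx; rewrite foldr_rcons.
move=> s x Dx; have [n] := ubnP (size s).
elim: n s f sf => // n IHn s f sf.
case/lastP: s => [|s v]; first by move=> _; exact: nsmooth_diff (sf 0%N) Dx.
rewrite size_rcons ltnS foldr_rcons => sn; apply: IHn => // m.
by have [_] := sf m.+1; apply.
Qed.

Hypothesis oD : open D.

(** Since [D] is open, equality on [D] is equality near each of its points, hence passes to
    derivatives. The closure rules below replace a derivative by a Leibniz or chain formula valid
    only on [D] and conclude through this lemma. *)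
Lemma nsmooth_eq (W : normedModType K) n (f g : V -> W) :
  (forall x, D x -> f x = g x) -> nsmooth n f -> nsmooth n g.
Proof.
have nD x : D x -> \forall y \near x, D y by move=> Dx; exact: open_nbhs_nbhs.
elim: n f g => [|n IHn] f g fg [df Df]; split=> //.
- move=> x Dx; apply: near_eq_differentiable (df _ Dx).
  by apply: filterS (nD _ Dx).
- move=> x Dx; apply: near_eq_differentiable (df _ Dx).
  by apply: filterS (nD _ Dx).
move=> v; apply: IHn (Df v) => x Dx; apply: near_eq_derive.
by apply: filterS (nD _ Dx).
Qed.

Lemma nsmooth_cst (W : normedModType K) n (c : W) : nsmooth n (fun=> c : W).
Proof. by move: n; apply/smooth_onP/smooth_on_cst. Qed.

Lemma nsmoothD (W : normedModType K) n (f g : V -> W) :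
  nsmooth n f -> nsmooth n g -> nsmooth n (fun x => f x + g x).
Proof.
elim: n f g => [|n IHn] f g [df Df] [dg Dg]; split=> //.
- by move=> x Dx; apply: differentiableD; [exact: df|exact: dg].
- by move=> x Dx; apply: differentiableD; [exact: df|exact: dg].
move=> v; apply: (@nsmooth_eq _ _ (fun x => 'D_v f x + 'D_v g x)).
  move=> x Dx; rewrite -deriveD //; apply: diff_derivable; [exact: df|exact: dg].
exact: IHn (Df v) (Dg v).
Qed.

Lemma nsmooth_sum (W : normedModType K) n m (f : 'I_m -> V -> W) :
  (forall i, nsmooth n (f i)) -> nsmooth n (fun x => \sum_i f i x).
Proof.
move=> sf; rewrite (_ : (fun x => _) = \sum_i f i); last first.
  by apply/funext => x; rewrite fct_sumE.
elim/big_ind: _ => //; first exact: nsmooth_cst.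
by move=> g h; exact: nsmoothD.
Qed.

Lemma nsmoothM n (f g : V -> K^o) :
  nsmooth n f -> nsmooth n g -> nsmooth n (fun x => f x * g x : K^o).
Proof.
elim: n f g => [|n IHn] f g sf sg; move: (sf) (sg) => [df Df] [dg Dg]; split=> //.
- by move=> x Dx; apply: differentiableM; [exact: df|exact: dg].
- by move=> x Dx; apply: differentiableM; [exact: df|exact: dg].
move=> v.
apply: (@nsmooth_eq _ _ (fun x => f x * 'D_v g x + g x * 'D_v f x)).
  move=> x Dx; rewrite [RHS](@deriveM _ _ f g) //; apply: diff_derivable;
    [exact: df|exact: dg].
by apply: nsmoothD; apply: IHn; by [exact: nsmoothW|exact: Dg|exact: Df].
Qed.

Lemma nsmoothN n (f : V -> K^o) :
  nsmooth n f -> nsmooth n (fun x => - f x : K^o).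
Proof.
move=> sf; apply: (@nsmooth_eq _ _ (fun x => -1 * f x)).
  by move=> x _; rewrite mulN1r.
by apply: nsmoothM => //; exact: nsmooth_cst.
Qed.

Lemma nsmoothB n (f g : V -> K^o) :
  nsmooth n f -> nsmooth n g -> nsmooth n (fun x => f x - g x : K^o).
Proof. by move=> sf sg; apply: nsmoothD => //; exact: nsmoothN. Qed.

Lemma nsmoothV n (f : V -> K^o) : (forall x, D x -> f x != 0) ->
  nsmooth n f -> nsmooth n (fun x => (f x)^-1 : K^o).
Proof.
move=> f0; elim: n f f0 => [|n IHn] f f0 sf; move: (sf) => [df Df]; split=> //.
- by move=> x Dx; apply: differentiableV; [exact: df|exact: f0].
- by move=> x Dx; apply: differentiableV; [exact: df|exact: f0].
move=> v.
apply: (@nsmooth_eq _ _ (fun x => - ((f x)^-1 * (f x)^-1 * 'D_v f x))).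
  move=> x Dx; rewrite (@deriveV _ _ f) ?f0 //.
    by rewrite expr2 invfM -mulNr.
  by apply: diff_derivable; exact: df.
apply: nsmoothN; apply: nsmoothM (Df v).
by apply: nsmoothM; apply: IHn => //; exact: nsmoothW.
Qed.

Lemma nsmoothX n m (f : V -> K^o) :
  nsmooth n f -> nsmooth n (fun x => f x ^+ m : K^o).
Proof.
move=> sf; elim: m => [|m IHm]; first exact: nsmooth_cst.
apply: (@nsmooth_eq _ _ (fun x => f x * f x ^+ m)); last exact: nsmoothM.
by move=> x _; rewrite exprS.
Qed.

Lemma nsmooth_scale (W : normedModType K) n (f : V -> K^o) (w : W) :
  nsmooth n f -> nsmooth n (fun x => f x *: w).
Proof.
elim: n f => [|n IHn] f [df Df]; split=> //.
- by move=> x Dx; apply: differentiableZl; exact: df.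
- by move=> x Dx; apply: differentiableZl; exact: df.
move=> v; apply: (@nsmooth_eq _ _ (fun x => 'D_v f x *: w)); last exact: IHn (Df v).
move=> x Dx; rewrite [RHS]deriveE; last by apply: differentiableZl; exact: df.
by rewrite [in LHS]deriveE ?diffZl //; exact: df.
Qed.

Lemma nsmooth_linear (W : normedModType K) n (f : V -> W) : linear f ->
  continuous f -> nsmooth n f.
Proof.
move=> lf cf.
pose fM := GRing.isLinear.Build _ _ _ _ _ lf.
pose F : {linear _ -> _} := HB.pack f fM.
case: n => [|n]; split=> //; move=> x; first by move=> _;
  exact: (@linear_differentiable _ _ _ F).
  by move=> _; exact: (@linear_differentiable _ _ _ F).
rewrite (_ : 'D_x f = (fun=> f x)); first exact: nsmooth_cst.
apply/funext => y; rewrite deriveE; last exact: (@linear_differentiable _ _ _ F).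
by rewrite (@diff_lin _ _ _ F).
Qed.

Lemma derive_coord m n (f : V -> 'M[K]_(m, n)) x v i j :
  differentiable f x -> 'D_v f x i j = 'D_v (fun y => f y i j : K^o) x.
Proof.
move=> df; have dc := @differentiable_coord K m n (f x) i j.
have -> : (fun y => f y i j : K^o) = (fun M : 'M[K]_(m, n) => M i j : K^o) \o f by [].
rewrite !deriveE //; last exact: differentiable_comp.
rewrite (@diff_comp _ _ _ _ f (fun M : 'M[K]_(m, n) => M i j : K^o)) //.
have @c : {linear 'M[K]_(m, n) -> K^o}.
  by exists (fun N : 'M[K]_(_, _) => N i j); do 2![eexists]; do ?[constructor];
     rewrite ?mxE// => ? *; rewrite ?mxE//; move=> ?; rewrite !mxE.
by rewrite -[RHS]/('d c (f x) ('d f x v)) (@diff_lin _ _ _ c) //;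
  exact: coord_continuous.
Qed.

Lemma nsmooth_row n m (f : V -> 'rV[K]_m) :
  (forall j, nsmooth n (fun x => f x 0 j : K^o)) -> nsmooth n f.
Proof.
move=> sf.
apply: (@nsmooth_eq _ _ (fun x => \sum_j (f x 0 j *: delta_mx 0 j))).
  by move=> x _; rewrite [RHS]row_sum_delta.
by apply: nsmooth_sum => j; exact: nsmooth_scale.
Qed.

Lemma nsmooth_coord n m (f : V -> 'rV[K]_m) j :
  nsmooth n f -> nsmooth n (fun x => f x 0 j : K^o).
Proof.
have dcoord g x : differentiable g x ->
    differentiable (fun y => (g : V -> 'rV[K]_m) y 0 j : K^o) x.
  move=> dg; apply: (@differentiable_comp _ _ _ _ g
    (fun M : 'rV[K]_m => M 0 j : K^o)) => //.
  exact: differentiable_coord.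
elim: n f => [|n IHn] f [df Df]; split=> //.
- by move=> x Dx; apply: dcoord; exact: df.
- by move=> x Dx; apply: dcoord; exact: df.
move=> v; apply: (@nsmooth_eq _ _ (fun x => 'D_v f x 0 j)); last exact: IHn (Df v).
by move=> x Dx; rewrite derive_coord //; exact: df.
Qed.

End IterSmooth.

Section Composition.
Context (K : numFieldType) (V : normedModType K) (D : set V) (oD : open D).

(** The chain rule goes through the fixed directions [delta_mx 0 i] instead of the differential,
    because [nsmooth] only controls derivatives along constant directions; this form allows the
    induction in [nsmooth_comp]. *)
Lemma derive_comp_row m (W : normedModType K) (f : V -> 'rV[K]_m)
    (g : 'rV[K]_m -> W) x v :
  differentiable f x -> differentiable g (f x) ->
  'D_v (g \o f) x = \sum_i 'D_v (fun y => f y 0 i : K^o) x *: 'D_(delta_mx 0 i) g (f x).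
Proof.
move=> df dg; rewrite deriveE; last exact: differentiable_comp.
rewrite diff_comp //= -(deriveE _ df) [X in 'd g (f x) X]row_sum_delta linear_sum.
by apply: eq_bigr => i _; rewrite linearZ /= derive_coord // (deriveE _ dg).
Qed.

Lemma nsmooth_comp m n (f : V -> 'rV[K]_m) (D' : set 'rV[K]_m)
    (g : 'rV[K]_m -> K^o) :
  (forall x, D x -> D' (f x)) -> nsmooth D n f -> nsmooth D' n g ->
  nsmooth D n (fun x => g (f x)).
Proof.
move=> DD'; elim: n g => [|n IHn] g sf sg; move: (sf) (sg) => [df Df] [dg Dg].
  by split=> // x Dx; apply: (@differentiable_comp _ _ _ _ f g) => //;
    [exact: df|exact/dg/DD'].
split=> [x Dx|v].
  by apply: (@differentiable_comp _ _ _ _ f g) => //; [exact: df|exact/dg/DD'].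
apply: (@nsmooth_eq _ _ _ _ _ _ (fun x =>
    \sum_i 'D_v (fun y => f y 0 i : K^o) x * 'D_(delta_mx 0 i) g (f x))) => //.
  by move=> x Dx; rewrite [RHS]derive_comp_row //; [exact: df|exact/dg/DD'].
apply: nsmooth_sum => // i; apply: nsmoothM => //.
  by have [_] := nsmooth_coord oD i sf; apply.
exact: IHn (nsmoothW sf) (Dg _).
Qed.

Lemma derive_scale1 (W : normedModType K) (g : K^o -> W) t h :
  differentiable g t -> 'D_h g t = h *: 'D_1 g t.
Proof.
by move=> dg; rewrite !deriveE // -[X in 'd g t X]mulr1 -linearZ.
Qed.

Lemma derive_comp1 (W : normedModType K) (f : V -> K^o) (g : K^o -> W) x v :
  differentiable f x -> differentiable g (f x) ->
  'D_v (g \o f) x = 'D_v f x *: 'D_1 g (f x).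
Proof.
move=> df dg; rewrite deriveE; last exact: differentiable_comp.
by rewrite diff_comp //= -(deriveE _ df) -(deriveE _ dg) derive_scale1.
Qed.

Lemma nsmooth_comp1 n (f : V -> K^o) (D' : set K^o) (g : K^o -> K^o) :
  (forall x, D x -> D' (f x)) -> nsmooth D n f -> nsmooth D' n g ->
  nsmooth D n (fun x => g (f x)).
Proof.
move=> DD'; elim: n g => [|n IHn] g sf sg; move: (sf) (sg) => [df Df] [dg Dg].
  by split=> // x Dx; apply: (@differentiable_comp _ _ _ _ f g) => //;
    [exact: df|exact/dg/DD'].
split=> [x Dx|v].
  by apply: (@differentiable_comp _ _ _ _ f g) => //; [exact: df|exact/dg/DD'].
apply: (@nsmooth_eq _ _ _ _ _ _ (fun x => 'D_v f x * 'D_1 g (f x))) => //.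
  by move=> x Dx; rewrite [RHS]derive_comp1 //; [exact: df|exact/dg/DD'].
apply: nsmoothM => //; first exact: Df.
exact: IHn (nsmoothW sf) (Dg _).
Qed.

(** The bootstrap step: a function whose derivative is expressed through functions of order n gains
    one order. It yields the smoothness of ODE solutions and of local inverses. *)
Lemma nsmooth1 n (D' : set K^o) (g : K^o -> K^o) : open D' ->
  (forall t, D' t -> differentiable g t) -> nsmooth D' n ('D_1 g) ->
  nsmooth D' n.+1 g.
Proof.
move=> oD' dg sg; split=> // v.
apply: (@nsmooth_eq _ _ _ _ _ _ (fun x => v * 'D_1 g x)) => //.
  by move=> x Dx; rewrite [RHS]derive_scale1 //; exact: dg.
by apply: nsmoothM => //; exact: nsmooth_cst.
Qed.

End Composition.

(** * Prolongation and composition of point transformations *)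

Lemma open_setI_preimage (T U : topologicalType) (D : set T) (O : set U)
    (f : T -> U) : open D -> open O -> (forall x, D x -> {for x, continuous f}) ->
  open (D `&` f @^-1` O).
Proof.
move=> oD oO cf; rewrite openE => x [Dx Ox].
by apply: filterI; [exact: open_nbhs_nbhs|apply: cf => //; exact: open_nbhs_nbhs].
Qed.

Lemma nsmooth_subset (K : numFieldType) (V W : normedModType K) (D D' : set V)
  n (f : V -> W) : D `<=` D' -> nsmooth D' n f -> nsmooth D n f.
Proof.
move=> DD'; elim: n f => [|n IHn] f [df Df]; split=> //.
- by move=> x /DD'; exact: df.
- by move=> x /DD'; exact: df.
by move=> v; exact: IHn (Df v).
Qed.

Lemma tfun_nsmooth (K : numFieldType) m (T : transf K m) n :
  nsmooth (tdom T) n T.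
Proof. by move: n; apply/smooth_onP; exact: (@tfun_smooth _ _ T). Qed.

Lemma tfun_diff (K : numFieldType) m (T : transf K m) z :
  tdom T z -> differentiable T z.
Proof. exact: nsmooth_diff (tfun_nsmooth T 0). Qed.

Lemma comp_transf_open (K : numFieldType) n (S T : transf K n) :
  open (tdom T `&` T @^-1` tdom S).
Proof.
apply: open_setI_preimage; [exact: tdom_open|exact: tdom_open|].
by move=> z Tz; exact/differentiable_continuous/tfun_diff.
Qed.

Lemma comp_transf_smooth (K : numFieldType) n (S T : transf K n) :
  smooth_on (tdom T `&` T @^-1` tdom S) (S \o T).
Proof.
apply/smooth_onP => k; have oD := @comp_transf_open _ _ S T.
have sub : tdom T `&` T @^-1` tdom S `<=` tdom T by move=> ? [].
apply: (nsmooth_row oD) => j.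
apply: (@nsmooth_comp _ _ _ oD _ _ _ (tdom S) (fun w => S w 0 j)).
- by move=> x [].
- exact: nsmooth_subset sub (tfun_nsmooth _ _).
- exact: (nsmooth_coord (@tdom_open _ _ S) j (tfun_nsmooth S k)).
Qed.

Lemma jacobian_comp (K : numFieldType) m n k (f : 'rV[K]_m -> 'rV[K]_n)
    (g : 'rV[K]_n -> 'rV[K]_k) z :
  differentiable f z -> differentiable g (f z) ->
  'J (g \o f) z = 'J f z *m 'J g (f z).
Proof.
move=> df dg; apply/row_matrixP => i; rewrite row_mul !rowE.
rewrite -deriveEjacobian; last exact: differentiable_comp.
rewrite -deriveEjacobian // -deriveEjacobian // !deriveE //;
  last exact: differentiable_comp.
by rewrite diff_comp.
Qed.

Lemma comp_transf_jacobian (K : numFieldType) n (S T : transf K n) z :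
  (tdom T `&` T @^-1` tdom S) z -> \det ('J (S \o T) z) != 0.
Proof.
move=> [Tz STz]; rewrite jacobian_comp; [|exact: tfun_diff|exact: tfun_diff].
by rewrite det_mulmx mulf_neq0 // tfun_jacobian.
Qed.

Definition comp_transf (K : numFieldType) n (S T : transf K n) : transf K n :=
  Transf (@comp_transf_open K n S T) (@comp_transf_smooth K n S T)
    (@comp_transf_jacobian K n S T).

Section Prolongation.
Context (K : numFieldType).
Implicit Types (F G : 'rV[K]_2 -> 'rV[K]_2) (g : 'rV[K]_2 -> K^o).

Lemma row2_0 (u v : K) : row2 u v 0 0 = u. Proof. by rewrite mxE. Qed.
Lemma row2_1 (u v : K) : row2 u v 0 1 = v. Proof. by rewrite mxE. Qed.

Lemma sum_ord2 (V : nmodType) (f : 'I_2 -> V) : \sum_i f i = f 0 + f 1.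
Proof.
rewrite !big_ord_recl big_ord0 addr0; congr (f _ + f _); exact: val_inj.
Qed.

Lemma row2P (u v : 'rV[K]_2) : u 0 0 = v 0 0 -> u 0 1 = v 0 1 -> u = v.
Proof.
move=> h0 h1; apply/rowP => -[[|[|//]] i].
  by rewrite (_ : Ordinal i = 0) //; exact: val_inj.
by rewrite (_ : Ordinal i = 1) //; exact: val_inj.
Qed.

Lemma row2E (u : 'rV[K]_2) : row2 (comp0 u) (comp1 u) = u.
Proof. by apply: row2P; rewrite ?row2_0 ?row2_1. Qed.

Lemma delta0 : delta_mx 0 0 = row2 1 0 :> 'rV[K]_2.
Proof. by apply: row2P; rewrite ?row2_0 ?row2_1 mxE. Qed.
Lemma delta1 : delta_mx 0 1 = row2 0 1 :> 'rV[K]_2.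
Proof. by apply: row2P; rewrite ?row2_0 ?row2_1 mxE. Qed.

Lemma derive_row2 g w (a b : K) : differentiable g w ->
  'D_(row2 a b) g w = a * 'D_(row2 1 0) g w + b * 'D_(row2 0 1) g w.
Proof.
move=> dg; rewrite !(deriveE _ dg).
rewrite (_ : row2 a b = a *: row2 1 0 + b *: row2 0 1) ?linearD ?linearZ //.
by apply: row2P; rewrite !mxE /= !(mulr1, mulr0, addr0, add0r).
Qed.

Lemma derive_comp2 F g z v : differentiable F z -> differentiable g (F z) ->
  'D_v (g \o F : 'rV[K]_2 -> K^o) z =
  'D_v (fun y => comp0 (F y) : K^o) z * 'D_(row2 1 0) g (F z)
  + 'D_v (fun y => comp1 (F y) : K^o) z * 'D_(row2 0 1) g (F z).
Proof. by move=> dF dg; rewrite derive_comp_row // sum_ord2 delta0 delta1. Qed.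

Lemma total1_comp F g z p : differentiable F z -> differentiable g (F z) ->
  prol_def F z p ->
  total1 (g \o F : 'rV[K]_2 -> K^o) z p =
  total1 (fun y => comp0 (F y) : K^o) z p * total1 g (F z) (prol1 F z p).
Proof.
move=> dF dg Fp; rewrite /total1 derive_comp2 // (derive_row2 1 (prol1 F z p) dg).
rewrite /prol1 /total1; field; exact: Fp.
Qed.

(** The second derivatives of [F] contribute X'' g_x + T'' g_t, where T'' and X'' are second total
    derivatives. The value [prol2] in the slot of x'' is exactly the one that accounts for this once
    T'' times the first total derivative of [g] is split off. *)
Lemma total2_comp F g (D D' : set 'rV[K]_2) z p q : open D -> open D' ->
  (forall y, D y -> D' (F y)) -> nsmooth D 1 F -> nsmooth D' 1 g -> D z ->
  prol_def F z p ->
  total2 (g \o F : 'rV[K]_2 -> K^o) z p q =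
  total1 (fun y => comp0 (F y) : K^o) z p ^+ 2 *
    total2 g (F z) (prol1 F z p) (prol2 F z p q)
  + total2 (fun y => comp0 (F y) : K^o) z p q * total1 g (F z) (prol1 F z p).
Proof.
move=> oD oD' DD' sF sg Dz Fp.
have dF y : D y -> differentiable F y by exact: nsmooth_diff sF.
have dg w : D' w -> differentiable g w by exact: nsmooth_diff sg.
have dgi v w : D' w -> differentiable ('D_v g) w.
  by case: sg => _ /(_ v) [] /(_ w).
have dFi v i y : D y -> differentiable ('D_v (fun y => F y 0 i : K^o)) y.
  by move=> Dy; have [_ /(_ v) [h _]] := nsmooth_coord oD i sF; exact: h.
have nD : \forall y \near z, D y by exact: open_nbhs_nbhs.
have nD' : \forall w \near F z, D' w by apply: open_nbhs_nbhs; split=> //; exact: DD'.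
have D'z := DD' _ Dz.
set v := row2 1 p; pose T y : K^o := comp0 (F y); pose X y : K^o := comp1 (F y).
pose g0 := 'D_(row2 1 0) g; pose g1 := 'D_(row2 0 1) g.
have dcomp w y : D y -> differentiable ('D_w g \o F) y.
  move=> Dy; apply: (@differentiable_comp _ _ _ _ F ('D_w g)); first exact: dF.
  exact/dgi/DD'.
have E1 : 'D_v ('D_v (g \o F : 'rV[K]_2 -> K^o)) z =
    T z *0 + ('D_v ('D_v T) z * g0 (F z) + 'D_v T z * 'D_v (g0 \o F) z
    + 'D_v ('D_v X) z * g1 (F z) + 'D_v X z * 'D_v (g1 \o F) z).
  rewrite mulr0 add0r (@near_eq_derive _ _ _ _
    ('D_v T * (g0 \o F : 'rV[K]_2 -> K^o) + 'D_v X * (g1 \o F : 'rV[K]_2 ->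
      K^o))); last first.
    apply: filterS nD => y Dy; rewrite derive_comp2 //; [exact: dF|exact/dg/DD'].
  have dT := dFi v 0 _ Dz; have dX := dFi v 1 _ Dz.
  rewrite deriveD; [|by apply: diff_derivable; apply: differentiableM => //;
    exact: dcomp..].
  rewrite !deriveM; try by apply: diff_derivable => //; exact: dcomp.
  rewrite /GRing.scale /=.
  move: ('D_v T z) ('D_v (g0 \o F) z) (g0 (F z)) ('D_v ('D_v T) z) => a b c d.
  move: ('D_v X z) ('D_v (g1 \o F) z) (g1 (F z)) ('D_v ('D_v X) z) => a' b' c' d'.
  ring.
rewrite mulr0 add0r in E1.
have E2 : 'D_(row2 1 (prol1 F z p)) ('D_(row2 1 (prol1 F z p)) g) (F z) =
   'D_(row2 1 0) g0 (F z) + prol1 F z p * 'D_(row2 0 1) g0 (F z)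
   + prol1 F z p * ('D_(row2 1 0) g1 (F z) + prol1 F z p * 'D_(row2 0 1) g1 (F z)).
  set r := prol1 F z p.
  rewrite (@near_eq_derive _ _ _ _ (g0 + cst r * g1)); last first.
    by apply: filterS nD' => w D'w; rewrite (derive_row2 1 r (dg _ D'w)) ?mul1r.
  have [dg0 dg1] := (dgi (row2 1 0) _ D'z, dgi (row2 0 1) _ D'z).
  rewrite deriveD; [|by apply: diff_derivable; rewrite // ; apply: differentiableM..].
  rewrite deriveM; [|exact: derivable_cst|exact: diff_derivable].
  rewrite derive_cst (derive_row2 1 r dg0) (derive_row2 1 r dg1) /GRing.scale /cst /=.
  move: ('D_(row2 1 0) g0 (F z)) ('D_(row2 0 1) g0 (F z)) (g1 (F z)) => g00 g01 h.
  move: ('D_(row2 1 0) g1 (F z)) ('D_(row2 0 1) g1 (F z)) => g10 g11.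
  ring.
rewrite /total2 E1 E2 -/v -/T -/X.
rewrite (derive_comp2 v (dF _ Dz) (dgi (row2 1 0) _ D'z)).
rewrite (derive_comp2 v (dF _ Dz) (dgi (row2 0 1) _ D'z)).
rewrite (derive_comp2 _ (dF _ Dz) (dg _ D'z)) -/T -/X -/g0 -/g1.
rewrite /total1 (derive_row2 1 (prol1 F z p) (dg _ D'z)) -/g0 -/g1.
have : 'D_v T z != 0 by [].
rewrite /prol1 /prol2 /total2 /total1 -/v -/T -/X.
rewrite -/(g0 (F z)) -/(g1 (F z)).
move: ('D_v T z) ('D_v X z) ('D_v ('D_v T) z) ('D_v ('D_v X) z) => a b c d.
move: (g0 (F z)) (g1 (F z)) ('D_(row2 0 1) T z) ('D_(row2 0 1) X z) => g0z g1z T1 X1.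
move: ('D_(row2 1 0) g0 (F z)) ('D_(row2 0 1) g0 (F z)) => g00 g01.
move: ('D_(row2 1 0) g1 (F z)) ('D_(row2 0 1) g1 (F z)) => g10 g11 a0.
by field.
Qed.

End Prolongation.

(** * Functoriality and locality of prolongation *)

Section ProlongationComp.
Context (K : numFieldType).
Implicit Types (S T : transf K 2) (F G : 'rV[K]_2 -> 'rV[K]_2).
Implicit Types E : linear_ode K.

(** Each D_t of a component of S o T is D_t of the t-component of T times the total derivative of S
    at the prolonged jet. The common factor is nonzero, so it cancels in the quotients and in the
    condition [prol_def]. *)
Lemma prol_comp S T z p : tdom T z -> tdom S (T z) -> prol_def T z p ->
  (prol_def (comp_transf S T) z p <-> prol_def S (T z) (prol1 T z p)) /\
  (prol_def S (T z) (prol1 T z p) ->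
   prol1 (comp_transf S T) z p = prol1 S (T z) (prol1 T z p) /\
   forall q, prol2 (comp_transf S T) z p q =
             prol2 S (T z) (prol1 T z p) (prol2 T z p q)).
Proof.
move=> Tz STz Tp.
have Dz : (tdom T `&` T @^-1` tdom S) z by [].
have oD := @comp_transf_open _ _ S T.
have sT n : nsmooth (tdom T `&` T @^-1` tdom S) n T.
  by apply: nsmooth_subset (tfun_nsmooth _ _) => ? [].
have sS n j : nsmooth (tdom S) n (fun w => S w 0 j : K^o).
  exact: (nsmooth_coord (@tdom_open _ _ S) j (tfun_nsmooth S n)).
have E1 j : total1 (fun y => S (T y) 0 j : K^o) z p =
    total1 (fun y => comp0 (T y) : K^o) z p *
    total1 (fun w => S w 0 j : K^o) (T z) (prol1 T z p).
  rewrite -(@total1_comp _ T (fun w => S w 0 j)) //; first exact: tfun_diff.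
  exact: nsmooth_diff (sS 0%N j) _.
have E2 j q : total2 (fun y => S (T y) 0 j : K^o) z p q =
    total1 (fun y => comp0 (T y) : K^o) z p ^+ 2 *
    total2 (fun w => S w 0 j : K^o) (T z) (prol1 T z p) (prol2 T z p q)
    + total2 (fun y => comp0 (T y) : K^o) z p q *
    total1 (fun w => S w 0 j : K^o) (T z) (prol1 T z p).
  rewrite -(@total2_comp _ T (fun w => S w 0 j) _ _ z p q oD (@tdom_open _ _ S)) //.
  by move=> y [].
rewrite /prol_def; split.
  rewrite (E1 0) mulf_eq0 negb_or; split=> [/andP[]//|h].
  by rewrite h andbT.
rewrite /prol_def => S0; split=> [|q].
  transitivity ((total1 (fun y => comp0 (T y) : K^o) z p *
      total1 (fun w => comp1 (S w) : K^o) (T z) (prol1 T z p)) /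
    (total1 (fun y => comp0 (T y) : K^o) z p *
      total1 (fun w => comp0 (S w) : K^o) (T z) (prol1 T z p))).
    by congr (_ / _); exact: E1.
  rewrite [RHS]/prol1; move: Tp S0; rewrite /prol_def.
  move: (total1 _ z p) (total1 _ (T z) _) (total1 _ (T z) _) => a t1 x1 a0 t0.
  by field; apply/andP.
rewrite {1}/prol2.
have e10 := E1 0; have e11 := E1 1; have e20 := E2 0 q; have e21 := E2 1 q.
rewrite -!/(comp0 _) -!/(comp1 _) in e10 e11 e20 e21.
rewrite e10 e11 e20 e21 [RHS]/prol2; move: Tp S0; rewrite /prol_def.
move: (total1 _ z p) (total1 _ (T z) _) (total1 _ (T z) _) => a t1 x1.
move: (total2 _ z p q) (total2 _ (T z) _ _) (total2 _ (T z) _ _) => b t2 x2 a0 t0.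
by field; apply/andP.
Qed.

(** The last hypothesis excludes jets at which S o T prolongs but T does not: there is no
    intermediate jet there on which the second equivalence could be used. It holds as soon as one of
    the two factors is a chart. *)
Lemma maps_at_comp S T E E' E'' z : maps_at T E E' z ->
  maps_at S E' E'' (T z) ->
  (forall p, prol_def (comp_transf S T) z p -> prol_def T z p) ->
  maps_at (comp_transf S T) E E'' z.
Proof.
move=> [Tz Ez ETz ET] [STz _ ESz ES] h; split=> // p q STp.
have Tp := h _ STp; have [hd he] := prol_comp Tz STz Tp.
have Sp : prol_def S (T z) (prol1 T z p) by apply/hd.
have [-> ->] := he Sp.
by rewrite ET // ES.
Qed.

Lemma near_eq_derive_near (F G : 'rV[K]_2 -> K^o) (z : 'rV[K]_2) : {near z, F =1 G} ->
  forall v : 'rV[K]_2, {near z, 'D_v F =1 'D_v G}.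
Proof.
(* Equality near [z] is also equality near every point close to [z], so second derivatives agree as
   well. *)
move=> FG v; have /nbhs_interior : nbhs z [set y | F y = G y] by exact: FG.
by apply: filterS => y; exact: near_eq_derive.
Qed.

Lemma near_prol F G (z : 'rV[K]_2) : {near z, F =1 G} ->
  [/\ forall p, prol_def F z p = prol_def G z p,
      forall p, prol1 F z p = prol1 G z p
    & forall p q, prol2 F z p q = prol2 G z p q].
Proof.
move=> FG.
have FGj j : {near z, (fun y => F y 0 j : K^o) =1 (fun y => G y 0 j : K^o)}.
  by apply: filterS FG => y ->.
have E1 j p : total1 (fun y => F y 0 j : K^o) z p = total1 (fun y => G y 0 j : K^o) z p.
  exact: near_eq_derive.
have E2 j p q : total2 (fun y => F y 0 j : K^o) z p q = total2 (fun y =>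
  G y 0 j : K^o) z p q.
  rewrite /total2 (near_eq_derive (row2 0 1) (FGj j)).
  by rewrite (near_eq_derive _ (near_eq_derive_near (FGj j) (row2 1 p))).
have E10 p := E1 0 p; have E11 p := E1 1 p.
have E20 p q := E2 0 p q; have E21 p q := E2 1 p q.
by split=> *; rewrite /prol_def /prol1 /prol2 ?(E10, E11, E20, E21).
Qed.

Lemma derive_fst (v z : 'rV[K]_2) : 'D_v (fun y => comp0 y : K^o) z = comp0 v.
Proof.
by rewrite -(@derive_coord _ _ 1 2 id z v 0 0) ?derive_id //; exact: ex_diff.
Qed.

Lemma derive_snd (v z : 'rV[K]_2) : 'D_v (fun y => comp1 y : K^o) z = comp1 v.
Proof.
by rewrite -(@derive_coord _ _ 1 2 id z v 0 1) ?derive_id //; exact: ex_diff.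
Qed.

Lemma coord_total (z : 'rV[K]_2) p q :
  [/\ total1 (fun y : 'rV[K]_2 => comp0 y : K^o) z p = 1,
      total1 (fun y : 'rV[K]_2 => comp1 y : K^o) z p = p,
      total2 (fun y : 'rV[K]_2 => comp0 y : K^o) z p q = 0
    & total2 (fun y : 'rV[K]_2 => comp1 y : K^o) z p q = q].
Proof.
have D0 v : 'D_v (fun y : 'rV[K]_2 => comp0 y : K^o) = cst (comp0 v).
  by apply/funext => y; rewrite derive_fst.
have D1 v : 'D_v (fun y : 'rV[K]_2 => comp1 y : K^o) = cst (comp1 v).
  by apply/funext => y; rewrite derive_snd.
split.
- by rewrite /total1 derive_fst /comp0 row2_0.
- by rewrite /total1 derive_snd /comp1 row2_1.
- by rewrite /total2 D0 derive_cst derive_fst /comp0 row2_0 mulr0 addr0.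
- by rewrite /total2 D1 derive_cst derive_snd /comp1 row2_1 mulr1 add0r.
Qed.

Lemma prol_id z p q :
  [/\ prol_def (@id 'rV[K]_2) z p, prol1 (@id 'rV[K]_2) z p = p
    & prol2 (@id 'rV[K]_2) z p q = q].
Proof.
have [t10 t11 t20 t21] := coord_total z p q.
rewrite /prol_def /prol1 /prol2 t10 t11 t20 t21 oner_neq0 divr1.
by split=> //; rewrite mulr0 subr0 expr1n mulr1 divr1.
Qed.

(** Prolongation is functorial and depends only on germs. Since T o S is the identity near [T z],
    prolonging by T undoes prolonging by S, and the equivalence for T, read at the jet prolonged by
    S, is the one for S. *)
Lemma maps_at_inv S T E E' z : maps_at T E E' z -> tdom S (T z) ->
  S (T z) = z -> (\forall w \near T z, T (S w) = w) ->
  (forall p, prol_def S (T z) p) -> maps_at S E' E (T z).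
Proof.
move=> [Tz Ez ETz ET] STz Sz TS Sp; split=> //; first by rewrite Sz.
move=> p q _; rewrite Sz.
have TSz : tdom T (S (T z)) by rewrite Sz.
have [hd he] := prol_comp STz TSz (Sp p).
have [d1 d2 d3] : [/\ prol_def (comp_transf T S) (T z) p,
  prol1 (comp_transf T S) (T z) p = p & prol2 (comp_transf T S) (T z) p q = q].
  have [e1 e2 e3] := @near_prol (comp_transf T S) id (T z) TS.
  by rewrite e1 e2 e3; exact: prol_id.
move: hd he; rewrite Sz => -[/(_ d1) Tp _] /(_ Tp) [e1 e2].
by rewrite ET // -e1 -e2 d2 d3.
Qed.

End ProlongationComp.

(** * Fibre-affine transformations and the equivalence group *)

Lemma derive_affine (K : numFieldType) (V W : normedModType K) (f : V -> W)
    (z v : V) (k : W) :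
  (forall h : K, f (h *: v + z) = f z + h *: k) -> 'D_v f z = k.
Proof.
move=> fE; apply: cvg_lim => //.
apply: (@cvg_trans _ ((fun=> k) @ 0^')); last exact: cvg_cst.
apply: near_eq_cvg; near=> h.
rewrite /= fE addrC addKr scalerA mulVf ?scale1r //.
by near: h; exact: nbhs_dnbhs_neq.
Unshelve. all: by end_near. Qed.

(** Rows of ['J] are indexed by the variables, so independence of component j from later variables
    makes the Jacobian upper triangular; it is transposed to apply the determinant formula for lower
    triangular matrices. *)
Lemma triangular_jacobian (K : numFieldType) n (f : 'rV[K]_n -> 'rV[K]_n) z :
  differentiable f z ->
  (forall i j : 'I_n, (j < i)%N ->
    forall h : K, f (h *: delta_mx 0 i + z) 0 j = f z 0 j) ->
  (forall i : 'I_n, 'D_(delta_mx 0 i) (fun y => f y 0 i : K^o) z != 0) ->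
  \det ('J f z) != 0.
Proof.
move=> df ft fd.
have JE i j : 'J f z i j = 'D_(delta_mx 0 i) (fun y => f y 0 j : K^o) z.
  by rewrite -derive_coord // deriveEjacobian // -rowE [RHS]mxE.
rewrite -det_tr det_trig.
  by apply/prodf_neq0 => i _; rewrite mxE JE.
apply/is_trig_mxP => i j ij; rewrite mxE JE; apply: derive_affine => h.
by rewrite scaler0 addr0 ft.
Qed.

Lemma nsmooth_row_mx (K : numFieldType) (V : normedModType K) (D : set V) n m1 m2
    (f : V -> 'rV[K]_m1) (g : V -> 'rV[K]_m2) : open D ->
  nsmooth D n f -> nsmooth D n g -> nsmooth D n (fun x => row_mx (f x) (g x)).
Proof.
move=> oD sf sg; apply: nsmooth_row => // j.
rewrite -(fintype.splitK j); case: (fintype.split j) => i /=.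
  by under eq_fun do rewrite row_mxEl; exact: nsmooth_coord.
by under eq_fun do rewrite row_mxEr; exact: nsmooth_coord.
Qed.

(** The fibre-affine maps (t, x) -> (tau t, U t x + V t) on a strip over [cdom]. The inverse [csig]
    is part of the data because the coefficients of an image equation must be functions of the new
    independent variable. *)
Record chart (K : numFieldType) := Chart {
  cdom : set K^o;
  ctau : K^o -> K^o;
  csig : K^o -> K^o;
  cU : K^o -> K^o;
  cV : K^o -> K^o;
  cdom_open : open cdom;
  cimg_open : open (ctau @` cdom);
  ctau_smooth : smooth_on cdom ctau;
  csig_smooth : smooth_on (ctau @` cdom) csig;
  cU_smooth : smooth_on cdom cU;
  cV_smooth : smooth_on cdom cV;
  cU_neq0 : forall t, cdom t -> cU t != 0;
  ctauK : forall t, cdom t -> csig (ctau t) = t }.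

Section ChartTransf.
Context (K : numFieldType).
Variable c : chart K.

Local Notation B := (cdom c).
Local Notation tau := (ctau c).
Local Notation sig := (csig c).
Local Notation U := (cU c).
Local Notation V := (cV c).

Let oB := @cdom_open _ c.

Lemma ctau_nsmooth n : nsmooth B n tau.
Proof. by move: n; apply/smooth_onP; exact: (@ctau_smooth _ c). Qed.
Lemma cU_nsmooth n : nsmooth B n U.
Proof. by move: n; apply/smooth_onP; exact: (@cU_smooth _ c). Qed.
Lemma cV_nsmooth n : nsmooth B n V.
Proof. by move: n; apply/smooth_onP; exact: (@cV_smooth _ c). Qed.
Lemma csig_nsmooth n : nsmooth (tau @` B) n sig.
Proof. by move: n; apply/smooth_onP; exact: (@csig_smooth _ c). Qed.

Lemma nsmooth_d1 (D : set K^o) (f : K^o -> K^o) n :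
  nsmooth D n.+1 f -> nsmooth D n (d1 f).
Proof. by case=> _; apply. Qed.

Lemma csigK s : (tau @` B) s -> B (sig s) /\ tau (sig s) = s.
Proof. by move=> [t Bt <-]; rewrite ctauK. Qed.

Lemma dtau_neq0 t : B t -> d1 tau t != 0.
Proof.
move=> Bt; apply/eqP => t0.
have : 'D_1 (sig \o tau) t = 1.
  rewrite -[RHS](@derive_id _ K^o t); apply: near_eq_derive.
  by apply: filterS (open_nbhs_nbhs (conj oB Bt)) => s Bs; rewrite /= ctauK.
have [dt ds] : differentiable tau t /\ differentiable sig (tau t).
  split; first exact: nsmooth_diff (ctau_nsmooth 0) Bt.
  by apply: nsmooth_diff (csig_nsmooth 0) _; exists t.
rewrite (derive_comp1 _ dt ds) t0 scale0r => /esym/eqP.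
by rewrite oner_eq0.
Qed.

Definition chart_fun (z : 'rV[K]_2) : 'rV[K]_2 :=
  row2 (tau (comp0 z)) (U (comp0 z) * comp1 z + V (comp0 z)).

(** The whole strip, with no restriction on x: recovering the coefficients of an image equation in
    [fiber_pushed] uses all x over a given t. *)
Definition chart_set : set 'rV[K]_2 := [set z | B (comp0 z)].

Lemma nsmooth_proj n m (D : set 'rV[K]_m) j :
  nsmooth D n (fun z : 'rV[K]_m => z 0 j : K^o).
Proof.
apply: nsmooth_linear; last exact: coord_continuous.
by move=> a u v; rewrite !mxE.
Qed.

Lemma chart_set_open : open chart_set.
Proof.
rewrite /chart_set (_ : mkset _ = (fun z : 'rV[K]_2 => z 0 0 : K^o) @^-1` B) //.
apply: open_comp => [z _|]; last exact: oB.
exact: coord_continuous.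
Qed.

Lemma chart_fun_smooth : smooth_on chart_set chart_fun.
Proof.
have oS := chart_set_open.
apply/smooth_onP => n; apply: (nsmooth_row oS) => -[[|[|//]] i].
  under eq_fun do rewrite mxE /=.
  by apply: (nsmooth_comp1 oS _ (nsmooth_proj _ _ _) (ctau_nsmooth n)).
under eq_fun do rewrite mxE /=.
apply: nsmoothD => //; first apply: nsmoothM => //.
- by apply: (nsmooth_comp1 oS _ (nsmooth_proj _ _ _) (cU_nsmooth n)).
- exact: nsmooth_proj.
- by apply: (nsmooth_comp1 oS _ (nsmooth_proj _ _ _) (cV_nsmooth n)).
Qed.

Lemma derive_fiber (f : K^o -> K^o) (v z : 'rV[K]_2) : differentiable f (comp0 z) ->
  'D_v (fun y => f (comp0 y) : K^o) z = comp0 v * d1 f (comp0 z).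
Proof.
move=> df; have := @derive_comp1 _ _ K^o (fun y : 'rV[K]_2 => comp0 y : K^o) f z v.
rewrite derive_fst; apply => //.
exact: differentiable_coord.
Qed.

Lemma derive_fiber_affine (f g : K^o -> K^o) (v z : 'rV[K]_2) :
  differentiable f (comp0 z) -> differentiable g (comp0 z) ->
  'D_v (fun y => f (comp0 y) * comp1 y + g (comp0 y) : K^o) z =
  comp0 v * (d1 f (comp0 z) * comp1 z + d1 g (comp0 z)) + f (comp0 z) * comp1 v.
Proof.
move=> df dg.
have d0 : differentiable (fun y : 'rV[K]_2 =>
  comp0 y : K^o) z by exact: differentiable_coord.
have d1' : differentiable (fun y : 'rV[K]_2 =>
  comp1 y : K^o) z by exact: differentiable_coord.
have df' : differentiable (fun y : 'rV[K]_2 => f (comp0 y) : K^o) z.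
  exact: (@differentiable_comp _ _ _ _ (fun y : 'rV[K]_2 => comp0 y : K^o) f).
have dg' : differentiable (fun y : 'rV[K]_2 => g (comp0 y) : K^o) z.
  exact: (@differentiable_comp _ _ _ _ (fun y : 'rV[K]_2 => comp0 y : K^o) g).
have -> : (fun y : 'rV[K]_2 => f (comp0 y) * comp1 y + g (comp0 y) : K^o) =
  (fun y => f (comp0 y) : K^o) * (fun y => comp1 y : K^o) + (fun y =>
    g (comp0 y) : K^o) by [].
rewrite deriveD; [|apply: diff_derivable..] => //; last exact: differentiableM.
rewrite deriveM; [|exact: diff_derivable..].
rewrite derive_fiber // derive_fiber // derive_snd /GRing.scale /=.
move: (derive f _ _) (derive g _ _) (f _) (comp0 v) (comp1 v) (comp1 z) =>
  a b c' d e g'.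
ring.
Qed.

Lemma chart_total z p q : B (comp0 z) ->
  [/\ total1 (fun y => comp0 (chart_fun y) : K^o) z p = d1 tau (comp0 z),
      total2 (fun y => comp0 (chart_fun y) : K^o) z p q = d1 (d1 tau) (comp0 z),
      total1 (fun y => comp1 (chart_fun y) : K^o) z p =
        d1 U (comp0 z) * comp1 z + d1 V (comp0 z) + U (comp0 z) * p
    & total2 (fun y => comp1 (chart_fun y) : K^o) z p q =
        d1 (d1 U) (comp0 z) * comp1 z + d1 (d1 V) (comp0 z)
        + 2 * d1 U (comp0 z) * p + q * U (comp0 z)].
Proof.
move=> Bz.
have nB : \forall y \near z, B (comp0 y) by apply: open_nbhs_nbhs; split;
  first exact: chart_set_open.
have E0 : (fun y => comp0 (chart_fun y) : K^o) = (fun y => tau (comp0 y)).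
  by apply/funext => y; rewrite /comp0 row2_0.
have E1 : (fun y => comp1 (chart_fun y) : K^o) = (fun y =>
  U (comp0 y) * comp1 y + V (comp0 y)).
  by apply/funext => y; rewrite /comp1 row2_1.
have dtau t : B t -> differentiable tau t by exact: nsmooth_diff (ctau_nsmooth 0).
have dU t : B t -> differentiable U t by exact: nsmooth_diff (cU_nsmooth 0).
have dV t : B t -> differentiable V t by exact: nsmooth_diff (cV_nsmooth 0).
have ddtau t : B t -> differentiable (d1 tau) t by apply: nsmooth_diff;
  exact: nsmooth_d1 (ctau_nsmooth 1).
have ddU t : B t -> differentiable (d1 U) t by apply: nsmooth_diff;
  exact: nsmooth_d1 (cU_nsmooth 1).
have ddV t : B t -> differentiable (d1 V) t by apply: nsmooth_diff;
  exact: nsmooth_d1 (cV_nsmooth 1).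
have [v0 v1] : comp0 (row2 1 p) = 1 /\ comp1 (row2 1 p) = p.
  by rewrite /comp0 /comp1 row2_0 row2_1.
have [w0 w1] : comp0 (row2 0 1 : 'rV[K]_2) = 0 /\ comp1 (row2 0 1 : 'rV[K]_2) = 1.
  by rewrite /comp0 /comp1 row2_0 row2_1.
have nT : {near z, 'D_(row2 1 p) (fun y => tau (comp0 y) : K^o) =1 (fun y =>
  d1 tau (comp0 y) : K^o)}.
  by apply: filterS nB => y By; rewrite derive_fiber ?v0 ?mul1r //; exact: dtau.
(* Along the constant direction (1, p), the derivative of U x + V is U' x + (V' + p U), again affine
   in x; with [W] as the free term, the same rule gives the second derivative. *)
pose W t : K^o := d1 V t + p * U t.
have dW t : B t -> differentiable W t.
  move=> Bt; apply: differentiableD; first exact: ddV.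
  by apply: differentiableM; [exact: differentiable_cst|exact: dU].
have nX : {near z, 'D_(row2 1 p) (fun y => U (comp0 y) * comp1 y + V (comp0 y) : K^o) =1
   (fun y => d1 U (comp0 y) * comp1 y + W (comp0 y) : K^o)}.
  apply: filterS nB => y By; rewrite derive_fiber_affine ?v0 ?v1 ?mul1r;
    [|exact: dU|exact: dV].
  by rewrite /W [p * _]mulrC addrA.
have d1W : d1 W (comp0 z) = d1 (d1 V) (comp0 z) + p * d1 U (comp0 z).
  rewrite (_ : W = d1 V + (cst p : K^o -> K^o) * U) //.
  rewrite deriveD; [|apply: diff_derivable..]; last 2 first.
  - exact: ddV.
  - by apply: differentiableM; [exact: differentiable_cst|exact: dU].
  rewrite deriveM; [|exact: derivable_cst|by apply: diff_derivable; exact: dU].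
  by rewrite derive_cst scaler0 addr0.
rewrite E0 E1 /total2 (near_eq_derive _ nT) (near_eq_derive _ nX) /total1.
rewrite (derive_fiber_affine _ (ddU _ Bz) (dW _ Bz)).
rewrite !(derive_fiber_affine _ (dU _ Bz) (dV _ Bz)).
rewrite (derive_fiber _ (ddtau _ Bz)) !(derive_fiber _ (dtau _ Bz)).
rewrite d1W v0 v1 w0 w1.
move: (derive _ _ _) (derive _ _ _) (derive U _ _) (derive V _ _) => a b u1 v1'.
move: (derive _ _ _) (derive _ _ _) (U _) (comp1 z) => u2 v2 u x.
by split; ring.
Qed.

End ChartTransf.

(** * Action of a chart on derivatives and coefficients *)

Section Push.
Context (K : numFieldType).
Variable c : chart K.

Local Notation B := (cdom c).
Local Notation tau := (ctau c).
Local Notation U := (cU c).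
Local Notation V := (cV c).

Lemma chart_fun_jacobian z : chart_set c z -> \det ('J (chart_fun c) z) != 0.
Proof.
move=> Bz; have dF : differentiable (chart_fun c) z.
  by have /smooth_onP/(_ 0%N) := @chart_fun_smooth _ c; move/nsmooth_diff; exact.
have [t1 _ _ _] := chart_total 0 0 Bz.
apply: triangular_jacobian => // [|i].
  move=> [[|[|//]] i] [[|[|//]] j] //= _ h.
  by rewrite !mxE /= /comp0 !mxE /= mulr0 add0r.
have [i0|i1] : i = 0 \/ i = 1.
- by case: i => -[|[|//]] i; [left|right]; exact: val_inj.
- by rewrite i0 delta0; apply: contraNneq (dtau_neq0 Bz) => /= e0; rewrite -t1;
  apply/eqP.
rewrite i1 (@derive_affine _ _ _ _ _ _ (U (comp0 z))); first exact: cU_neq0.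
move=> h; rewrite !mxE /= /comp0 /comp1 !mxE /= mulr0 add0r mulr1 mulrDr.
rewrite [h *: _]mulrC -!addrA addrC -addrA; congr (_ + _).
Qed.

Definition chart_transf : transf K 2 :=
  Transf (@chart_set_open _ c) (@chart_fun_smooth _ c) chart_fun_jacobian.

(* The coefficients of the image under [c] of the equation with the coefficients
   [a1], [a0], [b], at the point [tau t]. *)
Definition push1 (t a1 : K) : K :=
  (d1 (d1 tau) t / d1 tau t + a1 - 2 * d1 U t / U t) / d1 tau t.
Definition push0 (t a1 a0 : K) : K :=
  ((2 * d1 U t ^+ 2 / U t - d1 (d1 U) t - a1 * d1 U t) / U t + a0) / d1 tau t ^+ 2.
Definition pushb (t a1 a0 b : K) : K :=
  (U t * b + d1 (d1 V) t + a1 * d1 V t + a0 * V t - 2 * d1 U t * d1 V t / U t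
   + (2 * d1 U t ^+ 2 / U t - d1 (d1 U) t - a1 * d1 U t) * V t / U t) / d1 tau t ^+ 2.

(** Closed forms of the prolongation along the chart, as functions of independent variables t, x, p,
    q, so that smoothness and Jacobian of the joint action can be computed. *)
Definition fiber1 (t x p : K) : K := (d1 U t * x + d1 V t + U t * p) / d1 tau t.
Definition fiber2 (t x p q : K) : K :=
  ((d1 (d1 U) t * x + d1 (d1 V) t + 2 * d1 U t * p + q * U t) * d1 tau t
   - (d1 U t * x + d1 V t + U t * p) * d1 (d1 tau) t) / d1 tau t ^+ 3.

Lemma chart_prol z p q : chart_set c z ->
  [/\ prol_def chart_transf z p,
      prol1 chart_transf z p = fiber1 (comp0 z) (comp1 z) p
    & prol2 chart_transf z p q = fiber2 (comp0 z) (comp1 z) p q].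
Proof.
move=> Bz; have [e1 e2 e3 e4] := chart_total p q Bz.
split; first by rewrite /prol_def e1; exact: dtau_neq0.
- by rewrite /prol1 e1 e3.
- by rewrite /prol2 e1 e2 e3 e4.
Qed.

Lemma push_ode t x p q a1 a0 b : B t ->
  (q + a1 * p + a0 * x = b <->
   fiber2 t x p q + push1 t a1 * fiber1 t x p + push0 t a1 a0 * (U t * x + V t)
   = pushb t a1 a0 b).
Proof.
move=> Bt; have := dtau_neq0 Bt; have := @cU_neq0 _ c _ Bt.
rewrite /fiber1 /fiber2 /push1 /push0 /pushb.
move: ('D_1 ('D_1 tau) t) ('D_1 tau t) ('D_1 ('D_1 U) t) ('D_1 U t) => T2 T1 U2 U1.
move: ('D_1 ('D_1 V) t) ('D_1 V t) (U t) (V t) => V2 V1 u v u0 T0.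
set L := (X in _ <-> X = _); set M := (X in _ <-> _ = X).
(* The residual of the source equation is that of the image equation times the nonzero factor tau'^2
   / U, so both vanish together. *)
have E : q + a1 * p + a0 * x - b = (L - M) * (T1 ^+ 2 / u).
  by rewrite /L /M; field; rewrite u0 T0.
split=> h.
  have w0 : T1 ^+ 2 / u != 0 by rewrite mulf_neq0 ?expf_neq0 ?invr_eq0.
  by apply/subr0_eq/(mulIf w0); rewrite mul0r -E h subrr.
by apply/subr0_eq; rewrite E h subrr mul0r.
Qed.

Section PushSmooth.
Context (W : normedModType K) (D : set W) (oD : open D).
Variables (th a1 a0 b : W -> K^o).
Hypothesis DB : forall x, D x -> B (th x).
Hypotheses (sth : forall n, nsmooth D n th) (sa1 : forall n, nsmooth D n a1)
  (sa0 : forall n, nsmooth D n a0) (sb : forall n, nsmooth D n b).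

(** The inner map [th] is kept abstract for two uses: as the t-coordinate of the joint space it
    gives smoothness of the joint action, and as [csig] it gives smoothness of the coefficients of
    the image equation. *)
Lemma nsmooth_th n (f : K^o -> K^o) :
  nsmooth B n f -> nsmooth D n (fun x => f (th x)).
Proof. by move=> sf; exact: (nsmooth_comp1 oD DB (sth n) sf). Qed.

Let sT0 n := nsmooth_th (ctau_nsmooth c n).
Let sT1 n := nsmooth_th (nsmooth_d1 (ctau_nsmooth c n.+1)).
Let sT2 n := nsmooth_th (nsmooth_d1 (nsmooth_d1 (ctau_nsmooth c n.+2))).
Let sU0 n := nsmooth_th (cU_nsmooth c n).
Let sU1 n := nsmooth_th (nsmooth_d1 (cU_nsmooth c n.+1)).
Let sU2 n := nsmooth_th (nsmooth_d1 (nsmooth_d1 (cU_nsmooth c n.+2))).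
Let sV0 n := nsmooth_th (cV_nsmooth c n).
Let sV1 n := nsmooth_th (nsmooth_d1 (cV_nsmooth c n.+1)).
Let sV2 n := nsmooth_th (nsmooth_d1 (nsmooth_d1 (cV_nsmooth c n.+2))).

Let T1n0 x : D x -> d1 tau (th x) != 0. Proof. by move/DB/dtau_neq0. Qed.
Let T1Xn0 k x : D x -> d1 tau (th x) ^+ k != 0.
Proof. by move=> Dx; rewrite expf_neq0 ?T1n0. Qed.
Let Un0 x : D x -> U (th x) != 0. Proof. by move/DB/(@cU_neq0 _ c). Qed.

Ltac smooth := repeat lazymatch goal with
  | |- nsmooth _ _ (fun=> ?k) => exact: nsmooth_cst
  | |- nsmooth _ _ (fun x => @?f x + - @?g x) => apply: (nsmoothB oD)
  | |- nsmooth _ _ (fun x => @?f x + @?g x) => apply: (nsmoothD oD)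
  | |- nsmooth _ _ (fun x => @?f x * @?g x) => apply: (nsmoothM oD)
  | |- nsmooth _ _ (fun x => (@?f x)^-1) => apply: (nsmoothV oD)
  | |- nsmooth _ _ (fun x => @?f x ^+ _) => apply: (nsmoothX oD)
  | |- forall x, D x -> _ => first [exact: T1n0 | exact: T1Xn0 | exact: Un0]
  | |- context [ctau] => first [exact: sT0 | exact: sT1 | exact: sT2]
  | |- context [cU] => first [exact: sU0 | exact: sU1 | exact: sU2]
  | |- context [cV] => first [exact: sV0 | exact: sV1 | exact: sV2]
  | |- _ => first [exact: sa1 | exact: sa0 | exact: sb]
  end.

Lemma nsmooth_push1 n : nsmooth D n (fun x => push1 (th x) (a1 x) : K^o).
Proof. by rewrite /push1; smooth. Qed.

Lemma nsmooth_push0 n : nsmooth D n (fun x => push0 (th x) (a1 x) (a0 x) : K^o).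
Proof. by rewrite /push0; smooth. Qed.

Lemma nsmooth_pushb n :
  nsmooth D n (fun x => pushb (th x) (a1 x) (a0 x) (b x) : K^o).
Proof. by rewrite /pushb; smooth. Qed.

Lemma nsmooth_fiber1 n : nsmooth D n (fun x => fiber1 (th x) (a1 x) (a0 x) : K^o).
Proof. by rewrite /fiber1; smooth. Qed.

Lemma nsmooth_fiber2 n :
  nsmooth D n (fun x => fiber2 (th x) (a1 x) (a0 x) (b x) : K^o).
Proof. by rewrite /fiber2; smooth. Qed.

End PushSmooth.

End Push.

Section JointCoordinates.
Context (K : numFieldType).
Implicit Types (z d : 'rV[K]_2) (a : 'rV[K]_3) (j : 'rV[K]_(2 + (2 + 3))).

Lemma ord7E : [/\ lshift (2 + 3) 0 = ord7 0 :> 'I_(2 + (2 + 3)),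
   lshift (2 + 3) 1 = ord7 1, rshift 2 (lshift 3 0) = ord7 2
   & rshift 2 (lshift 3 1) = ord7 3].
Proof. by split; exact: val_inj. Qed.

Lemma ord7E3 : [/\ rshift 2 (rshift 2 0) = ord7 4 :> 'I_(2 + (2 + 3)),
   rshift 2 (rshift 2 1) = ord7 5 & rshift 2 (rshift 2 2%:R) = ord7 6].
Proof. by split; exact: val_inj. Qed.

Lemma jointE z d a :
  [/\ joint z d a 0 (ord7 0) = z 0 0, joint z d a 0 (ord7 1) = z 0 1,
      joint z d a 0 (ord7 2) = d 0 0 & joint z d a 0 (ord7 3) = d 0 1] /\
  [/\ joint z d a 0 (ord7 4) = a 0 0, joint z d a 0 (ord7 5) = a 0 1
    & joint z d a 0 (ord7 6) = a 0 2%:R].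
Proof.
have [<- <- <- <-] := ord7E; have [<- <- <-] := ord7E3.
by rewrite /joint !(row_mxEl, row_mxEr).
Qed.

Lemma partE j :
  [/\ base_part j 0 0 = j 0 (ord7 0), base_part j 0 1 = j 0 (ord7 1),
      deriv_part j 0 0 = j 0 (ord7 2) & deriv_part j 0 1 = j 0 (ord7 3)] /\
  [/\ arb_part j 0 0 = j 0 (ord7 4), arb_part j 0 1 = j 0 (ord7 5)
    & arb_part j 0 2%:R = j 0 (ord7 6)].
Proof.
have [<- <- <- <-] := ord7E; have [<- <- <-] := ord7E3.
by rewrite /base_part /deriv_part /arb_part !mxE.
Qed.

Lemma row3P (u v : 'rV[K]_3) :
  u 0 0 = v 0 0 -> u 0 1 = v 0 1 -> u 0 2%:R = v 0 2%:R -> u = v.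
Proof.
move=> h0 h1 h2; apply/rowP => -[[|[|[|//]]] i].
- by rewrite (_ : Ordinal i = 0) //; exact: val_inj.
- by rewrite (_ : Ordinal i = 1) //; exact: val_inj.
by rewrite (_ : Ordinal i = 2%:R) //; exact: val_inj.
Qed.

Lemma row3E (u v w : K) :
  [/\ row3 u v w 0 0 = u, row3 u v w 0 1 = v & row3 u v w 0 2%:R = w].
Proof. by rewrite !mxE. Qed.

Lemma base_part_joint z d a : base_part (joint z d a) = z.
Proof. by rewrite /base_part /joint row_mxKl. Qed.

End JointCoordinates.

(** * The equivalence transformation generated by a chart *)

Section ChartEquiv.
Context (K : numFieldType).
Variable c : chart K.

Local Notation B := (cdom c).
Local Notation tau := (ctau c).
Local Notation sig := (csig c).
Local Notation U := (cU c).
Local Notation V := (cV c).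

Definition joint_set : set 'rV[K]_(2 + (2 + 3)) := [set j | B (j 0 (ord7 0))].

Definition joint_fun (j : 'rV[K]_(2 + (2 + 3))) : 'rV[K]_(2 + (2 + 3)) :=
  let t := j 0 (ord7 0) in let x := j 0 (ord7 1) in let p := j 0 (ord7 2) in
  let a1 := j 0 (ord7 4) in let a0 := j 0 (ord7 5) in
  \row_i [:: tau t; U t * x + V t; fiber1 c t x p; fiber2 c t x p (j 0 (ord7 3));
     push1 c t a1; push0 c t a1 a0; pushb c t a1 a0 (j 0 (ord7 6))]`_i.

Lemma joint_set_open : open joint_set.
Proof.
have -> : joint_set = (fun z : 'rV[K]_(2 + (2 + 3)) =>
  z 0 (ord7 0) : K^o) @^-1` B by [].
apply: open_comp => [z _|]; last exact: cdom_open.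
exact: coord_continuous.
Qed.

Lemma joint_fun_smooth : smooth_on joint_set joint_fun.
Proof.
have oS := joint_set_open.
pose pr k n := @nsmooth_proj K n _ joint_set k.
have DB (j : 'rV[K]_(2 + (2 + 3))) : joint_set j -> B (j 0 (ord7 0)) by [].
apply/smooth_onP => n; apply: (nsmooth_row oS) => -[k i].
move: k i; do 7?[case]; last by [].
- move=> i; under eq_fun do rewrite mxE /=.
  exact: (nsmooth_th oS DB (pr _) (ctau_nsmooth c n)).
- move=> i; under eq_fun do rewrite mxE /=.
  apply: nsmoothD => //; last exact: (nsmooth_th oS DB (pr _) (cV_nsmooth c n)).
  apply: nsmoothM => //.
  exact: (nsmooth_th oS DB (pr _) (cU_nsmooth c n)).
- move=> i; under eq_fun do rewrite mxE /=.
  exact: (nsmooth_fiber1 oS DB (pr _) (pr _) (pr _)).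
- move=> i; under eq_fun do rewrite mxE /=.
  exact: (nsmooth_fiber2 oS DB (pr _) (pr _) (pr _) (pr _)).
- move=> i; under eq_fun do rewrite mxE /=.
  exact: (nsmooth_push1 oS DB (pr _) (pr _)).
- move=> i; under eq_fun do rewrite mxE /=.
  exact: (nsmooth_push0 oS DB (pr _) (pr _) (pr _)).
- move=> i; under eq_fun do rewrite mxE /=.
  exact: (nsmooth_pushb oS DB (pr _) (pr _) (pr _) (pr _)).
Qed.

(** The slopes are the diagonal entries of the Jacobian of the joint action for x', x'', a1, a0, b;
    each of these components is affine in its own coordinate. *)
Lemma fiber_shift t h : B t ->
  [/\ forall x p, fiber1 c t x (h + p) = fiber1 c t x p + h * (U t / d1 tau t),
      forall x p q, fiber2 c t x p (h + q) =
                    fiber2 c t x p q + h * (U t / d1 tau t ^+ 2),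
      forall a1, push1 c t (h + a1) = push1 c t a1 + h * (d1 tau t)^-1,
      forall a1 a0, push0 c t a1 (h + a0) = push0 c t a1 a0 + h * (d1 tau t ^+ 2)^-1
    & forall a1 a0 b, pushb c t a1 a0 (h + b) =
                      pushb c t a1 a0 b + h * (U t / d1 tau t ^+ 2)].
Proof.
move=> Bt; have := dtau_neq0 Bt; have := @cU_neq0 _ c _ Bt.
rewrite /fiber1 /fiber2 /push1 /push0 /pushb.
move: ('D_1 ('D_1 tau) t) ('D_1 tau t) ('D_1 ('D_1 U) t) ('D_1 U t) => T2 T1 U2 U1.
move: ('D_1 ('D_1 V) t) ('D_1 V t) (U t) (V t) => V2 V1 u v u0 T0.
by split=> *; field; rewrite ?u0 ?T0.
Qed.

(** In the chosen order of coordinates every component depends only on itself and earlier ones, so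
    the determinant is a product of tau', U and quotients of the forms U / tau'^n and 1 / tau'^n. *)
Lemma joint_fun_jacobian j : joint_set j -> \det ('J joint_fun j) != 0.
Proof.
move=> Bj; have dF : differentiable joint_fun j.
  by have /smooth_onP/(_ 0%N) := joint_fun_smooth; move/nsmooth_diff; exact.
have T0 := dtau_neq0 Bj; have U0 := @cU_neq0 _ c _ Bj.
apply: triangular_jacobian => //.
  move=> i l li h.
  have coordE (m : 'I_(2 + (2 + 3))) : (m < i)%N -> (h *: delta_mx 0 i + j) 0 m = j 0 m.
    move=> mi; rewrite !mxE eqxx andTb -val_eqE /= (ltn_eqF mi) mulr0 add0r //.
  rewrite [LHS]mxE [RHS]mxE; move: l li => [l il] /= li.
  move: l il li; do 7?[case=> /=]; move=> // il li;
    by rewrite !coordE //; apply: leq_ltn_trans li.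
move=> [k ik].
have coordE i l (h : K) : (h *: delta_mx 0 i + j) 0 l = h * (l == i)%:R + j 0 l.
  by rewrite !mxE eqxx andTb.
have diag i (w : K) : (forall h : K,
    joint_fun (h *: delta_mx 0 i + j) 0 i = joint_fun j 0 i + h * w) ->
    w != 0 -> 'D_(delta_mx 0 i) (fun y => joint_fun y 0 i : K^o) j != 0.
  by move=> e w0; rewrite (@derive_affine _ _ _ _ _ _ w).
have UT n : U (j 0 (ord7 0)) / 'D_1 tau (j 0 (ord7 0)) ^+ n != 0.
  by rewrite mulf_neq0 ?invr_eq0 ?expf_neq0.
have VT n : ('D_1 tau (j 0 (ord7 0)) ^+ n)^-1 != 0 by rewrite invr_eq0 expf_neq0.
move: k ik; do 7?[case=> /=]; move=> // ik.
(* The t-entry is the only one that is not affine in its own variable; it is tau', found by the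
   chain rule. *)
- have -> : Ordinal ik = ord7 0 by exact: val_inj.
  have -> : (fun y => joint_fun y 0 (ord7 0) : K^o) = tau \o (fun y =>
    y 0 (ord7 0) : K^o).
    by apply/funext => y; rewrite mxE.
  rewrite derive_comp1; last 2 first.
  + exact: differentiable_coord.
  + exact: nsmooth_diff (ctau_nsmooth c 0) Bj.
  rewrite mulf_neq0 // -(@derive_coord _ _ _ _ id) ?derive_id ?mxE ?oner_eq0 //.
- have -> : Ordinal ik = ord7 1 by exact: val_inj.
  apply: (diag _ (U (j 0 (ord7 0)))) => // h.
  rewrite /joint_fun [LHS]mxE [X in _ = X + _]mxE !coordE /= !mulr0 !mulr1 !add0r.
  by rewrite mulrDr (mulrC (U _) h) -addrA addrC.
- have -> : Ordinal ik = ord7 2 by exact: val_inj.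
  apply: diag (UT 1) => h; have [e _ _ _ _] := fiber_shift h Bj.
  by rewrite [LHS]mxE [X in _ = X + _]mxE !coordE /= !mulr0 !mulr1 !add0r e.
- have -> : Ordinal ik = ord7 3 by exact: val_inj.
  apply: diag (UT 2) => h; have [_ e _ _ _] := fiber_shift h Bj.
  by rewrite [LHS]mxE [X in _ = X + _]mxE !coordE /= !mulr0 !mulr1 !add0r e.
- have -> : Ordinal ik = ord7 4 by exact: val_inj.
  apply: diag (VT 1) => h; have [_ _ e _ _] := fiber_shift h Bj.
  by rewrite [LHS]mxE [X in _ = X + _]mxE !coordE /= !mulr0 !mulr1 !add0r e.
- have -> : Ordinal ik = ord7 5 by exact: val_inj.
  apply: diag (VT 2) => h; have [_ _ _ e _] := fiber_shift h Bj.
  by rewrite [LHS]mxE [X in _ = X + _]mxE !coordE /= !mulr0 !mulr1 !add0r e.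
- have -> : Ordinal ik = ord7 6 by exact: val_inj.
  apply: diag (UT 2) => h; have [_ _ _ _ e] := fiber_shift h Bj.
  by rewrite [LHS]mxE [X in _ = X + _]mxE !coordE /= !mulr0 !mulr1 !add0r e.
Qed.

End ChartEquiv.

Section ChartEquiv.
Context (K : numFieldType).
Variable c : chart K.

Local Notation B := (cdom c).
Local Notation tau := (ctau c).
Local Notation sig := (csig c).
Local Notation U := (cU c).
Local Notation V := (cV c).

Definition joint_transf : transf K (2 + (2 + 3)) :=
  Transf (@joint_set_open _ c) (@joint_fun_smooth _ c) (@joint_fun_jacobian _ c).

Lemma joint_set_joint z d a : joint_set c (joint z d a) <-> B (comp0 z).
Proof. by rewrite /joint_set /=; have [[-> _ _ _] _] := jointE z d a. Qed.

Lemma chart_eproj_dom :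
  tdom (chart_transf c) = [set base_part j | j in tdom joint_transf].
Proof.
apply/seteqP; split=> [z Bz|_ [j Bj <-]].
  by exists (joint z 0 0); rewrite ?base_part_joint //; exact/joint_set_joint.
by rewrite /= /chart_set /= /comp0; have [[-> _ _ _] _] := partE j.
Qed.

Lemma chart_eproj_fun j : tdom joint_transf j ->
  base_part (joint_transf j) = chart_transf c (base_part j).
Proof.
move=> _; have [[e0 e1 _ _] _] := partE j.
have [[f0 f1 _ _] _] := partE (joint_fun c j).
apply: row2P; rewrite ?row2_0 ?row2_1 /= ?f0 ?f1 mxE /comp0 /comp1 ?e0 ?e1 //.
Qed.

Lemma chart_econtact z p q a : tdom joint_transf (joint z (row2 p q) a) ->
  prol_def (chart_transf c) z p /\
  deriv_part (joint_transf (joint z (row2 p q) a)) =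
    row2 (prol1 (chart_transf c) z p) (prol2 (chart_transf c) z p q).
Proof.
move=> /joint_set_joint Bz; have [p0 p1 p2] := chart_prol p q Bz.
split=> //; rewrite p1 p2.
have [[_ _ f2 f3] _] := partE (joint_fun c (joint z (row2 p q) a)).
have [[e0 e1 e2 e3] _] := jointE z (row2 p q) a.
by apply: row2P; rewrite ?row2_0 ?row2_1 /= ?f2 ?f3 mxE /= e0 e1 e2 ?e3 ?row2_0 ?row2_1.
Qed.

Definition pushed_elts (E : linear_ode K) (t : K) : 'rV[K]_3 :=
  row3 (push1 c t (oa1 E t)) (push0 c t (oa1 E t) (oa0 E t))
       (pushb c t (oa1 E t) (oa0 E t) (ob E t)).

Lemma joint_arb_part E z d : B (comp0 z) ->
  arb_part (joint_transf (joint z d (arb_elts E (comp0 z)))) =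
  pushed_elts E (comp0 z).
Proof.
move=> Bz; have [[e0 _ _ _] [e4 e5 e6]] := jointE z d (arb_elts E (comp0 z)).
have [_ [f4 f5 f6]] := partE (joint_fun c (joint z d (arb_elts E (comp0 z)))).
have [r0 r1 r2] := row3E (oa1 E (comp0 z)) (oa0 E (comp0 z)) (ob E (comp0 z)).
have [s0 s1 s2] := row3E (push1 c (comp0 z) (oa1 E (comp0 z)))
  (push0 c (comp0 z) (oa1 E (comp0 z)) (oa0 E (comp0 z)))
       (pushb c (comp0 z) (oa1 E (comp0 z)) (oa0 E (comp0 z)) (ob E (comp0 z))).
apply: row3P; rewrite ?s0 ?s1 ?s2 /= ?f4 ?f5 ?f6 mxE /= e0 e4 ?e5 ?e6;
  by rewrite /arb_elts r0 ?r1 ?r2.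
Qed.

Lemma chart_maps_at E E' z : B (comp0 z) -> odom E (comp0 z) ->
  odom E' (tau (comp0 z)) ->
  arb_elts E' (tau (comp0 z)) = pushed_elts E (comp0 z) ->
  maps_at (chart_transf c) E E' z.
Proof.
move=> Bz Ez E'z /rowP eE;
  have z0 : comp0 (chart_transf c z) = tau (comp0 z) by rewrite /comp0 row2_0.
have z1 : comp1 (chart_transf c z) = U (comp0 z) * comp1 z + V (comp0 z) by
  rewrite /comp1 row2_1.
split=> //; first by rewrite z0.
move=> p q _; have [_ -> ->] := chart_prol p q Bz; rewrite /on_ode z0 z1.
have := eE 0; have := eE 1; have := eE 2%:R; rewrite /arb_elts /pushed_elts !mxE /=.
by move=> -> -> ->; exact: push_ode.
Qed.

Lemma chart_image_at E E' z : B (comp0 z) ->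
  maps_at (chart_transf c) E E' z ->
  arb_elts E' (tau (comp0 z)) = pushed_elts E (comp0 z) ->
  image_at joint_transf (chart_transf c) E E' z.
Proof.
move=> Bz [Tz Ez E'z h] eE; split=> //.
  by split=> //; exists 0; exact/joint_set_joint.
by move=> d _; rewrite joint_arb_part // -eE /comp0 row2_0.
Qed.

Section Push.
Variable E : linear_ode K.

Let D := tau @` B `&` sig @^-1` (odom E).

Lemma image_ode_open : open D.
Proof.
apply: open_setI_preimage; [exact: cimg_open|exact: odom_open|].
move=> s Ds; apply: differentiable_continuous.
exact: nsmooth_diff (csig_nsmooth c 0) Ds.
Qed.

Let sth n : nsmooth D n sig.
Proof. by apply: nsmooth_subset (csig_nsmooth c n) => s []. Qed.

Let DB s : D s -> B (sig s). Proof. by case=> /csigK[]. Qed.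

Let scoef (f : K^o -> K^o) n : smooth_on (odom E) f -> nsmooth D n (fun s =>
  f (sig s) : K^o).
Proof.
move=> /smooth_onP sf; apply: (nsmooth_comp1 image_ode_open _ (sth n) (sf n)).
by move=> s [].
Qed.

Lemma image_a1_smooth : smooth_on D (fun s => push1 c (sig s) (oa1 E (sig s)) : K^o).
Proof.
apply/smooth_onP => n; apply: (nsmooth_push1 image_ode_open DB sth) => m.
exact: scoef (@oa1_smooth _ E).
Qed.

Lemma image_a0_smooth : smooth_on D
  (fun s => push0 c (sig s) (oa1 E (sig s)) (oa0 E (sig s)) : K^o).
Proof.
apply/smooth_onP => n; apply: (nsmooth_push0 image_ode_open DB sth) => m.
  exact: scoef (@oa1_smooth _ E).
exact: scoef (@oa0_smooth _ E).
Qed.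

Lemma image_b_smooth : smooth_on D
  (fun s => pushb c (sig s) (oa1 E (sig s)) (oa0 E (sig s)) (ob E (sig s)) : K^o).
Proof.
apply/smooth_onP => n; apply: (nsmooth_pushb image_ode_open DB sth) => m.
- exact: scoef (@oa1_smooth _ E).
- exact: scoef (@oa0_smooth _ E).
- exact: scoef (@ob_smooth _ E).
Qed.

Definition image_ode : linear_ode K :=
  LinearOde image_ode_open image_a1_smooth image_a0_smooth image_b_smooth.

End Push.

Lemma chart_emaps (E : linear_ode K) : exists E' : linear_ode K,
  forall z, acts_at joint_transf E z ->
    image_at joint_transf (chart_transf c) E E' z.
Proof.
exists (image_ode E) => z [Ez [d /joint_set_joint Bz]].
have tE : arb_elts (image_ode E) (tau (comp0 z)) = pushed_elts E (comp0 z).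
  by rewrite /arb_elts /= ctauK.
apply: chart_image_at => //; apply: chart_maps_at => //.
by split; [exists (comp0 z)|rewrite /= ctauK].
Qed.

Definition chart_equiv : equiv_transf K :=
  EquivTransf chart_eproj_dom chart_eproj_fun chart_econtact chart_emaps.

Lemma fiber_surj t (X P Q : K) : B t -> exists x p q,
  [/\ U t * x + V t = X, fiber1 c t x p = P & fiber2 c t x p q = Q].
Proof.
move=> Bt; have := dtau_neq0 Bt; have := @cU_neq0 _ c _ Bt; move=> U0 T0.
have [_ f2 _ _ _] := fiber_shift 0 Bt.
exists ((X - V t) / U t).
exists ((P * d1 tau t - d1 U t * ((X - V t) / U t) - d1 V t) / U t).
set x := _ / U t; set p := (_ / U t).
(* Written as h + 0 so that [fiber_shift] gives the value at q = 0 plus h times the slope. *)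
exists ((Q - fiber2 c t x p 0) / (U t / d1 tau t ^+ 2) + 0).
have [_ -> _ _ _] := fiber_shift ((Q - fiber2 c t x p 0) / (U t / d1 tau t ^+ 2)) Bt.
have w0 : U t / d1 tau t ^+ 2 != 0 by rewrite mulf_neq0 ?invr_eq0 ?expf_neq0.
split; last by rewrite divfK // addrC subrK.
  by rewrite /x mulrC divfK // subrK.
rewrite /fiber1 /p [U t * _]mulrC divfK //.
move: (_ * x) ('D_1 V t) (P * _) (mulfK T0 P) => a b w <-; congr (_ / _).
ring.
Qed.

(** The jets over a fixed t determine the coefficients of a linear equation. This identifies the
    arbitrary elements of an image without computing how push-forward formulas compose. *)
Lemma fiber_pushed E E' t : B t ->
  (forall x, maps_at (chart_transf c) E E' (row2 t x)) ->
  arb_elts E' (tau t) = pushed_elts E t.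
Proof.
move=> Bt h.
(* [fiber_surj] provides a jet whose image has x = X, x' = P and the x'' prescribed by the pushed
   equation; that jet satisfies E, so its image satisfies E', and the two equations are
   subtracted. *)
have key X P : (push1 c t (oa1 E t) - oa1 E' (tau t)) * P
    + (push0 c t (oa1 E t) (oa0 E t) - oa0 E' (tau t)) * X
    = pushb c t (oa1 E t) (oa0 E t) (ob E t) - ob E' (tau t).
  have [x [p [q [eX eP eQ]]]] := fiber_surj X P (pushb c t (oa1 E t) (oa0 E t) (ob E t)
    - push1 c t (oa1 E t) * P - push0 c t (oa1 E t) (oa0 E t) * X) Bt.
  have [_ _ _ hx] := h x.
  have z0 : comp0 (row2 t x) = t by rewrite /comp0 row2_0.
  have z1 : comp1 (row2 t x) = x by rewrite /comp1 row2_1.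
  have Bz : chart_set c (row2 t x) by rewrite /chart_set /= z0.
  have [pd p1 p2] := chart_prol p q Bz.
  have w0 : comp0 (chart_transf c (row2 t x)) = tau t by rewrite {1}/comp0 row2_0 z0.
  have w1 : comp1 (chart_transf c (row2 t x)) = U t * x + V t.
    by rewrite {1}/comp1 row2_1 z0 z1.
  have := (hx p q pd).1; rewrite /on_ode p1 p2 w0 w1 z0 z1.
  have [_] := push_ode x p q (oa1 E t) (oa0 E t) (ob E t) Bt.
  rewrite eX eP eQ addrAC subrK subrK => /(_ erefl) h1 /(_ h1) <-.
  ring.
(* An affine identity in (X, P) is evaluated at (0, 0), (0, 1) and (1, 0), which gives b, a1 and a0
   in turn. *)
have kb := key 0 0; rewrite !mulr0 addr0 in kb.
have k1 := key 0 1; rewrite mulr0 mulr1 addr0 -kb in k1.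
have k0 := key 1 0; rewrite mulr0 mulr1 add0r -kb in k0.
apply: row3P; rewrite !mxE /=; apply/esym/subr0_eq => //.
Qed.

End ChartEquiv.

(** * Reduction to the local straightening of linear equations *)

Section InverseChart.
Context (K : numFieldType).
Variable c : chart K.

Local Notation D := (ctau c @` cdom c).

Lemma csig_image : csig c @` D = cdom c.
Proof.
apply/seteqP; split=> [_ [_ [t Bt <-] <-]|t Bt]; first by rewrite ctauK.
by exists (ctau c t); [exists t|rewrite ctauK].
Qed.

Lemma inv_img_open : open (csig c @` D).
Proof. by rewrite csig_image; exact: cdom_open. Qed.

Lemma inv_sig_smooth : smooth_on (csig c @` D) (ctau c).
Proof. by rewrite csig_image; exact: (@ctau_smooth _ c). Qed.

Lemma nsmooth_sig n (f : K^o -> K^o) :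
  nsmooth (cdom c) n f -> nsmooth D n (fun s => f (csig c s) : K^o).
Proof.
move=> sf; apply: (nsmooth_comp1 (@cimg_open _ c) _ (csig_nsmooth c n) sf).
by move=> s /csigK[].
Qed.

Lemma inv_U_neq0 s : D s -> (cU c (csig c s))^-1 != 0.
Proof. by move=> /csigK[Bs _]; rewrite invr_eq0; exact: cU_neq0. Qed.

Lemma inv_U_smooth : smooth_on D (fun s => (cU c (csig c s))^-1 : K^o).
Proof.
apply/smooth_onP => n; apply: (nsmoothV (@cimg_open _ c)).
  by move=> s Ds; have := inv_U_neq0 Ds; rewrite invr_eq0.
exact: nsmooth_sig (cU_nsmooth c n).
Qed.

Lemma inv_V_smooth :
  smooth_on D (fun s => - (cV c (csig c s) / cU c (csig c s)) : K^o).
Proof.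
apply/smooth_onP => n; apply: (nsmoothN (@cimg_open _ c)).
apply: (nsmoothM (@cimg_open _ c)); first exact: nsmooth_sig (cV_nsmooth c n).
by move: n; apply/smooth_onP; exact: inv_U_smooth.
Qed.

Lemma inv_tauK s : D s -> ctau c (csig c s) = s.
Proof. by move/csigK => []. Qed.

Definition inv_chart : chart K :=
  Chart (@cimg_open _ c) inv_img_open (@csig_smooth _ c) inv_sig_smooth
    inv_U_smooth inv_V_smooth inv_U_neq0 inv_tauK.

Lemma inv_chartK z : chart_set c z -> chart_fun inv_chart (chart_fun c z) = z.
Proof.
move=> Bz; have U0 := @cU_neq0 _ c _ Bz.
apply: row2P; rewrite ?row2_0 ?row2_1 /comp0 /comp1 !row2_0 ?row2_1 /= ctauK //.
by rewrite mulrDr mulKf // [_^-1 * _]mulrC addrK.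
Qed.

Lemma chart_set_inv z : chart_set c z -> chart_set inv_chart (chart_fun c z).
Proof. by move=> Bz; exists (comp0 z) => //; rewrite /comp0 row2_0. Qed.

Lemma inv_chartVK w : chart_set inv_chart w ->
  chart_set c (chart_fun inv_chart w) /\ chart_fun c (chart_fun inv_chart w) = w.
Proof.
move=> Dw; have /csigK [Bs e] := Dw; have U0 := @cU_neq0 _ c _ Bs.
split; first by rewrite /chart_set /= /comp0 row2_0.
apply: row2P; rewrite ?row2_0 ?row2_1 /comp0 /comp1 !row2_0 ?row2_1 //=.
by rewrite [_^-1 * _]mulrC -mulrBl mulrC divfK // subrK.
Qed.

Lemma chart_image_dom :
  tdom (chart_transf inv_chart) = chart_transf c @` tdom (chart_transf c).
Proof.
apply/seteqP; split=> [w Dw|_ [z Bz <-]]; last exact: chart_set_inv.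
by have [B e] := inv_chartVK Dw; exists (chart_fun inv_chart w).
Qed.

Lemma maps_at_inv_chart E E' z : maps_at (chart_transf c) E E' z ->
  maps_at (chart_transf inv_chart) E' E (chart_transf c z).
Proof.
move=> h; have [Bz _ _ _] := h; apply: (maps_at_inv h).
- exact: chart_set_inv.
- exact: inv_chartK.
- have : nbhs (chart_fun c z) (chart_set inv_chart).
    by apply: open_nbhs_nbhs; split; [exact: chart_set_open|exact: chart_set_inv].
  by apply: filterS => w /inv_chartVK[].
by move=> p; have [] := chart_prol p 0 (chart_set_inv Bz).
Qed.

End InverseChart.

Section CompChart.
Context (K : numFieldType).
Variables c2 c1 : chart K.

Let B := cdom c1 `&` ctau c1 @^-1` cdom c2.

Lemma comp_chart_open : open B.
Proof.
apply: open_setI_preimage; [exact: cdom_open|exact: cdom_open|].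
move=> t Bt; apply: differentiable_continuous.
exact: nsmooth_diff (ctau_nsmooth c1 0) Bt.
Qed.

Let D := ctau c2 @` cdom c2 `&` csig c2 @^-1` (ctau c1 @` cdom c1).

(** As a preimage under the smooth map [csig c2], the image of the composite is visibly open, which
    the chart record demands. *)
Lemma comp_chart_image : (ctau c2 \o ctau c1) @` B = D.
Proof.
apply/seteqP; split=> [_ [t [Bt Bt'] <-]|s [[u Bu <-]]].
  by split; [exists (ctau c1 t)|exists t => //=; rewrite ctauK].
rewrite /= ctauK // => -[t Bt e]; exists t; last by rewrite /= e.
by split=> //=; rewrite e.
Qed.

Lemma comp_chart_img_open : open ((ctau c2 \o ctau c1) @` B).
Proof.
rewrite comp_chart_image.
apply: open_setI_preimage; [exact: cimg_open|exact: cimg_open|].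
move=> t Bt; apply: differentiable_continuous.
exact: nsmooth_diff (csig_nsmooth c2 0) Bt.
Qed.

Let comp_tau n (f : K^o -> K^o) :
  nsmooth (cdom c2) n f -> nsmooth B n (fun t => f (ctau c1 t) : K^o).
Proof.
move=> sf; apply: (nsmooth_comp1 comp_chart_open _ _ sf); first by move=> t [].
by apply: nsmooth_subset (ctau_nsmooth c1 n) => t [].
Qed.

Lemma comp_tau_smooth : smooth_on B (ctau c2 \o ctau c1).
Proof. by apply/smooth_onP => n; exact: comp_tau (ctau_nsmooth c2 n). Qed.

Lemma comp_sig_smooth :
  smooth_on ((ctau c2 \o ctau c1) @` B) (csig c1 \o csig c2).
Proof.
apply/smooth_onP => n.
apply: (nsmooth_comp1 comp_chart_img_open _ _ (csig_nsmooth c1 n)).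
  by rewrite comp_chart_image => s [].
by rewrite comp_chart_image; apply: nsmooth_subset (csig_nsmooth c2 n) => s [].
Qed.

Lemma comp_U_smooth : smooth_on B (fun t => cU c2 (ctau c1 t) * cU c1 t : K^o).
Proof.
apply/smooth_onP => n; apply: (nsmoothM comp_chart_open).
  exact: comp_tau (cU_nsmooth c2 n).
by apply: nsmooth_subset (cU_nsmooth c1 n) => t [].
Qed.

Lemma comp_V_smooth :
  smooth_on B (fun t => cU c2 (ctau c1 t) * cV c1 t + cV c2 (ctau c1 t) : K^o).
Proof.
apply/smooth_onP => n; apply: (nsmoothD comp_chart_open);
  last exact: comp_tau (cV_nsmooth c2 n).
apply: (nsmoothM comp_chart_open); first exact: comp_tau (cU_nsmooth c2 n).
by apply: nsmooth_subset (cV_nsmooth c1 n) => t [].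
Qed.

Lemma comp_U_neq0 t : B t -> cU c2 (ctau c1 t) * cU c1 t != 0.
Proof. by move=> [Bt Bt']; rewrite mulf_neq0 //; exact: cU_neq0. Qed.

Lemma comp_tauK t : B t -> (csig c1 \o csig c2) ((ctau c2 \o ctau c1) t) = t.
Proof. by move=> [Bt Bt'] /=; rewrite ctauK // ctauK. Qed.

Definition comp_chart : chart K :=
  Chart comp_chart_open comp_chart_img_open comp_tau_smooth comp_sig_smooth
    comp_U_smooth comp_V_smooth comp_U_neq0 comp_tauK.

Lemma comp_chartE : chart_fun comp_chart = chart_fun c2 \o chart_fun c1.
Proof.
apply/funext => z; have E0 c : comp0 (chart_fun c z) = ctau c (comp0 z).
  by rewrite /comp0 row2_0.
apply: row2P; first by rewrite /= !row2_0 E0.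
by rewrite /= !row2_1 E0 {2}/comp1 row2_1 /= mulrDr mulrA addrA.
Qed.

Lemma comp_chart_setE z :
  chart_set comp_chart z <-> chart_set c1 z /\ chart_set c2 (chart_fun c1 z).
Proof. by rewrite /chart_set /= {3}/comp0 row2_0. Qed.

End CompChart.

(** The new independent variable is [ctau] of the old one, so its D_t is a multiple of D_t of the
    t-component of T and vanishes with it. *)
Lemma prol_def_comp_chart (K : numFieldType) (c : chart K) (T : transf K 2) z p :
  tdom T z -> chart_set c (T z) ->
  prol_def (comp_transf (chart_transf c) T) z p -> prol_def T z p.
Proof.
move=> Tz Bz; apply: contraNN => /eqP T0; rewrite /total1.
have -> : (fun y => comp0 (comp_transf (chart_transf c) T y) : K^o) =
    ctau c \o (fun y => comp0 (T y) : K^o).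
  by apply/funext => y; rewrite /= /comp0 row2_0.
have dT : differentiable (fun y => comp0 (T y) : K^o) z.
  by apply: nsmooth_diff (nsmooth_coord (@tdom_open _ _ T) 0 (tfun_nsmooth T 0)) Tz.
rewrite derive_comp1 //; last exact: nsmooth_diff (ctau_nsmooth c 0) _.
by rewrite /total1 in T0; rewrite T0 scale0r.
Qed.

(** Bridges [comp_chart] and [comp_transf]: the same map, but different records with different
    descriptions of the domain. *)
Lemma maps_at_eq (K : numFieldType) (S T : transf K 2) E E' z :
  tdom S z -> tfun T = tfun S -> maps_at T E E' z -> maps_at S E E' z.
Proof. by move=> Sz e [Tz Ez E'z h]; split; rewrite -?e. Qed.

Section Straightening.
Context (K : numFieldType).

Definition straightens (c : chart K) (E : linear_ode K) : Prop :=
  cdom c `<=` odom E /\ forall t, cdom c t -> pushed_elts c E t = 0.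

Lemma straightens_maps_at c E z : straightens c E -> chart_set c z ->
  maps_at (chart_transf c) E (free_ode K) z.
Proof.
move=> [cE e0] Bz; apply: chart_maps_at => //; first exact: cE.
by rewrite e0 //; apply: row3P; rewrite !mxE.
Qed.

Lemma straightens_sends_at c E z : straightens c E -> chart_set c z ->
  sends_at (chart_equiv c) E (free_ode K) z.
Proof.
move=> cE Bz; apply: chart_image_at => //; first exact: straightens_maps_at.
by case: cE => _ -> //; apply: row3P; rewrite !mxE.
Qed.

Hypothesis straightening : forall (E : linear_ode K) (z : 'rV[K]_2),
  odom E (comp0 z) ->
  exists c, [/\ straightens c E, chart_set c z & chart_fun c z = 0].

Lemma generated_of_straightening : groupoid_generated_via_free K.
Proof.
move=> E1 E2 T ET z0 Tz0; have [_ Ez Ez' _] := ET _ Tz0.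
have [c1 [c1E B1 _]] := straightening Ez.
have [c2 [c2E B2 _]] := straightening Ez'.
pose P1 := chart_transf c1; pose P2 := chart_transf c2.
pose Q1 := chart_transf (inv_chart c1).
exists (chart_equiv c1), (chart_equiv c2),
  (comp_transf P2 (comp_transf T Q1)), (chart_transf (inv_chart c2)).
split.
- move=> w [[Q1w TQ1w] P2w].
  (* In T o Q1 the first factor is a chart, and composing with P2 afterwards puts a chart last; both
     cases meet the definedness condition of [maps_at_comp]. *)
  apply: (@maps_at_comp _ P2 (comp_transf T Q1) _ E2).
  + apply: (@maps_at_comp _ T Q1 _ E1).
    * have [Bw e] := inv_chartVK Q1w; rewrite -[X in maps_at _ _ _ X]e.
      exact/maps_at_inv_chart/straightens_maps_at.
    * exact: ET.
    * by move=> p _; have [] := chart_prol p 0 Q1w.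
  + exact: straightens_maps_at.
  + by move=> p; exact: prol_def_comp_chart.
- split; first exact: chart_image_dom.
  by move=> z Bz; exact: inv_chartK.
have : nbhs z0 (chart_set c1 `&` (tdom T `&` T @^-1` chart_set c2)).
  apply: open_nbhs_nbhs; split=> //; apply: openI; first exact: chart_set_open.
  exact: (@comp_transf_open _ _ P2 T).
apply: filterS => z [B1z [Tz B2z]].
have eQ : chart_fun (inv_chart c1) (chart_fun c1 z) = z by exact: inv_chartK.
have dQ : tdom Q1 (P1 z) by exact: chart_set_inv.
split.
- exact: straightens_sends_at.
- exact: straightens_sends_at.
- split; last by rewrite /= eQ.
  by split; last by rewrite /= eQ.
- by rewrite /= eQ; exact: chart_set_inv.
- by rewrite /= eQ inv_chartK.
Qed.

Lemma semi_normalized_of_straightening : semi_normalized K.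
Proof.
move=> E E' T ET z0 Tz0; have [_ Ez Ez' _] := ET _ Tz0.
have [c1 [c1E B1 e1]] := straightening Ez.
have [c2 [c2E B2 e2]] := straightening Ez'.
pose c := comp_chart (inv_chart c2) c1.
have cz0 : chart_set c z0.
  (* Both straightening charts send their base points to 0, so the composite chart is defined at
     [z0] and takes it to [T z0]. *)
  by apply/comp_chart_setE; split=> //; rewrite e1 -e2; exact: chart_set_inv.
have ez0 : chart_fun c z0 = T z0 by rewrite comp_chartE /= e1 -e2 inv_chartK.
have cE z : chart_set c z -> maps_at (chart_transf c) E E' z.
  move=> Bz; have /comp_chart_setE[B1z B2z] := Bz.
  apply: (@maps_at_eq _ _ (comp_transf (chart_transf (inv_chart c2))
    (chart_transf c1))) => //.
    by rewrite /= comp_chartE.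
  apply: (@maps_at_comp _ _ _ _ (free_ode K)); first exact: straightens_maps_at.
    have [Bw e] := inv_chartVK B2z; rewrite -[X in maps_at _ _ _ X]e.
    exact/maps_at_inv_chart/straightens_maps_at.
  by move=> p _; have [] := chart_prol p 0 B1z.
(* Mapping E to E' on a whole fibre forces the coefficient values of E', as [sends_at] requires. *)
have cS z : chart_set c z -> sends_at (chart_equiv c) E E' z.
  move=> Bz; apply: chart_image_at => //; first exact: cE.
  apply: fiber_pushed => // x; apply: cE.
  have e : comp0 (row2 (comp0 z) x) = comp0 z by rewrite {1}/comp0 row2_0.
  by rewrite /chart_set /mkset e.
exists (comp_transf (chart_transf (inv_chart c)) T), (chart_equiv c); split.
  move=> z [Tz Cz]; apply: (@maps_at_comp _ _ _ _ E'); first exact: ET.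
    have [Bw e] := inv_chartVK Cz; rewrite -[X in maps_at _ _ _ X]e.
    exact/maps_at_inv_chart/cE.
  by move=> p; exact: prol_def_comp_chart.
have : nbhs z0 (tdom T `&` T @^-1` chart_set (inv_chart c)).
  apply: open_nbhs_nbhs; split;
    first exact: (@comp_transf_open _ _ (chart_transf (inv_chart c)) T).
  by split=> //; rewrite /preimage /mkset -ez0; exact: chart_set_inv.
apply: filterS => z [Tz Cz]; have [Bw e] := inv_chartVK Cz.
by split; [split|exact: cS|rewrite /= e].
Qed.

End Straightening.

(** * The swap of variables is not an equivalence transformation *)

Section Swap.
Context (K : numFieldType).

Definition swap_fun (z : 'rV[K]_2) : 'rV[K]_2 := row2 (comp1 z) (comp0 z).

Lemma swap_fun_smooth : smooth_on setT swap_fun.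
Proof.
apply/smooth_onP => n; apply: (nsmooth_row openT) => -[[|[|//]] i].
  by under eq_fun do rewrite mxE /=; exact: nsmooth_proj.
by under eq_fun do rewrite mxE /=; exact: nsmooth_proj.
Qed.

Lemma swap_funK : involutive swap_fun.
Proof. by move=> z; apply: row2P;
  rewrite /swap_fun /comp0 /comp1 !(row2_0, row2_1). Qed.

Lemma swap_fun_jacobian z : setT z -> \det ('J swap_fun z) != 0.
Proof.
move=> _; have dS y : differentiable swap_fun y.
  by have /smooth_onP/(_ 0%N) := swap_fun_smooth; move/nsmooth_diff; exact.
(* The swap is an involution, so by the chain rule its determinant has an inverse. *)
have : \det ('J (swap_fun \o swap_fun) z) = 1.
  have -> : swap_fun \o swap_fun = id by apply/funext => y; exact: swap_funK.
  rewrite (_ : 'J id z = 1%:M) ?det1 //; apply/row_matrixP => i.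
  have did : differentiable (@id 'rV[K]_2) z by exact: ex_diff.
  by rewrite !rowE -(deriveEjacobian _ did) derive_id mulmx1.
rewrite jacobian_comp ?det_mulmx // => h.
have aux (x y : K) : x * y = 1 -> x != 0.
  by apply: contra_eq_neq => ->; rewrite mul0r eq_sym oner_neq0.
exact: aux h.
Qed.

Definition swap : transf K 2 := Transf openT swap_fun_smooth swap_fun_jacobian.

Lemma swap_prol z p q :
  [/\ prol_def swap z p = (p != 0) :> Prop, prol1 swap z p = p^-1
    & prol2 swap z p q = - q / p ^+ 3].
Proof.
have [t10 t11 t20 t21] := coord_total z p q.
have e0 : (fun y => comp0 (swap y) : K^o) = (fun y => comp1 y).
  by apply/funext => y; rewrite /comp0 row2_0.
have e1 : (fun y => comp1 (swap y) : K^o) = (fun y => comp0 y).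
  by apply/funext => y; rewrite /comp1 row2_1.
rewrite /prol_def /prol1 /prol2 e0 e1 t10 t11 t20 t21.
by split=> //; rewrite ?mul0r ?mul1r ?sub0r.
Qed.

Lemma swap_admissible : admissible (free_ode K) (free_ode K) swap.
Proof.
move=> z _; split=> // p q; have [-> -> ->] := swap_prol z p q => p0.
rewrite /on_ode /= !mul0r !addr0; split=> [->|/eqP]; first by rewrite oppr0 mul0r.
by rewrite mulf_eq0 invr_eq0 expf_eq0 (negPf p0) andbF orbF oppr_eq0 => /eqP.
Qed.

Definition cst_ode (a1 a0 b : K) : linear_ode K :=
  @LinearOde K setT (fun=> a1) (fun=> a0) (fun=> b) openT
    (@smooth_on_cst K K^o K^o setT a1) (@smooth_on_cst K K^o K^o setT a0)
    (@smooth_on_cst K K^o K^o setT b).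

(** By openness, a joint transformation acting on the coefficients of x'' = 0 over [z] also acts on
    those of some x'' = e with e nonzero, over the same derivatives [d]. *)
Lemma joint_path_open (D : set 'rV[K]_(2 + (2 + 3))) (z d : 'rV[K]_2) :
  open D -> D (joint z d 0) ->
  exists2 e : K, e != 0 & D (joint z d (row3 0 0 e)).
Proof.
move=> oD Dz; pose g (e : K^o) := joint z d (row3 0 0 e : 'rV[K]_3).
have sg n : nsmooth setT n g.
  apply: (nsmooth_row_mx openT); first exact: nsmooth_cst.
  apply: (nsmooth_row_mx openT); first exact: nsmooth_cst.
  apply: (nsmooth_row openT) => -[[|[|[|//]]] i].
  - by under eq_fun do rewrite mxE /=; exact: nsmooth_cst.
  - by under eq_fun do rewrite mxE /=; exact: nsmooth_cst.
  under eq_fun do rewrite mxE /=.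
  by apply: nsmooth_linear => // x.
have cg : {for 0, continuous g}.
  by apply: differentiable_continuous; exact: nsmooth_diff (sg 0%N) _.
have g0 : g 0 = joint z d 0.
  congr joint; apply/rowP => i; rewrite !mxE.
  by case: i => -[|[|[|//]]].
have Dg : \forall e \near 0, D (g e).
  by apply: cg; rewrite g0; exact: open_nbhs_nbhs.
have /filter_ex[e [De e0]] : \forall e \near (0 : K^o)^', D (g e) /\ e != 0.
  near=> e; split; last by near: e; exact: nbhs_dnbhs_neq.
  by near: e; exact: nbhs_dnbhs Dg.
by exists e.
Unshelve. all: by end_near. Qed.

Lemma not_normalized : ~ normalized K.
Proof.
move=> /(_ _ _ _ swap_admissible 0 I) [Phi nPhi].
have [[[_ [d Dd]] _ _] e0] := nbhs_singleton nPhi.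
have nS : {near (0 : 'rV[K]_2), eproj Phi =1 swap}.
  by apply: filterS nPhi => z [_ ->].
have D0 : tdom (ejoint Phi) (joint 0 d 0).
  move: Dd; congr (tdom _ (joint _ _ _)).
  by apply/rowP => i; rewrite !mxE; case: i => -[|[|[|//]]].
have [e ene De] := joint_path_open (@tdom_open _ _ (ejoint Phi)) D0.
have [E' hE] := @emaps _ Phi (cst_ode 0 0 e).
have [_ [_ _ _ hm] _] : image_at (ejoint Phi) (eproj Phi) (cst_ode 0 0 e) E' 0.
  by apply: hE; split=> //; exists d.
have [n1 n2 n3] := near_prol nS.
(* The swap fixes (0, 0) and takes (p, e) to (1/p, -e/p^3); at x = 0 the a0-term drops out, leaving
   a relation between [oa1 E' 0] and [ob E' 0] for every nonzero p. *)
have key p : p != 0 -> - e / p ^+ 3 + oa1 E' 0 / p = ob E' 0.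
  move=> p0; have := hm p e; rewrite n1 n2 n3 -e0.
  have [-> -> ->] := swap_prol 0 p e.
  have [w0 w1] : comp0 (swap 0) = 0 /\ comp1 (swap 0) = 0.
    by rewrite /= /swap_fun /comp0 /comp1 row2_0 row2_1 !mxE.
  rewrite /on_ode w0 w1 /= !mulr0 !mul0r !addr0.
  by move=> /(_ p0) [/(_ erefl)].
(* The values p = 1, -1, 1/2 give a - e = b, e - a = b and 2a - 8e = b. The first two yield b = 0
   and a = e, and then the third yields 6e = 0. *)
have k1 := key 1 (oner_neq0 _).
have k2 := key (- 1) (_ : - 1 != 0); rewrite oppr_eq0 oner_eq0 in k2.
have {}k2 := k2 isT.
have n20 : (2^-1 : K) != 0 by rewrite invr_eq0 pnatr_eq0.
have k3 := key 2^-1 n20.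
move: k1 k2 k3; move: (oa1 E' 0) (ob E' 0) => a b k1 k2 k3.
have : e *+ 6 = 0.
  have -> : e *+ 6 = (a - e) * 2 - (a * 2 - e * 8) by ring.
  have -> : a - e = b by rewrite -k1; field.
  have -> : a * 2 - e * 8 = b by rewrite -k3; field.
  have b0 : b * 2 = 0.
    have -> : b * 2 = b + b by ring.
    by rewrite -{1}k1 -k2; field.
  have bz : b = 0 by move/eqP: b0; rewrite mulf_eq0 pnatr_eq0 orbF => /eqP.
  by rewrite bz mul0r subr0.
by move/eqP; rewrite mulrn_eq0 (negPf ene).
Qed.

End Swap.

(** * Analysis over a complete field *)

(* The topology of [K] described by a real-valued absolute value, so that the
   estimates are inequalities between real numbers also when [K] is R[i]. *)
Record absval (R : realType) (K : numFieldType) := AbsVal {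
  av :> K -> R;
  av_ge0 : forall x, 0 <= av x;
  av_eq0 : forall x, av x = 0 -> x = 0;
  avM : forall x y, av (x * y) = av x * av y;
  avD : forall x y, av (x + y) <= av x + av y;
  av_nat : forall n : nat, av n%:R = n%:R;
  av_small : forall e : K, 0 < e -> exists2 d : R, 0 < d &
    forall x, av x < d -> `|x| < e;
  av_norm : forall d : R, 0 < d -> exists2 e : K, 0 < e &
    forall x, `|x| < e -> av x < d;
  av_complete_ex : forall (u : nat -> K) (C : R),
    (forall n, av (u n.+1 - u n) <= C * 2^-1 ^+ n) ->
    exists l, exists C', forall n, av (u n - l) <= C' * 2^-1 ^+ n }.

Section AbsVal.
Context (R : realType) (K : numFieldType) (N : absval R K).

Lemma av0 : N 0 = 0. Proof. exact: (av_nat N 0). Qed.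
Lemma av1 : N 1 = 1. Proof. exact: (av_nat N 1). Qed.

Lemma avN x : N (- x) = N x.
Proof.
rewrite -mulN1r avM; suff -> : N (- 1) = 1 by rewrite mul1r.
have h : N (-1) * N (-1) = 1 by rewrite -avM mulrNN mulr1 av1.
have := av_ge0 N (-1); nra.
Qed.

Lemma avB x y : N (x - y) = N (y - x). Proof. by rewrite -avN opprB. Qed.

Lemma avBD x y z : N (x - z) <= N (x - y) + N (y - z).
Proof. by rewrite -(subrKA y x) ; apply: avD. Qed.

Lemma av_gt0 x : x != 0 -> 0 < N x.
Proof.
move=> x0; rewrite lt_neqAle av_ge0 andbT; apply: contraNneq x0 => /esym /av_eq0 ->.
by rewrite eqxx.
Qed.

Lemma avV x : N x^-1 = (N x)^-1.
Proof.
have [->|x0] := eqVneq x 0; first by rewrite invr0 av0 invr0.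
have Nx : N x != 0 by rewrite gt_eqF // av_gt0.
by apply: (mulfI Nx); rewrite -avM !mulfV // av1.
Qed.

Lemma half_small (e : R) : 0 < e -> exists n, 2^-1 ^+ n < e.
Proof.
move=> e0; have [n hn] : exists n : nat,
  e^-1 < n%:R by exists (Num.truncn e^-1).+1; rewrite truncnS_gt.
exists n; rewrite exprVn invf_plt ?posrE ?exprn_gt0 //.
apply: lt_le_trans hn _; rewrite -natrX ler_nat ltnW //; exact: ltn_expl.
Qed.

(** The substitute for passing to the limit: equalities of limits are proved by bounding [N] of the
    difference by C 2^-n for every n. *)
Lemma le_half_pow (a C : R) : (forall n, a <= C * 2^-1 ^+ n) -> a <= 0.
Proof.
move=> h; rewrite leNgt; apply/negP => a0.
have C0 : 0 < C by have := h 0%N; rewrite expr0 mulr1; lra.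
have [n hn] := half_small (divr_gt0 a0 C0).
have := h n; rewrite leNgt => /negP; apply.
by rewrite mulrC -ltr_pdivlMr.
Qed.

(** The bound supplied with the limit has an uncontrolled constant. Summing the increments from n to
    n + k and letting k grow replaces it by the explicit 2 C. *)
Lemma av_complete (u : nat -> K) (C : R) :
  (forall n, N (u n.+1 - u n) <= C * 2^-1 ^+ n) ->
  exists l, forall n, N (u n - l) <= 2 * C * 2^-1 ^+ n.
Proof.
move=> hu; have [l [C' hl]] := av_complete_ex hu; exists l => n.
have geo k : N (u n - u (n + k)%N) <= 2 * C * 2^-1 ^+ n - 2 * C * 2^-1 ^+ (n + k).
  elim: k => [|k IHk]; first by rewrite addn0 !subrr av0.
  have := avBD (u n) (u (n + k)%N) (u (n + k).+1).
  have := hu (n + k)%N; rewrite addnS (avB (u (n + k).+1)) exprS; lra.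
rewrite -subr_le0; apply: (@le_half_pow _ (C' * 2^-1 ^+ n - 2 * C * 2^-1 ^+ n)) => k.
by have := geo k; have := hl (n + k)%N; have := avBD (u n) (u (n + k)%N) l;
  rewrite exprD; lra.
Qed.

Lemma nbhs_avP (x : K^o) (P : set K^o) :
  nbhs x P <-> exists2 d : R, 0 < d & forall y, N (y - x) < d -> P y.
Proof.
split=> [/nbhs_ballP[e e0 he]|[d d0 hd]].
  have [d d0 hd] := av_small N e0; exists d => // y /hd yx; apply: he.
  by rewrite /= -ball_normE /= distrC.
have [e e0 he] := av_norm N d0.
apply/nbhs_ballP; exists e => //= y; rewrite -ball_normE /= => xy.
by apply/hd/he; rewrite distrC.
Qed.

Definition deriv_at (f : K -> K) (x l : K) : Prop :=
  forall e : R, 0 < e -> exists2 d : R, 0 < d & forall y, N (y - x) < d ->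
    N (f y - f x - l * (y - x)) <= e * N (y - x).

Lemma deriv_atP (f : K^o -> K^o) (x l : K^o) : is_derive x 1 f l <-> deriv_at f x l.
Proof.
have quot h : h != 0 -> forall w : K,
    w - h^-1 *: ((f \o shift x) (h *: (1 : K^o)) - f x) =
    - h^-1 * (f (h + x) - f x - w * h).
  move=> h0 w /=; rewrite [h *: _]mulr1 /GRing.scale /= [RHS]mulrBr !mulNr opprK.
  by rewrite (mulrC w) mulKf // addrC.
split=> [df e e0|df].
  have [r r0 hr] := av_norm N e0.
  have /cvgrPdist_lt : h^-1 *: ((f \o shift x) (h *: (1 : K^o)) - f x) @[h -->
    0^'] --> l.
    by rewrite -(@derive_val _ _ _ _ _ _ _ df); exact: (@ex_derive _ _ _ _ _ _ _ df).
  move=> /(_ r r0); rewrite near_withinE => /nbhs_avP[d d0 hd]; exists d => // y yx.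
  have [->|yx0] := eqVneq y x; first by rewrite !subrr mulr0 subr0 av0 mulr0.
  have h0 : y - x != 0 by rewrite subr_eq0.
  have := hd (y - x); rewrite subr0 => /(_ yx h0); rewrite quot // => /hr.
  rewrite subrK mulNr avN avM avV.
  by rewrite ltr_pdivrMl ?av_gt0 // [X in _ < X]mulrC => /ltW.
have cv : h^-1 *: ((f \o shift x) (h *: (1 : K^o)) - f x) @[h --> 0^'] --> l.
  apply/cvgrPdist_lt => e e0; have [d d0 hd] := av_small N e0.
  have d20 : 0 < d / 2 by lra.
  have [r r0 hr] := df _ d20.
  rewrite near_withinE; apply/nbhs_avP; exists r => // h; rewrite subr0 => hr' h0.
  apply: hd; rewrite quot // mulNr avN avM avV ltr_pdivrMl ?av_gt0 //.
  have := hr (h + x); rewrite addrK => /(_ hr'); have := av_gt0 h0.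
  by nra.
by apply: DeriveDef; [apply/cvg_ex; exists l|apply: cvg_lim].
Qed.

(** If the slope from a to b exceeded M, one of the two halves would have at least the same slope.
    Repeated halving yields a limit point c at which the derivative bound is violated. The set [P]
    must contain midpoints and geometric limits for c to stay inside. *)
Lemma av_mean_value (P : K -> Prop) (f g : K -> K) (M : R) (a b : K) :
  (forall x y, P x -> P y -> P (2^-1 * (x + y))) ->
  (forall (u : nat -> K) l, (forall n, P (u n)) ->
    (exists C, forall n, N (u n - l) <= C * 2^-1 ^+ n) -> P l) ->
  (forall x, P x -> deriv_at f x (g x) /\ N (g x) <= M) ->
  P a -> P b -> N (f b - f a) <= M * N (b - a).
Proof.
move=> Pmid Plim Pd Pa Pb; rewrite leNgt; apply/negP => lt.
have M0 : 0 <= M by have [_] := Pd _ Pa; apply: le_trans; exact: av_ge0.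
have ab : 0 < N (b - a).
  apply: av_gt0; rewrite subr_eq0; apply/eqP => e.
  by move: lt; rewrite e !subrr av0 mulr0 ltxx.
pose M' := N (f b - f a) / N (b - a).
have MM' : M < M' by rewrite /M' ltr_pdivlMr.
pose good (p : K * K) := [/\ P p.1, P p.2 & M' * N (p.2 - p.1) <= N (f p.2 - f p.1)].
have N2 : N 2^-1 = 2^-1 by rewrite avV av_nat.
have n2 : (2 : K) != 0 by rewrite pnatr_eq0.
have step (p : {p | good p}) : {q : {q | good q} |
    (sval q).2 - (sval q).1 = 2^-1 * ((sval p).2 - (sval p).1) /\
    N ((sval q).1 - (sval p).1) <= 2^-1 * N ((sval p).2 - (sval p).1)}.
  case: p => -[x y] [/= Px Py h]; apply: cid.
  pose m := 2^-1 * (x + y).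
  have Pm : P m by exact: Pmid.
  have ym : y - m = 2^-1 * (y - x) by rewrite /m; field.
  have mx : m - x = 2^-1 * (y - x) by rewrite /m; field.
  have [le1|le1] := leP (M' * N (m - x)) (N (f m - f x)).
    have gd : good (x, m) by [].
    exists (exist _ _ gd) => /=; split=> //; rewrite subrr av0.
    by rewrite mulr_ge0 ?av_ge0 //; lra.
  have gd : good (m, y).
    split=> //=; have := avBD (f y) (f m) (f x); move: h le1.
    rewrite ym mx avM N2; lra.
  exists (exist _ _ gd) => /=; split=> //.
  by rewrite mx avM N2.
have gab : good (a, b) by split=> //=; rewrite /M' divfK // gt_eqF.
pose s := fix s n := if n is m.+1 then sval (step (s m)) else exist _ _ gab.
have sE n : (sval (s n)).2 - (sval (s n)).1 = 2^-1 ^+ n * (b - a).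
  elim: n => [|n IHn]; first by rewrite expr0 mul1r.
  by rewrite exprS -mulrA -IHn; have [] := svalP (step (s n)).
have NsE n : N ((sval (s n)).2 - (sval (s n)).1) = 2^-1 ^+ n * N (b - a).
  by rewrite sE avM; congr (_ * _); elim: n => [|n IHn];
    rewrite ?av1 // !exprS avM N2 IHn.
have [c hc] : exists l, forall n,
  N ((sval (s n)).1 - l) <= 2 * (2^-1 * N (b - a)) * 2^-1 ^+ n.
  apply: (@av_complete (fun n => (sval (s n)).1)) => n.
  have [_ h] := svalP (step (s n)); apply: le_trans h _; rewrite NsE; lra.
have Pc : P c.
  apply: (Plim (fun n => (sval (s n)).1)) => [n|]; first by have [] := svalP (s n).
  by exists (2 * (2^-1 * N (b - a))).
have [dc gM] := Pd _ Pc.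
(* With W the length of the n-th interval, its ends lie within W and 2 W of c. The two remainders
   total at most 3/4 (M' - M) W, short of the excess (M' - M) W. *)
have e0 : 0 < (M' - M) / 4 by lra.
have [d d0 hd] := dc _ e0.
have [n hn] := half_small (divr_gt0 d0 (mulr_gt0 (ltr0n R 2) ab)).
have hn' : 2 * N (b - a) * 2^-1 ^+ n < d.
  by rewrite mulrC -ltr_pdivlMr // mulr_gt0 ?ltr0n.
have [_ _ Mle] := svalP (s n).
move: (hc n) (NsE n) Mle; move: (sval (s n)) => [x y] /= hx xy.
rewrite xy; set w := 2^-1 ^+ n in hx xy hn' *.
have w0 : 0 < w * N (b - a) by rewrite mulr_gt0 // exprn_gt0 // invr_gt0 ltr0n.
have hy : N (y - c) <= 2 * (w * N (b - a)).
  apply: le_trans (avBD y x c) _; rewrite xy; move: hx; lra.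
have dx : N (x - c) < d by apply: le_lt_trans hx _; move: hn'; rewrite -/w; lra.
have dy : N (y - c) < d by apply: le_lt_trans hy _; move: hn'; lra.
have := hd _ dx; have := hd _ dy.
have -> : f y - f x = (f y - f c - g c * (y - c)) - (f x - f c - g c * (x - c))
  + g c * (y - x) by ring.
move: (f y - f c - g c * (y - c)) (f x - f c - g c * (x - c)) => A B hA hB.
have := avD N (A - B) (g c * (y - x)); have := avD N A (- B).
rewrite avN avM xy; set W := w * N (b - a) in w0 hy *.
have hx' : N (x - c) <= W by apply: le_trans hx _; rewrite /W; lra.
have := mulr_ge0 (ltW e0) (av_ge0 N (y - c)).
have : N (g c) * W <= M * W by rewrite ler_wpM2r // ltW.
have : (M' - M) / 4 * N (y - c) <= (M' - M) / 4 * (2 * W) by rewrite ler_wpM2l // ltW.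
have : (M' - M) / 4 * N (x - c) <= (M' - M) / 4 * W by rewrite ler_wpM2l // ltW.
have : 0 < (M' - M) * W by rewrite mulr_gt0 // subr_gt0.
move: (N (y - c)) (N (x - c)) (N (g c)) (N A) (N B) hA hB (N (A - B)) (N (A - B
  + g c * (y - x))) => ny nx ng nA nB hA hB nAB nn.
lra.
Qed.

End AbsVal.

(** * Mean value estimates and limits of derivatives *)

Section DerivAt.
Context (R : realType) (K : numFieldType) (N : absval R K).
Implicit Types (f g : K -> K) (x y z c : K) (r : R).

Lemma deriv_at_cst (a x : K) : deriv_at N (fun=> a) x 0.
Proof. by apply/deriv_atP; exact: is_derive_cst. Qed.

Lemma deriv_at_id x : deriv_at N id x 1.
Proof. by apply/deriv_atP; exact: is_derive_id. Qed.

Lemma deriv_atD f g x l m : deriv_at N f x l -> deriv_at N g x m ->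
  deriv_at N (fun z => f z + g z) x (l + m).
Proof.
by move=> /deriv_atP df /deriv_atP dg; apply/deriv_atP; exact: is_deriveD.
Qed.

Lemma deriv_atM f g x l m : deriv_at N f x l -> deriv_at N g x m ->
  deriv_at N (fun z => f z * g z) x (f x * m + g x * l).
Proof.
by move=> /deriv_atP df /deriv_atP dg; apply/deriv_atP; exact: is_deriveM.
Qed.

Lemma deriv_at_eq f x l m : deriv_at N f x l -> l = m -> deriv_at N f x m.
Proof. by move=> ? <-. Qed.

Lemma deriv_atZ f x l (k : K) : deriv_at N f x l ->
  deriv_at N (fun z => k * f z) x (k * l).
Proof.
move=> df; have := deriv_atM (deriv_at_cst k x) df => /deriv_at_eq; apply.
by rewrite mulr0 addr0.
Qed.

Lemma deriv_atB f g x l m : deriv_at N f x l -> deriv_at N g x m ->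
  deriv_at N (fun z => f z - g z) x (l - m).
Proof.
by move=> /deriv_atP df /deriv_atP dg; apply/deriv_atP; exact: is_deriveB.
Qed.

Lemma deriv_at_sum n (f : nat -> K -> K) x (l : nat -> K) :
  (forall i, (i < n)%N -> deriv_at N (f i) x (l i)) ->
  deriv_at N (fun z => \sum_(0 <= i < n) f i z) x (\sum_(0 <= i < n) l i).
Proof.
elim: n => [|n IHn] h.
  rewrite big_nil (_ : (fun z => _) = fun=> 0); first exact: deriv_at_cst.
  by apply/funext => z; rewrite big_nil.
rewrite big_nat_recr //= (_ : (fun z => _) = fun z =>
  \sum_(0 <= i < n) f i z + f n z); last first.
  by apply/funext => z; rewrite big_nat_recr.
by apply: deriv_atD; [apply: IHn => i ni; apply: h; exact: ltnW|exact: h].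
Qed.

Lemma deriv_at_comp f g x l m : deriv_at N f x l -> deriv_at N g (f x) m ->
  deriv_at N (fun z => g (f z)) x (m * l).
Proof.
move=> /deriv_atP df /deriv_atP dg; apply/deriv_atP.
have cf : differentiable (f : K^o -> K^o) x by apply/derivable1_diffP;
  exact: (@ex_derive _ _ _ _ _ _ _ df).
have cg : differentiable (g : K^o -> K^o) (f x) by apply/derivable1_diffP;
  exact: (@ex_derive _ _ _ _ _ _ _ dg).
apply: DeriveDef; first by apply/derivable1_diffP; exact: differentiable_comp.
rewrite [LHS](derive_comp1 _ cf cg) (@derive_val _ _ _ _ _ _ _ df) (@derive_val
  _ _ _ _ _ _ _ dg).
by rewrite /GRing.scale /= mulrC.
Qed.

Definition inball c r z := N (z - c) < r.

Lemma av_mean_value_ball f g M c r x y : inball c r x -> inball c r y ->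
  (forall z, inball c r z -> N (z - x) <= N (y - x) ->
    deriv_at N f z (g z) /\ N (g z) <= M) ->
  N (f y - f x) <= M * N (y - x).
Proof.
(* The open ball is not closed under limits, so the argument runs in the closed ball of radius m <
   r. *)
move=> xr yr h; pose m := Order.max (N (x - c)) (N (y - c)).
have mr : m < r by rewrite gt_max; apply/andP.
have N2 : N 2^-1 = 2^-1 by rewrite avV av_nat.
have n2 : (2 : K) != 0 by rewrite pnatr_eq0.
have mid p q u b : N (p - u) <= b -> N (q - u) <= b -> N (2^-1 * (p + q) - u) <= b.
  move=> hp hq; rewrite (_ : _ - u = 2^-1 * ((p - u) + (q - u))); last by field.
  by rewrite avM N2; have := avD N (p - u) (q - u); lra.
have lim (u : nat -> K) l b p : (forall n, N (u n - p) <= b) ->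
    (exists C, forall n, N (u n - l) <= C * 2^-1 ^+ n) -> N (l - p) <= b.
  move=> hu [C hC]; rewrite -subr_le0; apply: (@le_half_pow R _ C) => n.
  by have := hC n; have := hu n; have := avBD N l (u n) p; rewrite (avB N l (u n)); lra.
pose P z := N (z - c) <= m /\ N (z - x) <= N (y - x).
apply: (@av_mean_value _ _ _ P f g).
- by move=> p q [? ?] [? ?]; split; exact: mid.
- move=> u l hu hC; split; apply: lim hC => n; by have [] := hu n.
- by move=> z [zc zx]; apply: h => //; exact: le_lt_trans mr.
- by split; rewrite ?subrr ?av0 ?av_ge0 // le_max lexx.
- by split; rewrite ?lexx // le_max lexx orbT.
Qed.

(** The mean value inequality is applied to f - f1(x) id, whose derivative f1(z) - f1(x) is
    estimated by a second application. This is where only points z no farther from x than y should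
    count. *)
Lemma av_taylor f f1 f2 M c r x y : inball c r x -> inball c r y ->
  (forall z, inball c r z -> [/\ deriv_at N f z (f1 z), deriv_at N f1 z (f2 z)
     & N (f2 z) <= M]) ->
  N (f y - f x - f1 x * (y - x)) <= M * N (y - x) ^+ 2.
Proof.
move=> xr yr h.
rewrite (_ : _ - _ - _ = (f y - f1 x * y) - (f x - f1 x * x)); last by ring.
rewrite expr2 mulrA.
apply: (@av_mean_value_ball (fun z => f z - f1 x * z) (fun z =>
  f1 z - f1 x) _ c r) => //.
move=> z zr zx; have [df df1 M2] := h _ zr.
have M0 : 0 <= M by apply: le_trans M2; exact: av_ge0.
split.
  apply: deriv_atB => //; apply: (deriv_at_eq (deriv_atZ (f1 x) (deriv_at_id z))).
  by rewrite mulr1.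
apply: (@le_trans _ _ (M * N (z - x))); last by rewrite ler_wpM2l.
apply: (@av_mean_value_ball f1 f2 _ c r) => // w wr _.
by have [_] := h _ wr.
Qed.

Lemma inball_center c r : 0 < r -> inball c r c.
Proof. by rewrite /inball subrr av0. Qed.

(** Differentiation commutes with limits when the derivatives converge uniformly and the values at c
    are fixed; the mean value inequality transfers the geometric rate from derivatives to
    increments. *)
Lemma uniform_limit (f g : nat -> K -> K) (G : K -> K) c r (C : R) a : 0 < r ->
  (forall k z, inball c r z -> deriv_at N (f k) z (g k z)) ->
  (forall k z, inball c r z -> N (g k z - G z) <= C * 2^-1 ^+ k) ->
  (forall k, f k c = a) ->
  exists F, [/\ F c = a, forall z, inball c r z -> deriv_at N F z (G z)
    & forall k z, inball c r z -> N (f k z - F z) <= 4 * C * r * 2^-1 ^+ k].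
Proof.
move=> r0 df hG fa; have cr := inball_center c r0.
have C0 : 0 <= C.
  by have := hG 0%N _ cr; rewrite expr0 mulr1; apply: le_trans; exact: av_ge0.
have w0 k : 0 < 2^-1 ^+ k :> R by rewrite exprn_gt0 // invr_gt0 ltr0n.
have wS k : 2^-1 ^+ k.+1 = 2^-1 * 2^-1 ^+ k :> R by rewrite exprS.
have hd k x y : inball c r x -> inball c r y ->
    N ((f k.+1 y - f k y) - (f k.+1 x - f k x)) <= 2 * C * 2^-1 ^+ k * N (y - x).
  move=> xr yr; apply: (@av_mean_value_ball (fun z => f k.+1 z - f k z)
    (fun z => g k.+1 z - g k z) _ c r) => // z zr _; split.
    by apply: deriv_atB; exact: df.
  have := avBD N (g k.+1 z) (G z) (g k z); rewrite (avB N (G z) (g k z)).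
  have := hG k _ zr; have := hG k.+1 _ zr; rewrite wS;
    have := mulr_ge0 C0 (ltW (w0 k)); lra.
have [F hF] : exists F : K -> K, forall z, inball c r z ->
    forall k, N (f k z - F z) <= 2 * (2 * C * r) * 2^-1 ^+ k.
  suff /choice[F hF] : forall z, exists l, inball c r z ->
      forall k, N (f k z - l) <= 2 * (2 * C * r) * 2^-1 ^+ k by exists F.
  move=> z; have [zr|nz] := pselect (inball c r z); last by exists 0.
  have [l hl] : exists l, forall n, N (f n z - l) <= 2 * (2 * C * r) * 2^-1 ^+ n.
    apply: (@av_complete _ _ N (fun k => f k z)) => n.
    have := hd n c z cr zr; rewrite !fa subrr subr0 => h; apply: le_trans h _.
    rewrite [X in _ <= X]mulrAC; apply: ler_wpM2l; last exact: ltW.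
    by rewrite !mulr_ge0 // ltW.
  by exists l.
(* [F] is not yet known to be differentiable, so the increments of f_k - F are bounded as limits of
   increments of f_n. *)
have lip k x y : inball c r x -> inball c r y ->
    N (f k y - f k x - (F y - F x)) <= 4 * C * N (y - x) * 2^-1 ^+ k.
  move=> xr yr.
  have [l hl] : exists l, forall n,
    N ((f n y - f n x) - l) <= 2 * (2 * C * N (y - x)) * 2^-1 ^+ n.
    apply: (@av_complete _ _ N (fun k => f k y - f k x)) => n.
    rewrite (_ : f n.+1 y - f n.+1 x - _ = (f n.+1 y - f n y) - (f n.+1 x - f n
      x)); last by ring.
    by apply: le_trans (hd n x y xr yr) _; lra.
  suff <- : l = F y - F x by have := hl k; lra.
  apply/subr0_eq/(@av_eq0 _ _ N)/eqP; rewrite eq_le av_ge0 andbT.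
  apply: (@le_half_pow R _ (2 * (2 * C * N (y - x)) + 2 * (2 * (2 * C * r)))) => n.
  have := hF _ xr n; have := hF _ yr n; have := hl n.
  rewrite (_ : l - (F y - F x) = - (f n y - f n x - l) + ((f n y - F y) - (f n
    x - F x))); last by ring.
  have := avD N (- (f n y - f n x - l)) ((f n y - F y) - (f n x - F x)).
  have := avD N (f n y - F y) (- (f n x - F x)); rewrite !avN; lra.
exists F; split; last by move=> k z zr; have := hF z zr k; lra.
  apply/subr0_eq/(@av_eq0 _ _ N)/eqP; rewrite eq_le av_ge0 andbT.
  apply: (@le_half_pow R _ (2 * (2 * C * r))) => n.
  by rewrite avB; have := hF _ cr n; rewrite fa.
move=> x xr e e0.
(* The increments contribute 4 C and the derivatives C, so 5 C 2^-k must stay below e / 2; the added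
   1 keeps the divisor positive when C = 0. *)
have C1 : 0 < 2 * (5 * C + 1) by lra.
have [k hk] := half_small (divr_gt0 e0 C1).
have hk' : 2 * (5 * C + 1) * 2^-1 ^+ k < e by rewrite mulrC -ltr_pdivlMr.
have e20 : 0 < e / 2 by lra.
have [d d0 hdk] := df k _ xr _ e20.
exists (Order.min d (r - N (x - c))); first by rewrite lt_min d0 subr_gt0.
move=> y; rewrite lt_min => /andP[yd yr'].
have yr : inball c r y by rewrite /inball; have := avBD N y x c; lra.
have := hdk _ yd; have := lip k _ _ xr yr; have := hG k _ xr.
rewrite (_ : F y - F x - G x * (y - x) = - (f k y - f k x - (F y - F x))
  + ((f k y - f k x - g k x * (y - x)) + (g k x - G x) * (y - x))); last by ring.
set A := f k y - f k x - (F y - F x); set B := f k y - f k x - g k x * (y - x).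
have := avD N (- A) (B + (g k x - G x) * (y - x));
  have := avD N B ((g k x - G x) * (y - x)).
rewrite avN avM; have := av_ge0 N (y - x); set n := N (y - x) => n0.
move: (N (g k x - G x)) => gg h1 h2 hg hA hB.
have : gg * n <= C * 2^-1 ^+ k * n by rewrite ler_wpM2r.
have : 2 * (5 * C + 1) * 2^-1 ^+ k * n <= e * n by rewrite ler_wpM2r // ltW.
have := mulr_ge0 (ltW (w0 k)) n0; have := w0 k; move: (2^-1 ^+ k) hA => w hA _.
move: h1 h2 hB; move: (N A) (N B) hA (N _) (N _) => nA nB hA n1 n2; lra.
Qed.

End DerivAt.

(** * Primitives and linear systems *)

Section Picard.
Context (R : realType) (K : numFieldType) (N : absval R K).
Implicit Types (f g : K -> K) (x y z c : K) (r : R).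

Lemma av_sum n (F : nat -> K) :
  N (\sum_(0 <= i < n) F i) <= \sum_(0 <= i < n) N (F i).
Proof.
elim: n => [|n IHn]; first by rewrite !big_nil av0.
by rewrite !big_nat_recr //=; apply: le_trans (avD _ _ _) _; rewrite lerD2r.
Qed.

(* Riemann sums of [f] from [c] to [z]: their derivatives are Riemann sums of
   [d/ds (s f(c + s (z - c)))] over [0, 1], and so tend to [f z]. *)
Lemma riemann_sum f f1 f2 (M : R) c r n : 0 < r -> (0 < n)%N ->
  (forall z, inball N c r z -> [/\ deriv_at N f z (f1 z), deriv_at N f1 z (f2 z),
     N (f1 z) <= M & N (f2 z) <= M]) ->
  exists F g : K -> K, [/\ F c = 0, forall z, inball N c r z -> deriv_at N F z (g z)
    & forall z, inball N c r z -> N (g z - f z) <= (M * r + M * r ^+ 2) / n%:R].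
Proof.
move=> r0 n0 h.
have M0 : 0 <= M.
  by have [_ _ h1 _] := h _ (inball_center N c r0); apply: le_trans h1; exact: av_ge0.
have nK : (n%:R : K) != 0 by rewrite pnatr_eq0 -lt0n.
have nR : 0 < (n%:R : R) by rewrite ltr0n.
pose s z := (z - c) / n%:R; pose p j z := c + j%:R * s z.
have Ns z : N (s z) = N (z - c) / n%:R by rewrite /s avM avV av_nat.
have pr j z : (j <= n)%N -> inball N c r z -> inball N c r (p j z).
  move=> jn; apply: le_lt_trans; rewrite /p [c + _]addrC addrK avM av_nat Ns.
  rewrite mulrCA -[X in _ <= X]mulr1 ler_wpM2l ?av_ge0 //.
  by rewrite ler_pdivrMr // mul1r ler_nat.
have ds z : deriv_at N s z n%:R^-1.
  have := deriv_atM (deriv_atB (deriv_at_id N z) (deriv_at_cst N c z))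
    (deriv_at_cst N n%:R^-1 z).
  by move=> /deriv_at_eq; apply; rewrite mulr0 add0r subr0 mulr1.
have dp j z : deriv_at N (p j) z (j%:R / n%:R).
  have := deriv_atD (deriv_at_cst N c z) (deriv_atZ j%:R (ds z)).
  by move=> /deriv_at_eq; apply; rewrite add0r.
exists (fun z => s z * \sum_(0 <= j < n) f (p j z)).
exists (fun z => s z * (\sum_(0 <= j < n) f1 (p j z) * (j%:R / n%:R))
         + (\sum_(0 <= j < n) f (p j z)) * n%:R^-1).
split; first by rewrite /s subrr mul0r mul0r.
  move=> z zr; apply: deriv_atM (ds z) _.
  apply: (@deriv_at_sum _ _ N n (fun j z => f (p j z)) z (fun j =>
    f1 (p j z) * (j%:R / n%:R))) => j jn.
  apply: deriv_at_comp (dp j z) _.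
  by have [] := h _ (pr j z (ltnW jn) zr).
move=> z zr.
(* f(z) telescopes as the sum of the increments of (j/n) f(p_j), to be compared term by term with
   the derivative of the Riemann sum. *)
pose phi j := j%:R / n%:R * f (p j z).
have fz : f z = \sum_(0 <= j < n) (phi j.+1 - phi j).
  rewrite telescope_sumr // /phi mul0r mul0r subr0 divff // mul1r.
  by rewrite /p /s mulrC divfK // subrKC.
rewrite fz mulr_sumr mulr_suml -big_split -sumrB /=.
apply: le_trans (av_sum _ _) _.
have -> : (M * r + M * r ^+ 2) / n%:R =
    \sum_(0 <= j < n) ((M * r + M * r ^+ 2) / n%:R ^+ 2).
  rewrite sumr_const_nat subn0 -mulr_natr expr2; field; exact: lt0r_neq0.
apply: ler_sum_nat => j /andP[_ jn].
have pj := pr _ _ (ltnW jn) zr; have pj1 := pr _ _ jn zr.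
have pp : p j.+1 z - p j z = s z by rewrite /p -natr1; ring.
(* Of the two errors, the mean value inequality bounds the first by M r / n^2, and the Taylor
   estimate bounds the second by M r^2 / n^2. *)
rewrite /phi (_ : _ - _ = - (n%:R^-1 * (f (p j.+1 z) - f (p j z))
   + j%:R / n%:R * (f (p j.+1 z) - f (p j z) - f1 (p j z) * s z))); last first.
  by rewrite -natr1; field.
rewrite avN; apply: le_trans (avD _ _ _) _; rewrite !avM !avV !av_nat.
have h1 : N (f (p j.+1 z) - f (p j z)) <= M * N (s z).
  rewrite -pp; apply: (@av_mean_value_ball _ _ N f f1 _ c r) => // w wr _.
  by have [] := h _ wr.
have h2 : N (f (p j.+1 z) - f (p j z) - f1 (p j z) * s z) <= M * N (s z) ^+ 2.
  rewrite -pp; apply: (@av_taylor _ _ N f f1 f2 M c r) => // w wr.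
  by have [] := h _ wr.
have jn1 : j%:R / n%:R <= 1 :> R by rewrite ler_pdivrMr // mul1r ler_nat ltnW.
have jn0 : 0 <= j%:R / n%:R :> R by rewrite divr_ge0 ?ler0n.
have sr : N (s z) <= r / n%:R by rewrite Ns ler_pM2r ?invr_gt0 // ltW.
have s0 := av_ge0 N (s z).
have i0 : 0 < n%:R^-1 :> R by rewrite invr_gt0.
rewrite -exprVn.
have e1 : n%:R^-1 * N (f (p j.+1 z) - f (p j z)) <= n%:R^-1 * (M * (r / n%:R)).
  rewrite ler_pM2l //; apply: le_trans h1 _; exact: ler_wpM2l.
have e2 : j%:R / n%:R * N (f (p j.+1 z) - f (p j z) - f1 (p j z) * s z) <= 1 *
  (M * (r / n%:R) ^+ 2).
  apply: ler_pM => //; first exact: av_ge0.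
  apply: le_trans h2 _; apply: ler_wpM2l => //.
  by rewrite lerXn2r // nnegrE divr_ge0 // ltW.
apply: le_trans (lerD e1 e2) _.
rewrite le_eqVlt; apply/orP; left; apply/eqP.
by move: (n%:R^-1 : R) => i; ring.
Qed.

Lemma primitive f f1 f2 (M : R) c r a : 0 < r ->
  (forall z, inball N c r z -> [/\ deriv_at N f z (f1 z), deriv_at N f1 z (f2 z),
     N (f1 z) <= M & N (f2 z) <= M]) ->
  exists F : K -> K, F c = a /\ forall z, inball N c r z -> deriv_at N F z (f z).
Proof.
move=> r0 h.
(* Subdividing into 2^k pieces turns the error of order 1/n into the geometric one used by
   [uniform_limit]. *)
have pow k : (0 < 2 ^ k)%N by rewrite expn_gt0.
have /choice[F /choice[g hF]] := fun k => riemann_sum r0 (pow k) h.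
have [G [Gc dG _]] : exists G, [/\ G c = 0, forall z, inball N c r z ->
  deriv_at N G z (f z)
    & forall k z, inball N c r z ->
      N (F k z - G z) <= 4 * (M * r + M * r ^+ 2) * r * 2^-1 ^+ k].
  apply: (@uniform_limit _ _ N F g f c r) => //.
  - by move=> k; have [_] := hF k.
  - by move=> k z zr; have [_ _ /(_ z zr)] := hF k; rewrite natrX -exprVn.
  by move=> k; have [] := hF k.
exists (fun z => a + G z); rewrite Gc addr0; split=> // z zr.
have := deriv_atD (deriv_at_cst N a z) (dG z zr).
by rewrite add0r.
Qed.

(** What [primitive] needs, in a form that survives Picard iteration: on a ball of finite radius a
    primitive of such a function is again of this kind, with f and f1 as its derivatives. *)
Definition bounded_C2 c r f := exists f1 f2 : K -> K, exists M : R,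
  forall z, inball N c r z -> [/\ deriv_at N f z (f1 z), deriv_at N f1 z (f2 z)
    & [/\ N (f z) <= M, N (f1 z) <= M & N (f2 z) <= M]].

Lemma bounded_C2_cst c r (a : K) : bounded_C2 c r (fun=> a).
Proof.
exists (fun=> 0), (fun=> 0), (N a) => z _; split; [exact: deriv_at_cst..|].
by split; rewrite ?av0 ?av_ge0.
Qed.

Lemma bounded_C2D c r f g : bounded_C2 c r f -> bounded_C2 c r g ->
  bounded_C2 c r (fun z => f z + g z).
Proof.
move=> [f1 [f2 [M hf]]] [g1 [g2 [M' hg]]].
exists (fun z => f1 z + g1 z), (fun z => f2 z + g2 z), (M + M') => z zr.
have [df df1 [a0 a1 a2]] := hf _ zr; have [dg dg1 [b0 b1 b2]] := hg _ zr.
split; [exact: deriv_atD..|].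
by split; apply: le_trans (avD _ _ _) _; exact: lerD.
Qed.

Lemma bounded_C2M c r f g : bounded_C2 c r f -> bounded_C2 c r g ->
  bounded_C2 c r (fun z => f z * g z).
Proof.
move=> [f1 [f2 [M hf]]] [g1 [g2 [M' hg]]].
exists (fun z => f z * g1 z + g z * f1 z).
exists (fun z => (f z * g2 z + g1 z * f1 z) + (g z * f2 z + f1 z * g1 z)).
exists (4 * (M * M')) => z zr.
have [df df1 [a0 a1 a2]] := hf _ zr; have [dg dg1 [b0 b1 b2]] := hg _ zr.
split; first exact: deriv_atM.
  by apply: deriv_atD; exact: deriv_atM.
have [Mp Mp'] : 0 <= M /\ 0 <= M'.
  by split; [apply: le_trans a0|apply: le_trans b0]; exact: av_ge0.
have MM := mulr_ge0 Mp Mp'.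
have mul u v : N u <= M -> N v <= M' -> N (u * v) <= M * M'.
  by move=> hu hv; rewrite avM; apply: ler_pM => //; exact: av_ge0.
have c00 := mul _ _ a0 b0; have c01 := mul _ _ a0 b1; have c02 := mul _ _ a0 b2.
have c10 := mul _ _ a1 b0; have c11 := mul _ _ a1 b1; have c20 := mul _ _ a2 b0.
rewrite (mulrC (g1 z)) (mulrC (g z) (f1 z)) (mulrC (g z) (f2 z)); split; first lra.
  by have := avD N (f z * g1 z) (f1 z * g z); lra.
have := avD N (f z * g2 z + f1 z * g1 z) (f2 z * g z + f1 z * g1 z).
have := avD N (f z * g2 z) (f1 z * g1 z).
by have := avD N (f2 z * g z) (f1 z * g1 z); lra.
Qed.

Lemma bounded_primitive c r f a : 0 < r -> bounded_C2 c r f ->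
  exists F : K -> K, [/\ F c = a, bounded_C2 c r F &
    forall z, inball N c r z -> deriv_at N F z (f z)].
Proof.
move=> r0 [f1 [f2 [M h]]].
have cr := inball_center N c r0.
have M0 : 0 <= M by have [_ _ [h0 _ _]] := h _ cr; apply: le_trans h0; exact: av_ge0.
have [F [Fc dF]] : exists F : K -> K, F c = a /\ forall z, inball N c r z ->
  deriv_at N F z (f z).
  by apply: (@primitive f f1 f2 M) => // z /h[? ? []].
exists F; split=> //; exists f, f1, (N a + M * r + M) => z zr.
have [df df1 [h0 h1 h2]] := h _ zr.
have Mr : 0 <= M * r by rewrite mulr_ge0 // ltW.
have Na := av_ge0 N a.
split=> //; first exact: dF; split; [|lra..].
have := @av_mean_value_ball _ _ N F f M c r c z cr zr; rewrite Fc => hm.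
have {}hm : N (F z - a) <= M * N (z - c).
  by apply: hm => w wr _; split; [exact: dF|have [_ _ []] := h _ wr].
have : M * N (z - c) <= M * r by rewrite ler_wpM2l // ltW.
by have := avD N (F z - a) a; rewrite subrK; lra.
Qed.

(** The bounds on r make one Picard step halve the distance between iterates: the u-part gains the
    factor r <= 1/2 and the v-part 2 r M <= 1/2. *)
Lemma linear_system c r (A0 A1 b : K -> K) (M : R) (al be : K) :
  0 < r -> r <= 1 / 2 -> 2 * r * M <= 1 / 2 ->
  bounded_C2 c r A0 -> bounded_C2 c r A1 -> bounded_C2 c r b ->
  (forall z, inball N c r z -> N (A0 z) <= M /\ N (A1 z) <= M) ->
  exists u v : K -> K, [/\ u c = al, v c = be &
    forall z, inball N c r z -> deriv_at N u z (v z) /\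
      deriv_at N v z (b z - A1 z * v z - A0 z * u z)].
Proof.
move=> r0 r1 rM BA0 BA1 Bb hM; have cr := inball_center N c r0.
have M0 : 0 <= M by have [h0 _] := hM _ cr; apply: le_trans h0; exact: av_ge0.
pose rhs (p : (K -> K) * (K -> K)) z := b z - A1 z * p.2 z - A0 z * p.1 z.
pose good (p : (K -> K) * (K -> K)) :=
  [/\ bounded_C2 c r p.1, bounded_C2 c r p.2, p.1 c = al & p.2 c = be].
have step (p : {p | good p}) : {q : {q | good q} | forall z, inball N c r z ->
    deriv_at N (sval q).1 z ((sval p).2 z) /\ deriv_at N (sval q).2 z (rhs (sval p) z)}.
  case: p => -[u v] [/= Bu Bv uc vc]; apply: cid.
  have [u' [uc' Bu' du']] := bounded_primitive al r0 Bv.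
  have Brhs : bounded_C2 c r (rhs (u, v)).
    rewrite /rhs /= (_ : (fun z => _) = fun z =>
      b z + (-1 * (A1 z * v z) + -1 * (A0 z * u z))).
      apply: bounded_C2D => //; apply: bounded_C2D; apply: bounded_C2M;
        by [exact: bounded_C2_cst|exact: bounded_C2M].
    by apply/funext => z; ring.
  have [v' [vc' Bv' dv']] := bounded_primitive be r0 Brhs.
  have gd : good (u', v') by [].
  by exists (exist _ _ gd) => z zr /=; split; [exact: du'|exact: dv'].
have g0 : good (fun=> al, fun=> be) by split=> //; exact: bounded_C2_cst.
pose s := fix s n := if n is m.+1 then sval (step (s m)) else exist _ _ g0.
pose u n := (sval (s n)).1; pose v n := (sval (s n)).2.
have uc n : u n c = al by have [] := svalP (s n).
have vc n : v n c = be by have [] := svalP (s n).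
have du n z : inball N c r z -> deriv_at N (u n.+1) z (v n z).
  by move=> zr; have [] := svalP (step (s n)) z zr.
have dv n z : inball N c r z ->
  deriv_at N (v n.+1) z (b z - A1 z * v n z - A0 z * u n z).
  by move=> zr; have [] := svalP (step (s n)) z zr.
have w0 k : 0 < 2^-1 ^+ k :> R by rewrite exprn_gt0 // invr_gt0 ltr0n.
have wS k : 2^-1 ^+ k.+1 = 2^-1 * 2^-1 ^+ k :> R by rewrite exprS.
have [C C0 hC0] : exists2 C, 0 <= C & forall z, inball N c r z ->
    N (u 1%N z - u 0%N z) <= C /\ N (v 1%N z - v 0%N z) <= C.
  have [[? [? [Mu hu]]] [? [? [Mv hv]]] _ _] := svalP (s 1%N).
  have [_ _ [hc _ _]] := hu _ cr; have [_ _ [hc' _ _]] := hv _ cr.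
  have := av_ge0 N (u 1%N c); have := av_ge0 N (v 1%N c) => q1 q2.
  have := av_ge0 N al; have := av_ge0 N be => q3 q4.
  have p1 : 0 <= Mu by apply: le_trans hc.
  have p2 : 0 <= Mv by apply: le_trans hc'.
  exists (Mu + Mv + N al + N be) => [|z zr]; first by rewrite !addr_ge0.
  have [_ _ [h1 _ _]] := hu _ zr; have [_ _ [h2 _ _]] := hv _ zr.
  have := avD N (u 1%N z) (- al); have := avD N (v 1%N z) (- be); rewrite !avN.
  by move=> h3 h4; split; [apply: le_trans h4 _|apply: le_trans h3 _];
    rewrite -/(u 1%N) -/(v 1%N) in h1 h2 *; lra.
have hC n z : inball N c r z ->
    N (u n.+1 z - u n z) <= C * 2^-1 ^+ n /\ N (v n.+1 z - v n z) <= C * 2^-1 ^+ n.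
  elim: n z => [|n IHn] z zr; first by rewrite expr0 mulr1; exact: hC0.
  have zc : N (z - c) <= r by exact: ltW.
  have Cw : 0 <= C * 2^-1 ^+ n by rewrite mulr_ge0 // ltW.
  split.
    have := @av_mean_value_ball _ _ N (fun z => u n.+2 z - u n.+1 z)
      (fun z => v n.+1 z - v n z) (C * 2^-1 ^+ n) c r c z cr zr.
    rewrite !uc subrr subr0 => hm.
    have {}hm : N (u n.+2 z - u n.+1 z) <= C * 2^-1 ^+ n * N (z - c).
      apply: hm => w wr _; split; first by apply: deriv_atB; exact: du.
      by have [] := IHn w wr.
    apply: le_trans hm _; apply: le_trans (_ : _ <= C * 2^-1 ^+ n * (1 / 2)) _.
      by rewrite ler_wpM2l //; exact: le_trans r1.
    by rewrite wS; lra.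
  have := @av_mean_value_ball _ _ N (fun z => v n.+2 z - v n.+1 z)
    (fun z => (b z - A1 z * v n.+1 z - A0 z * u n.+1 z) - (b z - A1 z * v n z -
      A0 z * u n z))
    (2 * M * (C * 2^-1 ^+ n)) c r c z cr zr.
  rewrite !vc subrr subr0 => hm.
  have {}hm : N (v n.+2 z - v n.+1 z) <= 2 * M * (C * 2^-1 ^+ n) * N (z - c).
    apply: hm => w wr _; split; first by apply: deriv_atB; exact: dv.
    have [k1 k2] := IHn w wr; have [m0 m1] := hM _ wr.
    rewrite (_ : _ - _ = - (A1 w * (v n.+1 w - v n w) + A0 w * (u n.+1 w - u n
      w))); last by ring.
    rewrite avN; apply: le_trans (avD _ _ _) _; rewrite !avM.
    have := ler_pM (av_ge0 N _) (av_ge0 N _) m1 k2.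
    have := ler_pM (av_ge0 N _) (av_ge0 N _) m0 k1.
    lra.
  apply: le_trans hm _.
  have := ler_wpM2l (mulr_ge0 (mulr_ge0 (ler0n R 2) M0) Cw) zc.
  have := ler_wpM2r Cw rM; rewrite wS; lra.
have lims (f : nat -> K -> K) : (forall n z, inball N c r z ->
  N (f n.+1 z - f n z) <= C * 2^-1 ^+ n) ->
    exists F : K -> K, forall z, inball N c r z ->
      forall n, N (f n z - F z) <= 2 * C * 2^-1 ^+ n.
  move=> hf; suff /choice[F hF] : forall z, exists l, inball N c r z ->
      forall k, N (f k z - l) <= 2 * C * 2^-1 ^+ k by exists F.
  move=> z; have [zr|nz] := pselect (inball N c r z); last by exists 0.
  have [l hl] : exists l, forall n, N (f n z - l) <= 2 * C * 2^-1 ^+ n.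
    by apply: (@av_complete _ _ N (fun k => f k z)) => n; exact: hf.
  by exists l.
have [ul hul] := lims u (fun n z zr => (hC n z zr).1).
have [vl hvl] := lims v (fun n z zr => (hC n z zr).2).
have uniq (f : nat -> K -> K) (F G : K -> K) C1 C2 z :
    (forall n, N (f n z - F z) <= C1 * 2^-1 ^+ n) ->
    (forall n, N (f n.+1 z - G z) <= C2 * 2^-1 ^+ n) -> F z = G z.
  move=> h1 h2; apply/subr0_eq/(@av_eq0 _ _ N)/eqP; rewrite eq_le av_ge0 andbT.
  apply: (@le_half_pow R _ (C1 / 2 + C2)) => n.
  have := h1 n.+1; have := h2 n; rewrite wS.
  by have := avBD N (F z) (f n.+1 z) (G z); rewrite (avB N (F z) (f n.+1 z)); lra.
(* Differentiability of the limit needs the limit [vl] of the derivatives first, so limits are taken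
   twice: pointwise as [ul], [vl], then with derivatives as [U], [V]. Uniqueness of limits
   identifies them. *)
have [U [Uc dU hU]] : exists F, [/\ F c = al, forall z, inball N c r z ->
  deriv_at N F z (vl z)
    & forall k z, inball N c r z -> N (u k.+1 z - F z) <= 4 * (2 * C) * r * 2^-1 ^+ k].
  apply: (@uniform_limit _ _ N (fun k => u k.+1) v vl) => //.
  by move=> k z zr; exact: hvl.
have [V [Vc dV hV]] : exists F, [/\ F c = be, forall z, inball N c r z ->
      deriv_at N F z (b z - A1 z * vl z - A0 z * ul z)
    & forall k z, inball N c r z ->
      N (v k.+1 z - F z) <= 4 * (4 * M * C) * r * 2^-1 ^+ k].
  apply: (@uniform_limit _ _ N (fun k => v k.+1)
    (fun k z => b z - A1 z * v k z - A0 z * u k z)) => //.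
  move=> k z zr.
  rewrite (_ : _ - _ = - (A1 z * (v k z - vl z) + A0 z * (u k z - ul z))); last by ring.
  rewrite avN; apply: le_trans (avD _ _ _) _; rewrite !avM.
  have [m0 m1] := hM _ zr.
  have := ler_pM (av_ge0 N _) (av_ge0 N _) m1 (hvl _ zr k).
  have := ler_pM (av_ge0 N _) (av_ge0 N _) m0 (hul _ zr k).
  lra.
exists U, V; split=> // z zr.
have eV : vl z = V z by apply: uniq (hvl _ zr) (fun k => hV k _ zr).
have eU : ul z = U z by apply: uniq (hul _ zr) (fun k => hU k _ zr).
by rewrite -eV -eU; split; [exact: dU|exact: dV].
Qed.

End Picard.

(** * Inversion of functions with derivative close to 1 *)

Section InverseFunction.
Context (R : realType) (K : numFieldType) (N : absval R K).
Variables (f f1 : K -> K) (c : K) (r : R).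
Hypothesis df : forall z, inball N c r z -> deriv_at N f z (f1 z).
Hypothesis f1near : forall z, inball N c r z -> N (f1 z - 1) <= 1 / 2.

Lemma near_isometry x y : inball N c r x -> inball N c r y ->
  N ((f y - f x) - (y - x)) <= 1 / 2 * N (y - x).
Proof.
move=> xr yr; rewrite (_ : _ - (y - x) = (f y - y) - (f x - x)); last by ring.
apply: (@av_mean_value_ball _ _ N (fun z => f z - z) (fun z =>
  f1 z - 1) _ c r) => // z zr _.
by split; [apply: deriv_atB (deriv_at_id N z); exact: df|exact: f1near].
Qed.

Lemma expanding x y : inball N c r x -> inball N c r y ->
  N (y - x) <= 2 * N (f y - f x).
Proof.
move=> xr yr; have := near_isometry xr yr.
have := avBD N (y - x) (f y - f x) 0; rewrite !subr0 (avB N (y - x)); lra.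
Qed.

Lemma image_inner x : inball N c r x -> exists2 d, 0 < d &
  forall y, N (y - f x) < d -> exists2 x', inball N c r x' & f x' = y.
Proof.
(* The iterates stay within 2 h of x, hence within half of the distance left to the boundary of the
   ball. *)
move=> xr; exists ((r - N (x - c)) / 4); first by rewrite divr_gt0 // subr_gt0.
move=> y; set h := N (y - f x) => hd; have h0 : 0 <= h by exact: av_ge0.
(* A fixed point of m -> m + (y - f m) solves f m = y, and this map contracts by 1/2 because f - id
   does. *)
pose s := fix s n := if n is m.+1 then s m + (y - f (s m)) else x.
have w0 k : 0 < 2^-1 ^+ k :> R by rewrite exprn_gt0 // invr_gt0 ltr0n.
have hs n : N (s n - x) <= 2 * h - 2 * h * 2^-1 ^+ n /\ N (s n.+1 - s n) <= h *
  2^-1 ^+ n.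
  have ball m : N (m - x) <= 2 * h -> inball N c r m.
    by move=> hm; rewrite /inball; have := avBD N m x c; lra.
  have hw m : 0 <= h * 2^-1 ^+ m by rewrite mulr_ge0 // ltW.
  elim: n => [|n [IH1 IH2]].
    by rewrite /= expr0 !mulr1 !subrr av0 lexx addrC addKr.
  have IH1' : N (s n.+1 - x) <= 2 * h - 2 * h * 2^-1 ^+ n.+1.
    by have := avBD N (s n.+1) (s n) x; rewrite exprS; lra.
  split=> //.
  have b1 : inball N c r (s n) by apply: ball; have := hw n; lra.
  have b2 : inball N c r (s n.+1) by apply: ball; have := hw n.+1; lra.
  rewrite (_ : s n.+2 - s n.+1 = - ((f (s n.+1) - f (s n)) - (s n.+1 - s n))).
    by rewrite avN; have := near_isometry b1 b2; rewrite [2^-1 ^+ n.+1]exprS; lra.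
  by rewrite /=; ring.
have [l hl] : exists l, forall n, N (s n - l) <= 2 * h * 2^-1 ^+ n.
  by apply: av_complete => n; have [] := hs n.
have bl : inball N c r l.
  by have := hl 0%N; rewrite /= expr0 mulr1 avB /inball => hx;
    have := avBD N l x c; lra.
exists l => //; apply/subr0_eq/(@av_eq0 _ _ N)/eqP; rewrite eq_le av_ge0 andbT.
apply: (@le_half_pow R _ (4 * h)) => n.
have bn : inball N c r (s n).
  have [h1 _] := hs n; rewrite /inball; have := avBD N (s n) x c;
    have := mulr_ge0 h0 (ltW (w0 n)); lra.
have [_ h2] := hs n; have h3 := hl n; have h4 := near_isometry bl bn.
have h5 : N (f (s n) - y) <= h * 2^-1 ^+ n.
  by rewrite avB; move: h2; rewrite /= addrC addKr.
rewrite (_ : f l - y = (f (s n) - y) - ((f (s n) - f l - (s n - l)) + (s n -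
  l))); last by ring.
have := avD N (f (s n) - y) (- ((f (s n) - f l - (s n - l)) + (s n - l))).
have := avD N (f (s n) - f l - (s n - l)) (s n - l); rewrite avN.
lra.
Qed.

Lemma local_inverse : exists g : K -> K, (forall x, inball N c r x -> g (f x) = x) /\
  forall x, inball N c r x -> deriv_at N g (f x) (f1 x)^-1.
Proof.
have /choice[g hg] : forall y, exists x, (exists2 x', inball N c r x' & f x' = y) ->
    inball N c r x /\ f x = y.
  move=> y; have [[x xr fx]|n] :=
    pselect (exists2 x', inball N c r x' & f x' = y); last by exists 0.
  by exists x.
have gK x : inball N c r x -> g (f x) = x.
  move=> xr; have [gr e] := hg (f x) (ex_intro2 _ _ x xr erefl).
  apply/subr0_eq/(@av_eq0 _ _ N)/eqP; rewrite eq_le av_ge0 andbT.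
  by have := expanding xr gr; rewrite e subrr av0 mulr0.
exists g; split=> // x xr e e0.
have m0 : 1 / 2 <= N (f1 x).
  have := f1near xr; have := avBD N 1 (f1 x) 0; rewrite !subr0 av1 (avB N 1); lra.
have mV : N (f1 x)^-1 <= 2.
  by rewrite avV -[2]invrK lef_pV2 ?posrE; lra.
have f10 : f1 x != 0 by apply/eqP => z; move: m0; rewrite z av0; lra.
(* One factor 2 is lost in the bound on 1 / f1(x) and another in [expanding]. *)
have e40 : 0 < e / 4 by lra.
have [d d0 hd] := df xr e40; have [d' d'0 hd'] := image_inner xr.
exists (Order.min d' (d / 2)); first by rewrite lt_min d'0; lra.
move=> y; rewrite lt_min => /andP[/hd' [z zr <-] yd].
rewrite !gK //; have h1 := expanding xr zr.
have zd : N (z - x) < d by lra.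
have h2 := hd _ zd.
rewrite (_ : z - x - _ = - ((f1 x)^-1 * (f z - f x - f1 x * (z - x)))); last by field.
rewrite avN avM.
have := ler_pM (av_ge0 N _) (av_ge0 N _) mV h2.
have : e / 4 * N (z - x) <= e / 4 * (2 * N (f z - f x)) by rewrite ler_wpM2l // ltW.
lra.
Qed.

End InverseFunction.

(** * Local straightening *)

(** Applied to u U = 1, u V = -w and u tau = s, it describes derivatives of the quotients by
    implicit Leibniz relations. *)
Lemma derive_product2 (K : numFieldType) (D : set K^o) (f g h : K^o -> K^o) :
  open D -> nsmooth D 1 f -> nsmooth D 1 g -> (forall t, D t -> f t * g t = h t) ->
  forall t, D t -> d1 h t = f t * d1 g t + g t * d1 f t /\
    d1 (d1 h) t = f t * d1 (d1 g) t + 2 * d1 f t * d1 g t + g t * d1 (d1 f) t.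
Proof.
move=> oD sf sg fg.
have nD t : D t -> \forall s \near t, D s by move=> Dt; exact: open_nbhs_nbhs.
have df t : D t -> derivable f t 1 by move=> Dt; apply/diff_derivable/(nsmooth_diff sf).
have dg t : D t -> derivable g t 1 by move=> Dt; apply/diff_derivable/(nsmooth_diff sg).
have ddf t : D t -> derivable (d1 f) t 1.
  by move=> Dt; apply/diff_derivable/(nsmooth_diff (nsmooth_d1 sf)).
have ddg t : D t -> derivable (d1 g) t 1.
  by move=> Dt; apply/diff_derivable/(nsmooth_diff (nsmooth_d1 sg)).
have E1 t : D t -> d1 h t = f t * d1 g t + g t * d1 f t.
  move=> Dt; rewrite -(@near_eq_derive _ _ _ (f * g)); last first.
    by apply: filterS (nD _ Dt) => s Ds; rewrite -fg.
  by rewrite (deriveM (df _ Dt) (dg _ Dt)).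
move=> t Dt; split; first exact: E1.
rewrite (@near_eq_derive _ _ _ _ (f * d1 g + g * d1 f)); last first.
  by apply: filterS (nD _ Dt) => s Ds; rewrite E1.
rewrite (deriveD (derivableM (df _ Dt) (ddg _ Dt)) (derivableM (dg _ Dt) (ddf _ Dt))).
rewrite (deriveM (df _ Dt) (ddg _ Dt)) (deriveM (dg _ Dt) (ddf _ Dt)) /GRing.scale /=.
move: ('D_1 ('D_1 f) t) ('D_1 ('D_1 g) t) ('D_1 f t) ('D_1 g t) (f t) (g t) =>
  f2 g2 f1 g1 f0 g0.
ring.
Qed.

Section Straighten.
Context (R : realType) (K : numFieldType) (N : absval R K).

Lemma inball_open (c : K) (r : R) : open (inball N c r : set K^o).
Proof.
rewrite openE => z zr; apply/(nbhs_avP N); exists (r - N (z - c));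
  first by rewrite subr_gt0.
by move=> y yz; rewrite /inball; have := avBD N y z c; lra.
Qed.

Lemma nsmooth_deriv_at (D : set K^o) n (f : K^o -> K^o) t : nsmooth D n f -> D t ->
  deriv_at N f t (d1 f t).
Proof.
move=> sf Dt; apply/deriv_atP/derivableP; apply: diff_derivable.
exact: nsmooth_diff sf Dt.
Qed.

Lemma continuous_bounded (f : K^o -> K^o) (t : K^o) : {for t, continuous f} ->
  \forall s \near t, N (f s) <= N (f t) + 1.
Proof.
move=> cf; have : nbhs (f t) [set y | N y <= N (f t) + 1].
  apply/(nbhs_avP N); exists 1 => // y yt /=.
  by have := avBD N y (f t) 0; rewrite !subr0; lra.
exact: cf.
Qed.

Lemma smooth_bounded_C2 (D : set K^o) (f : K^o -> K^o) t : open D ->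
  (forall n, nsmooth D n f) -> D t ->
  exists2 r0, 0 < r0 & forall r, r <= r0 -> bounded_C2 N t r f /\
    forall s, inball N t r s -> D s /\ N (f s) <= N (f t) + 1.
Proof.
move=> oD sf Dt; have nD : \forall s \near t, D s by exact: open_nbhs_nbhs.
have cn (g : K^o -> K^o) : nsmooth D 0 g -> {for t, continuous g}.
  by move=> sg; apply: differentiable_continuous; exact: nsmooth_diff sg Dt.
have c0 := continuous_bounded (cn _ (sf 0%N)).
have c1 := continuous_bounded (cn _ (nsmooth_d1 (sf 1%N))).
have c2 := continuous_bounded (cn _ (nsmooth_d1 (nsmooth_d1 (sf 2%N)))).
have [r0 r00 hr0] := (nbhs_avP N t _).1 (filterI nD (filterI c0 (filterI c1 c2))).
have bound (x y z x' y' z' : R) : 0 <= x -> 0 <= y -> 0 <= z ->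
    x' <= x + 1 -> y' <= y + 1 -> z' <= z + 1 ->
    [/\ x' <= x + 1 + (y + 1) + (z + 1), y' <= x + 1 + (y + 1) + (z + 1)
      & z' <= x + 1 + (y + 1) + (z + 1)].
  by move=> *; split; lra.
exists r0 => // r rr0.
have hr s : inball N t r s -> N (s - t) < r0 by move=> h; exact: lt_le_trans rr0.
split; last by move=> s /hr/hr0 [? []].
exists (d1 f), (d1 (d1 f)).
exists ((N (f t) + 1) + (N (d1 f t) + 1) + (N (d1 (d1 f) t) + 1)) =>
  s /hr/hr0 [Ds [h0 [h1 h2]]].
split; first exact: nsmooth_deriv_at (sf 0%N) Ds.
  exact: nsmooth_deriv_at (nsmooth_d1 (sf 1%N)) Ds.
exact: bound (av_ge0 N _) (av_ge0 N _) (av_ge0 N _) h0 h1 h2.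
Qed.

(** Bootstrap: the equations express u' and v' through u, v and smooth functions, so order n for the
    pair gives order n + 1. *)
Lemma solution_smooth (E : linear_ode K) (D : set K^o) (u v be : K^o -> K^o) :
  open D -> D `<=` odom E -> (forall n, nsmooth D n be) ->
  (forall t, D t -> deriv_at N u t (v t) /\
     deriv_at N v t (be t - oa1 E t * v t - oa0 E t * u t)) ->
  (forall n, nsmooth D n u) /\ (forall t, D t -> d1 u t = v t /\
     d1 (d1 u) t = be t - oa1 E t * d1 u t - oa0 E t * u t).
Proof.
move=> oD DE sb h.
have du t : D t -> is_derive (t : K^o) (1 : K^o) u (v t) by move=> /h[/deriv_atP].
have dv t : D t -> is_derive (t : K^o) (1 : K^o) v (be t - oa1 E t * v t - oa0
  E t * u t).
  by move=> /h[_ /deriv_atP].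
have s1 n : nsmooth D n (oa1 E).
  by apply: nsmooth_subset DE _; move: n; apply/smooth_onP; exact: (@oa1_smooth _ E).
have s0 n : nsmooth D n (oa0 E).
  by apply: nsmooth_subset DE _; move: n; apply/smooth_onP; exact: (@oa0_smooth _ E).
have fu t : D t -> differentiable u t.
  by move=> Dt; apply/derivable1_diffP; exact: (@ex_derive _ _ _ _ _ _ _ (du _ Dt)).
have fv t : D t -> differentiable v t.
  by move=> Dt; apply/derivable1_diffP; exact: (@ex_derive _ _ _ _ _ _ _ (dv _ Dt)).
have eu t : D t -> d1 u t = v t by move=> Dt;
  exact: (@derive_val _ _ _ _ _ _ _ (du _ Dt)).
have ev t : D t -> d1 v t = be t - oa1 E t * v t - oa0 E t * u t.
  by move=> Dt; exact: (@derive_val _ _ _ _ _ _ _ (dv _ Dt)).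
have suv n : nsmooth D n u /\ nsmooth D n v.
  elim: n => [|n [IHu IHv]]; first by [].
  split; apply: nsmooth1 => //.
    by apply: nsmooth_eq IHv => // t Dt; rewrite eu.
  apply: (@nsmooth_eq _ _ _ oD _ _ (fun t => be t - oa1 E t * v t - oa0 E t * u t)).
    by move=> t Dt; rewrite ev.
  apply: nsmoothB => //; first apply: nsmoothB => //; exact: nsmoothM.
split=> [n|t Dt]; first by have [] := suv n.
split; first exact: eu.
rewrite (@near_eq_derive _ _ _ _ v); first by rewrite ev // eu.
by apply: filterS (open_nbhs_nbhs (conj oD Dt)) => s Ds; rewrite eu.
Qed.

Definition solves (E : linear_ode K) (D : set K^o) (be u : K^o -> K^o) : Prop :=
  (forall n, nsmooth D n u) /\
  forall t, D t -> d1 (d1 u) t = be t - oa1 E t * d1 u t - oa0 E t * u t.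

(** By linearity the contraction condition involves only bounds on a1 and a0, so one radius serves
    the homogeneous and inhomogeneous equations and all initial values. *)
Lemma local_solutions (E : linear_ode K) (t0 : K^o) : odom E t0 ->
  exists2 r, 0 < r & (inball N t0 r : set K^o) `<=` odom E /\
    forall be : K^o -> K^o, be = ob E \/ be = (fun=> 0) -> forall al al' : K,
    exists u, [/\ solves E (inball N t0 r) be u, u t0 = al & d1 u t0 = al'].
Proof.
move=> Et0; have oE := @odom_open _ E.
have s1 n : nsmooth (odom E) n (oa1 E) by move: n; apply/smooth_onP;
  exact: (@oa1_smooth _ E).
have s0 n : nsmooth (odom E) n (oa0 E) by move: n; apply/smooth_onP;
  exact: (@oa0_smooth _ E).
have sb n : nsmooth (odom E) n (ob E) by move: n; apply/smooth_onP;
  exact: (@ob_smooth _ E).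
have [r1 r10 h1] := smooth_bounded_C2 oE s1 Et0.
have [r2 r20 h0] := smooth_bounded_C2 oE s0 Et0.
have [r3 r30 hb] := smooth_bounded_C2 oE sb Et0.
pose M := (N (oa1 E t0) + 1) + (N (oa0 E t0) + 1).
have [M1 M2] : N (oa1 E t0) + 1 <= M /\ N (oa0 E t0) + 1 <= M.
  by have := av_ge0 N (oa1 E t0); have := av_ge0 N (oa0 E t0); rewrite /M; lra.
have M0 : 0 < M by have := av_ge0 N (oa1 E t0); lra.
(* The radii r1, r2, r3 ensure bounded coefficients with two bounded derivatives; 1/2 and 1/(4M) are
   the contraction conditions of [linear_system]. *)
pose r := Order.min (Order.min r1 r2) (Order.min r3 (Order.min (1 / 2) (1 / 2 /
  (2 * M)))).
have r0 : 0 < r.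
  rewrite !lt_min r10 r20 r30 /=; apply/andP; split; first lra.
  by rewrite divr_gt0 //; lra.
have : r <= r by [].
rewrite {2}/r !le_min => /andP[/andP[rr1 rr2] /and3P[rr3 rhalf rM]].
have BE : (inball N t0 r : set K^o) `<=` odom E by move=> t /(h1 _ rr1).2[].
exists r => //; split=> // be hbe al al'.
have [sbe Bbe] : (forall n, nsmooth (inball N t0 r) n be) /\ bounded_C2 N t0 r be.
  case: hbe => ->; last by split; [move=> n; exact: nsmooth_cst|exact: bounded_C2_cst].
  by split; [move=> n; exact: nsmooth_subset BE (sb n)|exact: (hb _ rr3).1].
have [||u [v [u0 v0 h]]] :=
  @linear_system _ _ N t0 r (oa0 E) (oa1 E) be M al al' r0 rhalf _ (h0 _ rr2).1
  (h1 _ rr1).1 Bbe.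
- by move: rM; rewrite ler_pdivlMr; lra.
- move=> z zr; have [_ k0] := (h0 _ rr2).2 _ zr;
  have [_ k1] := (h1 _ rr1).2 _ zr; split; lra.
have [su hu] := solution_smooth (@inball_open t0 r) BE sbe h.
exists u; split=> //; first by split=> // t /hu[].
by rewrite (hu _ (inball_center N t0 r0)).1.
Qed.

End Straighten.

Section PushedZero.
Context (K : numFieldType).

(** The letters stand for values and first two derivatives at one point. Each Leibniz relation is
    solved for its highest derivative; the remaining variables are free, and the claims become field
    identities. *)
Lemma pushed_zero_algebra
    (u u1 u2 w w1 w2 s s1 s2 T T1 T2 U U1 U2 V V1 V2 a1 a0 b : K) :
  u != 0 -> T1 != 0 ->
  u2 = 0 - a1 * u1 - a0 * u -> s2 = 0 - a1 * s1 - a0 * s ->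
  w2 = b - a1 * w1 - a0 * w ->
  u * U = 1 -> u * V = - w -> u * T = s ->
  0 = u * U1 + U * u1 -> 0 = u * U2 + 2 * u1 * U1 + U * u2 ->
  - w1 = u * V1 + V * u1 -> - w2 = u * V2 + 2 * u1 * V1 + V * u2 ->
  s1 = u * T1 + T * u1 -> s2 = u * T2 + 2 * u1 * T1 + T * u2 ->
  [/\ (T2 / T1 + a1 - 2 * U1 / U) / T1 = 0,
      ((2 * U1 ^+ 2 / U - U2 - a1 * U1) / U + a0) / T1 ^+ 2 = 0
    & (U * b + V2 + a1 * V1 + a0 * V - 2 * U1 * V1 / U
       + (2 * U1 ^+ 2 / U - U2 - a1 * U1) * V / U) / T1 ^+ 2 = 0].
Proof.
move=> u0 T10 hu2 hs2 hw2 hU hV hT hU1 hU2 hV1 hV2 hs1 hs'.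
have solve x y : u * x = y -> x = y / u by move=> <-; rewrite mulrC mulKf.
have eU : U = u^-1 by rewrite (solve _ _ hU) mul1r.
have eV := solve _ _ hV.
have eU1 : U1 = - (U * u1) / u by apply: solve; rewrite -[RHS]add0r hU1 addrK.
have eU2 : U2 = - (2 * u1 * U1 + U * u2) / u.
  by apply: solve; apply/subr0_eq; rewrite opprK addrA -hU2.
have eV1 : V1 = (- w1 - V * u1) / u by apply: solve; rewrite hV1 addrK.
have eV2 : V2 = (- w2 - 2 * u1 * V1 - V * u2) / u.
  by apply: solve; rewrite hV2; ring.
have eT2 : T2 = (s2 - 2 * u1 * T1 - T * u2) / u by apply: solve; rewrite hs'; ring.
move: eT2 eV2 eU2; rewrite hs2 hs1 -hT hu2 hw2 eV1 eU1 eV eU => -> -> ->.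
by split; field; rewrite ?u0 ?T10.
Qed.

Lemma pushed_zero (c : chart K) (E : linear_ode K) (u s w : K^o -> K^o) :
  (forall n, nsmooth (cdom c) n u) -> (forall n, nsmooth (cdom c) n s) ->
  (forall n, nsmooth (cdom c) n w) ->
  (forall t, cdom c t -> d1 (d1 u) t = 0 - oa1 E t * d1 u t - oa0 E t * u t) ->
  (forall t, cdom c t -> d1 (d1 s) t = 0 - oa1 E t * d1 s t - oa0 E t * s t) ->
  (forall t, cdom c t -> d1 (d1 w) t = ob E t - oa1 E t * d1 w t - oa0 E t * w t) ->
  (forall t, cdom c t -> u t != 0) ->
  (forall t, cdom c t -> cU c t = (u t)^-1) ->
  (forall t, cdom c t -> cV c t = - w t / u t) ->
  (forall t, cdom c t -> ctau c t = s t / u t) ->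
  forall t, cdom c t -> pushed_elts c E t = 0.
Proof.
move=> su ss sw eu es ew u0 hU hV hT t Bt; have oB := @cdom_open _ c.
have k0 (a : K) : d1 (fun=> a : K^o) t = 0 by exact: derive_cst.
have kf (a : K) : d1 (fun=> a : K^o) = (fun=> 0) :> (K^o -> K^o).
  by apply/funext => x; exact: derive_cst.
have kk (a : K) : d1 (d1 (fun=> a : K^o)) t = 0 by rewrite (kf a); exact: derive_cst.
have eqU (x : K^o) : cdom c x -> u x * cU c x = 1 by move=> Bx;
  rewrite hU // mulfV // u0.
have eqV (x : K^o) : cdom c x -> u x * cV c x = - w x.
  by move=> Bx; rewrite hV // mulrC divfK // u0.
have eqT (x : K^o) : cdom c x -> u x * ctau c x = s x.
  by move=> Bx; rewrite hT // mulrC divfK // u0.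
(* Viewing -w as the product of -1 and w lets the same product rule give its first two
   derivatives. *)
have eqW (x : K^o) : cdom c x -> -1 * w x = - w x by rewrite mulN1r.
have [U1 U2] := derive_product2 oB (su 1%N) (cU_nsmooth c 1) eqU Bt.
have [V1 V2] := derive_product2 oB (su 1%N) (cV_nsmooth c 1) eqV Bt.
have [T1 T2] := derive_product2 oB (su 1%N) (ctau_nsmooth c 1) eqT Bt.
have sm : nsmooth (cdom c) 1 (fun=> -1 : K^o) by exact: nsmooth_cst.
have [W1 W2] := derive_product2 oB sm (sw 1%N) eqW Bt.
rewrite (k0 1) in U1; rewrite (kk 1) in U2.
rewrite W1 (k0 (-1)) mulr0 addr0 mulN1r in V1.
have aux (x y z p q : K) : z = 0 -> q = 0 -> -1 * x + 2 * z * y + p * q = - x.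
  by move=> -> ->; ring.
rewrite W2 (aux _ _ _ _ _ (k0 (-1)) (kk (-1))) in V2.
have [p1 p0 pb] := pushed_zero_algebra (u0 _ Bt) (dtau_neq0 Bt) (eu _ Bt) (es _ Bt)
  (ew _ Bt) (eqU _ Bt) (eqV _ Bt) (eqT _ Bt) U1 U2 V1 V2 T1 T2.
by rewrite /pushed_elts /push1 /push0 /pushb p1 p0 pb; apply: row3P; rewrite !mxE.
Qed.

End PushedZero.

Section Straightening.
Context (R : realType) (K : numFieldType) (N : absval R K).

(** Bootstrap on g' = 1 / f'(g): if g has order n, so has the right-hand side, and g gains one
    order. *)
Lemma local_inverse_smooth (D : set K^o) (f g : K^o -> K^o) :
  open D -> open (f @` D) -> (forall n, nsmooth D n f) ->
  (forall t, D t -> g (f t) = t) -> (forall t, D t -> d1 f t != 0) ->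
  (forall t, D t -> deriv_at N g (f t) (d1 f t)^-1) ->
  forall n, nsmooth (f @` D) n g.
Proof.
move=> oD oI sf gK f0 dg.
have dgs s : (f @` D) s -> is_derive (s : K^o) (1 : K^o) g (d1 f (g s))^-1.
  by move=> [t Dt <-]; rewrite gK //; apply/deriv_atP; exact: dg.
have fg s : (f @` D) s -> differentiable g s.
  by move=> Ds; apply/derivable1_diffP; exact: (@ex_derive _ _ _ _ _ _ _ (dgs _ Ds)).
have Dg s : (f @` D) s -> D (g s) by move=> [t Dt <-]; rewrite gK.
elim=> [|n IHn]; first by [].
apply: nsmooth1 => //.
apply: (@nsmooth_eq _ _ _ oI _ _ (fun s => (d1 f (g s))^-1 : K^o)).
  by move=> s Ds; rewrite (@derive_val _ _ _ _ _ _ _ (dgs _ Ds)).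
apply: (nsmoothV oI); first by move=> s /Dg; exact: f0.
exact: (nsmooth_comp1 oI Dg IHn (nsmooth_d1 (sf n.+1))).
Qed.

Lemma straightening_of_absval (E : linear_ode K) (z : 'rV[K]_2) : odom E (comp0 z) ->
  exists c, [/\ straightens c E, chart_set c z & chart_fun c z = 0].
Proof.
move: (row2E z); move: (comp0 z) (comp1 z) => t0 x0 zE Et0.
have [r r0 [rE sol]] := local_solutions N Et0.
have [u [[su eu] u0 u1]] := sol (fun=> 0) (or_intror erefl) 1 0.
have [s [[ss es] s0 s1]] := sol (fun=> 0) (or_intror erefl) 0 1.
have [w [[sw ew] w0 w1]] := sol (ob E) (or_introl erefl) x0 0.
pose D0 : set K^o := inball N t0 r; have oD0 : open D0 by exact: inball_open.
have D0t : D0 t0 by exact: inball_center.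
pose D1 : set K^o := D0 `&` u @^-1` [set x | x != 0].
have cu t : D0 t -> {for t, continuous u}.
  by move=> Dt; apply: differentiable_continuous; exact: nsmooth_diff (su 0%N) Dt.
have oD1 : open D1.
  apply: open_setI_preimage => //; rewrite openE => x xn0.
  apply/(nbhs_avP N); exists (N x); first exact: av_gt0.
  by move=> y; apply: contraTneq => ->; rewrite sub0r avN ltxx.
have D1t : D1 t0 by split=> //=; rewrite u0 oner_eq0.
pose tau t : K^o := s t / u t.
have D10 : D1 `<=` D0 by move=> t [].
have stau n : nsmooth D1 n tau.
  apply: (nsmoothM oD1); first exact: nsmooth_subset D10 (ss n).
  by apply: (nsmoothV oD1); [move=> t []|exact: nsmooth_subset D10 (su n)].
(* The Wronskian-type normalization u = s' = 1, u' = 0 at t0 makes tau' equal to 1 there, the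
   setting in which [local_inverse] applies after shrinking the interval or disc. *)
have dtau0 : d1 tau t0 = 1.
  have eqT x : D1 x -> u x * tau x = s x.
    by move=> [_ ux]; rewrite /tau mulrC divfK.
  have [e _] := derive_product2 oD1 (nsmooth_subset D10 (su 1%N)) (stau 1%N) eqT D1t.
  by move: e; rewrite s1 u0 u1 mul1r mulr0 addr0.
have cdtau : {for t0, continuous (d1 tau)}.
  apply: differentiable_continuous.
  exact: nsmooth_diff (nsmooth_d1 (stau 1%N)) D1t.
have n1 : \forall t \near t0, N (d1 tau t - 1) <= 1 / 2.
  have : nbhs (d1 tau t0) [set y | N (y - 1) <= 1 / 2].
    apply/(nbhs_avP N); exists (1 / 2); first lra.
    by rewrite dtau0 => y yh /=; exact: ltW.
  exact: cdtau.
have nD1 : \forall t \near t0, D1 t by exact: open_nbhs_nbhs.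
have [q q0 hq] := (nbhs_avP N t0 _).1 (filterI nD1 n1).
pose D : set K^o := inball N t0 q; have oD : open D by exact: inball_open.
have Dt0 : D t0 by exact: inball_center.
have DD1 : D `<=` D1 by move=> t /hq[].
have DD0 : D `<=` D0 by move=> t /DD1/D10.
have hd t : inball N t0 q t -> deriv_at N tau t (d1 tau t).
  by move=> Dt; exact: nsmooth_deriv_at (stau 0%N) (DD1 _ Dt).
have hd1 t : inball N t0 q t -> N (d1 tau t - 1) <= 1 / 2 by move=> /hq[].
have [g [gK dg]] := local_inverse hd hd1.
have oI : open (tau @` D).
  rewrite openE => _ [t Dt <-]; have [d d0 hdd] := image_inner hd hd1 Dt.
  by apply/(nbhs_avP N); exists d => // y /hdd[t' Dt' <-]; exists t'.
have sD n (f : K^o -> K^o) : (forall n, nsmooth D0 n f) -> nsmooth D n f.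
  by move=> sf; exact: nsmooth_subset DD0 (sf n).
have un0 t : D t -> u t != 0 by move=> /DD1[].
have dtaun0 t : D t -> d1 tau t != 0.
  move=> Dt; apply/eqP => e; have := hd1 _ Dt.
  by rewrite e sub0r avN av1; lra.
have sg := local_inverse_smooth oD oI (fun n =>
  nsmooth_subset DD1 (stau n)) gK dtaun0 dg.
have sU n : nsmooth D n (fun t => (u t)^-1 : K^o).
  by apply: (nsmoothV oD) => //; exact: sD.
have sV n : nsmooth D n (fun t => - w t / u t : K^o).
  by apply: (nsmoothM oD) => //; apply: (nsmoothN oD); exact: sD.
have U0 t : D t -> (u t)^-1 != 0 by move=> /un0; rewrite invr_eq0.
pose c : chart K := @Chart K D tau g (fun t => (u t)^-1) (fun t => - w t / u t) oD oI
  ((smooth_onP _ _).2 (fun n => nsmooth_subset DD1 (stau n)))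
  ((smooth_onP _ _).2 sg) ((smooth_onP _ _).2 sU) ((smooth_onP _ _).2 sV) U0 gK.
have Bz : chart_set c z by rewrite -zE /chart_set /= /comp0 row2_0.
exists c; split=> //; last first.
  rewrite -zE; apply: row2P;
    rewrite ?row2_0 ?row2_1 /= /comp0 /comp1 row2_0 ?row2_1 mxE.
    by rewrite /tau s0 mul0r.
  by rewrite u0 w0 invr1 mul1r mulr1 subrr.
split; first by move=> t /DD0/rE.
apply: (@pushed_zero K c E u s w) => //.
- by move=> n; exact: sD.
- by move=> n; exact: sD.
- by move=> n; exact: sD.
- by move=> t /DD0; exact: eu.
- by move=> t /DD0; exact: es.
- by move=> t /DD0; exact: ew.
Qed.

Theorem classification_of_absval :
  [/\ groupoid_generated_via_free K, semi_normalized K & ~ normalized K].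
Proof.
split; [apply: generated_of_straightening|apply:
  semi_normalized_of_straightening|exact: not_normalized];
  exact: straightening_of_absval.
Qed.

End Straightening.

(** * The real and the complex fields *)

(** The intervals of radius 2 C 2^-n around u_n are nested, and the supremum of their left ends lies
    in all of them. *)
Lemma real_geometric_complete (R : realType) (u : nat -> R) (C : R) :
  (forall n, `|u n.+1 - u n| <= C * 2^-1 ^+ n) ->
  exists l, forall n, `|u n - l| <= 2 * C * 2^-1 ^+ n.
Proof.
move=> hu; pose w n : R := 2 * C * 2^-1 ^+ n.
have C0 : 0 <= C by have := hu 0%N; rewrite expr0 mulr1; apply: le_trans.
have w0 n : 0 <= w n by rewrite mulr_ge0 ?mulr_ge0 ?exprn_ge0 ?invr_ge0.
have step n : u n - w n <= u n.+1 - w n.+1 /\ u n.+1 + w n.+1 <= u n + w n.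
  by have := hu n; rewrite ler_norml /w exprS => /andP[? ?]; split; lra.
have mono n k : u n - w n <= u (n + k)%N - w (n + k)%N /\
    u (n + k)%N + w (n + k)%N <= u n + w n.
  elim: k => [|k [IH1 IH2]]; first by rewrite addn0.
  by have [s1 s2] := step (n + k)%N; rewrite addnS; split; lra.
have le_ab n m : u n - w n <= u m + w m.
  have [h1 _] := mono n m; have [_ h2] := mono m n; rewrite addnC in h2.
  by have := w0 (n + m)%N; lra.
pose A := range (fun n => u n - w n).
have ubA m : ubound A (u m + w m) by move=> _ [n _ <-].
have A0 : A !=set0 by exists (u 0%N - w 0%N); exists 0%N.
exists (sup A) => n; rewrite ler_distl; apply/andP; split.
  by rewrite lerBlDr; apply: ge_sup.
rewrite -lerBlDr; apply: ub_le_sup; first by exists (u 0%N + w 0%N); exact: ubA.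
by exists n.
Qed.

Definition real_absval (R : realType) : absval R R.
Proof.
apply: (@AbsVal R R (fun x => `|x|)) => //.
- by move=> x /normr0_eq0.
- exact: normrM.
- exact: ler_normD.
- by move=> n; rewrite normr_nat.
- by move=> e e0; exists e.
- by move=> d d0; exists d.
move=> u C /real_geometric_complete[l hl]; exists l, (2 * C); exact: hl.
Defined.

(** The norm on [R[i]] takes values in [R[i]] itself; its real part is the real-valued modulus.
    Completeness reduces to real and imaginary parts. *)
Definition complex_absval (R : realType) : absval R R[i].
Proof.
have NE (z : R[i]) : `|z| = (complex.Re `|z|)%:C%C by rewrite normc_def.
have ReE (z : R[i]) : `|complex.Re z| <= complex.Re `|z| /\ `|complex.Im z| <=
  complex.Re `|z|.
  rewrite normc_def /= -!sqrtr_sqr; split; apply: ler_wsqrtr.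
    by rewrite lerDl sqr_ge0.
  by rewrite lerDr sqr_ge0.
have leN (z : R[i]) : complex.Re `|z| <= `|complex.Re z| + `|complex.Im z|.
  rewrite normc_def /= -[X in _ <= X]ger0_norm ?addr_ge0 // -sqrtr_sqr.
  apply: ler_wsqrtr; rewrite sqrrD !real_normK ?num_real //.
  by rewrite addrAC lerDl mulrn_wge0 // mulr_ge0.
apply: (@AbsVal R R[i] (fun z => complex.Re `|z|)).
- by move=> z; rewrite normc_def /= sqrtr_ge0.
- by move=> z h; apply: normr0_eq0; rewrite NE h.
- by move=> x y; rewrite normrM NE (NE y) /= mulr0 subr0.
- move=> x y; have := ler_normD x y; rewrite lecE => /andP[_].
  by rewrite raddfD.
- by move=> n; rewrite normr_nat raddfMn.
(* A positive element of [R[i]] has zero imaginary part, so its real part is a valid threshold. *)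
- move=> e; rewrite ltcE /= => /andP[/eqP e0 re]; exists (complex.Re e) => // x hx.
  by rewrite ltcE hx andbT (NE x) /= -e0.
- move=> d d0; exists d%:C%C; first by rewrite ltcE /= eqxx.
  by move=> x; rewrite ltcE => /andP[].
move=> u C hu.
have [a ha] : exists l, forall n, `|complex.Re (u n) - l| <= 2 * C * 2^-1 ^+ n.
  apply: real_geometric_complete => n; apply: le_trans (hu n).
  by have [+ _] := ReE (u n.+1 - u n); rewrite raddfB.
have [b hb] : exists l, forall n, `|complex.Im (u n) - l| <= 2 * C * 2^-1 ^+ n.
  apply: real_geometric_complete => n; apply: le_trans (hu n).
  by have [_] := ReE (u n.+1 - u n); rewrite raddfB.
exists (a +i* b)%C, (2 * C + 2 * C) => n.
apply: le_trans (leN _) _; rewrite !raddfB /=.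
by have := ha n; have := hb n; lra.
Defined.

Theorem proposition2 (R : realType) (K : numFieldType)
  (hK : K = R :> numFieldType \/ K = R[i]%C :> numFieldType) :
  [/\ groupoid_generated_via_free K,
      semi_normalized K
    & ~ normalized K].
Proof.
by case: hK => ->; [exact: classification_of_absval (real_absval R)
                   |exact: classification_of_absval (complex_absval R)].
Qed.
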